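(* Let $r\ge2$ and let $F$ be an $r$-critical graph with $f$ vertices. If $q=q(n)$ satisfies $q/n^2\to0$ and $q/n\to\infty$ as $n\to\infty$, then \[h_F(n,q)=(\beta_F+o(1))\,q\,n^{f-2}.\]
   Context: A graph $F$ is $r$-critical if $\chi(F)=r+1$ and $F$ contains an edge $e$ with $\chi(F-e)=r$. $h_F(n,q)$ is the minimum number of subgraphs isomorphic to $F$ in a graph with $n$ vertices and $\mathrm{ex}(n,F)+q$ edges, where $\mathrm{ex}(n,F)$ is the Turán number. A vertex $u$ of $F$ is critical if $\chi(F-u)=r$. Let $\mathrm{Aut}(F)$ be the number of automorphisms of $F$. For $\boldsymbol{\xi}\in\mathbb{R}^r$, $P_F(\boldsymbol{\xi})=\frac{1}{\mathrm{Aut}(F)}\sum_{u\text{ critical}}\sum_{\chi_u}\prod_{i=1}^r r^{-x_i}\xi_i^{y_i}$, the inner sum over proper colorings $\chi_u:V(F)\setminus\{u\}\to[r]$ of $F-u$, with $y_i$ (resp. $x_i$) the number of neighbors (resp. non-neighbors other than $u$) of $u$ colored $i$. Let $\mathcal{S}_\rho=\{\boldsymbol{\xi}\in[0,1/r]^r:\sum_i\xi_i=\rho\}$ and $p(\rho)=\min\{P_F(\boldsymbol{\xi}):\boldsymbol{\xi}\in\mathcal{S}_\rho\}$. Define $\beta_F=\inf\{p(\rho)/(\rho-(1-1/r)):\ \rho\in(1-1/r,1]\}$. *)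

(* Defs.v *)
From HB Require Import structures.
From mathcomp Require Import all_boot all_order all_algebra all_fingroup.
From mathcomp Require Import all_classical all_reals all_analysis.

Set Implicit Arguments.
Unset Strict Implicit.
Unset Printing Implicit Defensive.

Import Order.TTheory GRing.Theory Num.Theory.

Definition simple_graph (n : nat) (E : {set {set 'I_n}}) : bool :=
  [forall e in E, #|e| == 2].

Definition adj (n : nat) (E : {set {set 'I_n}}) (x y : 'I_n) : bool :=
  (x != y) && ([set x; y] \in E).

Definition colorable_on (n : nat) (E : {set {set 'I_n}}) (U : {set 'I_n})
    (k : nat) : bool :=
  [exists c : {ffun 'I_n -> 'I_k},
    [forall x in U, forall y in U, adj E x y ==> (c x != c y)]].

Lemma colorable_on_ex (n : nat) (E : {set {set 'I_n}}) (U : {set 'I_n}) :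
  exists k, colorable_on E U k.
Proof.
exists n; apply/existsP; exists [ffun x => x].
apply/forall_inP => x _; apply/forall_inP => y _; apply/implyP.
by case/andP; rewrite !ffunE.
Qed.

Definition chi_on (n : nat) (E : {set {set 'I_n}}) (U : {set 'I_n}) : nat :=
  ex_minn (colorable_on_ex E U).

Definition chi (n : nat) (E : {set {set 'I_n}}) : nat := chi_on E [set: 'I_n].

Definition r_critical (f r : nat) (EF : {set {set 'I_f}}) : Prop :=
  chi EF = r.+1 /\ exists2 e, e \in EF & chi (EF :\ e) = r.

Definition copies (f n : nat) (EF : {set {set 'I_f}}) (E : {set {set 'I_n}})
    : nat :=
  #|[set UH : {set 'I_n} * {set {set 'I_n}} |
      [&& UH.2 \subset E,
          [forall h in UH.2, h \subset UH.1] &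
          [exists phi : {ffun 'I_f -> 'I_n},
             [&& injectiveb phi, phi @: [set: 'I_f] == UH.1 &
                 [forall x, forall y,
                    ([set x; y] \in EF) == ([set phi x; phi y] \in UH.2)]]]]]|.

Definition ex_num (f : nat) (EF : {set {set 'I_f}}) (n : nat) : nat :=
  \max_(E : {set {set 'I_n}} | simple_graph E && (copies EF E == 0)) #|E|.

Definition admissible (f : nat) (EF : {set {set 'I_f}}) (n q : nat)
    (E : {set {set 'I_n}}) : bool :=
  simple_graph E && (#|E| == ex_num EF n + q).

(* h_F(n,q): minimum number of copies of F in a graph on n vertices with
   ex(n,F)+q edges (conventionally 0 if no such graph exists). *)
Definition hF (f : nat) (EF : {set {set 'I_f}}) (n q : nat) : nat :=
  match [pick E : {set {set 'I_n}} | admissible EF q E] with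
  | Some E0 => copies EF [arg min_(E < E0 | admissible EF q E) copies EF (E : {set {set 'I_n}})]
  | None => 0
  end.

Definition aut (f : nat) (EF : {set {set 'I_f}}) : nat :=
  #|[set s : {perm 'I_f} |
      [forall x, forall y, ([set s x; s y] \in EF) == ([set x; y] \in EF)]]|.

Definition critical_vertex (f r : nat) (EF : {set {set 'I_f}}) (u : 'I_f)
    : bool :=
  chi_on EF ([set: 'I_f] :\ u) == r.

(* a proper r-colouring of F - u, encoded as c : 'I_f -> option 'I_r with
   c x = None exactly when x = u *)
Definition coloring_minus (f r : nat) (EF : {set {set 'I_f}}) (u : 'I_f)
    (c : {ffun 'I_f -> option 'I_r}) : bool :=
  [forall x, (c x == None) == (x == u)] &&
  [forall x, forall y, adj EF x y ==> (c x != c y)].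

Definition ycnt (f r : nat) (EF : {set {set 'I_f}}) (u : 'I_f)
    (c : {ffun 'I_f -> option 'I_r}) (i : 'I_r) : nat :=
  #|[set x | adj EF u x && (c x == Some i)]|.

Definition xcnt (f r : nat) (EF : {set {set 'I_f}}) (u : 'I_f)
    (c : {ffun 'I_f -> option 'I_r}) (i : 'I_r) : nat :=
  #|[set x | [&& x != u, ~~ adj EF u x & c x == Some i]]|.

Local Open Scope ring_scope.

Definition PF (R : realType) (f r : nat) (EF : {set {set 'I_f}})
    (xi : 'I_r -> R) : R :=
  (aut EF)%:R^-1 *
  \sum_(u : 'I_f | critical_vertex r EF u)
    \sum_(c : {ffun 'I_f -> option 'I_r} | coloring_minus EF u c)
      \prod_(i < r) ((r%:R : R) ^- (xcnt EF u c i) * xi i ^+ (ycnt EF u c i)).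

Local Open Scope classical_set_scope.

Definition S_rho (R : realType) (r : nat) (rho : R) : set ('I_r -> R) :=
  [set xi | (forall i, 0 <= xi i <= (r%:R : R)^-1) /\ \sum_(i < r) xi i = rho].

Arguments S_rho {R} r rho.

Definition p_min (R : realType) (f r : nat) (EF : {set {set 'I_f}}) (rho : R)
    : R :=
  inf [set PF EF xi | xi in S_rho r rho].

Arguments p_min {R f} r EF rho.

Definition betaF (R : realType) (f r : nat) (EF : {set {set 'I_f}}) : R :=
  inf [set p_min r EF rho / (rho - (1 - (r%:R : R)^-1)) |
        rho in [set rho : R | 1 - (r%:R : R)^-1 < rho <= 1]].

Arguments betaF R {f} r EF.

(* Main.v *)
(** Lower bound. A graph with few copies of [F] has few cliques K_(r+1), because
    cloning vertices turns many cliques into many copies of a blow-up containing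
    [F]. If it also has density at least 1 - 1/r, the Moon-Moser inequalities are
    nearly tight, and a typical K_r then yields a partition into [r] parts with
    o(n^2) inner edges: the [i]-th part is the common neighbourhood of all but
    the [i]-th vertex. Take a partition with fewest inner edges. A vertex [x]
    with linearly many inner edges is the critical vertex of about P_F(xi) n^(f-1)
    copies, [xi] being its vector of degrees into the parts divided by [n], and
    it contributes (sum xi - (1 - 1/r)) n to the excess number of edges; each
    remaining inner edge lies in at least (betaF - o(1)) n^(f-2) copies using no
    other inner edge. Since betaF is at most P_F(xi) / (sum xi - (1 - 1/r)), summing
    gives the bound; vertices missing linearly many cross edges only decrease the
    excess.

    Upper bound. Join q / ((sum xi - (1 - 1/r)) n) new vertices with degree
    vector [xi n], for a nearly optimal [xi], to a balanced complete r-partite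
    graph. *)

Require Import Defs.
From HB Require Import structures.
From mathcomp Require Import all_boot all_order all_algebra all_fingroup.
From mathcomp Require Import all_classical all_reals all_analysis.
From mathcomp Require Import ring lra.
Set Implicit Arguments.
Unset Strict Implicit.
Unset Printing Implicit Defensive.
Import Order.TTheory GRing.Theory Num.Theory.
Import numFieldNormedType.Exports.
Local Open Scope ring_scope.

(** Cliques and homomorphisms are counted as functions on one fixed index set [J], constrained only
    on some coordinates. All counts then share the normalisation [N ^+ #|J|], a free coordinate is
    an independent uniform vertex, and a single resampling inequality serves both the Moon-Moser
    bounds and cloning. The obstacle in the lower bound is that every error must be o(q), while q
    may be barely superlinear. Closeness to the Turan graph alone allows a number k of heavy
    vertices as large as [eta * n], with errors of order [k ^ 2] and [eta * k * n] that can exceed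
    q. A first, crude count repairs this: each heavy vertex alone lies in a positive proportion of
    n^(f-1) copies, so k n = O(q) unless there are enough copies anyway. The hypothesis that q/n
    tends to infinity absorbs the terms linear in n, which come from rounding and from the estimate
    of ex(n,F). *)

Section Sums.
Variable R : realType.

Lemma natr_card (T : finType) (P : pred T) : (#|P|%:R : R) = \sum_x (P x)%:R.
Proof.
rewrite -sum1_card natr_sum [LHS]big_mkcond /=; apply: eq_bigr => x _.
by rewrite unfold_in; case: (P x).
Qed.

(** Lagrange's identity: twice the difference of the two sides is a double sum of squares. *)
Lemma cauchy_schwarz (T : finType) (g G : T -> R) :
  (\sum_x g x * G x) ^+ 2 <= (\sum_x g x ^+ 2) * (\sum_x G x ^+ 2).
Proof.
have h : 0 <= \sum_x \sum_y (g x * G y - g y * G x) ^+ 2.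
  by apply: sumr_ge0 => x _; apply: sumr_ge0 => y _; exact: sqr_ge0.
have E : \sum_x \sum_y (g x * G y - g y * G x) ^+ 2 =
   (\sum_x g x ^+ 2) * (\sum_x G x ^+ 2) *+ 2 - (\sum_x g x * G x) ^+ 2 *+ 2.
  transitivity (\sum_x \sum_y (g x ^+ 2 * G y ^+ 2 + G x ^+ 2 * g y ^+ 2
     - (g x * G x) * (g y * G y) *+ 2)).
    by apply: eq_bigr => x _; apply: eq_bigr => y _; ring.
  under eq_bigr do rewrite sumrB big_split /= -!mulr_sumr sumrMnl -mulr_sumr.
  rewrite sumrB big_split /= -!mulr_suml sumrMnl -mulr_suml; ring.
move: h; rewrite E subr_ge0 lerMn2r //=.
Qed.

Lemma sum_card_disjoint (I T : finType) (P : pred I) (S : I -> {set T}) (D : {set T}) :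
  (forall i, P i -> S i \subset D) ->
  (forall i j x, P i -> P j -> x \in S i -> x \in S j -> i = j) ->
  (\sum_(i | P i) #|S i| <= #|D|)%N.
Proof.
move=> sub dis.
rewrite (eq_bigr (fun i => \sum_(x in D) (x \in S i)))%N; last first.
  move=> i Pi; rewrite -sum1_card big_mkcond [RHS]big_mkcond /=.
  apply: eq_bigr => x _; have := fintype.subsetP (sub i Pi) x.
  by case: (x \in S i) => [/(_ isT) ->|_] //; case: ifP.
rewrite exchange_big /= -sum1_card; apply: leq_sum => x _.
case: (pickP (fun i => P i && (x \in S i))) => [i /andP[Pi xi]|h]; last first.
  by rewrite big1 // => i Pi; have := h i; rewrite Pi /= => ->.
rewrite (bigD1 i) //= xi big1 // => j /andP[Pj ji].
by apply/eqP; rewrite eqb0; apply: contra ji => xj; apply/eqP; exact: (dis _ _ x).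
Qed.

(** On the unit cube a product is 1-Lipschitz in each factor. Only downward deviations are bounded,
    since the products measure counts that are estimated from below. *)
Lemma prodr_lip (T : finType) (a z : T -> R) (k : R) : 0 <= k ->
  (forall x, 0 <= a x <= 1) -> (forall x, 0 <= z x <= 1) ->
  (forall x, z x - k <= a x) ->
  \prod_x z x - #|T|%:R * k <= \prod_x a x.
Proof.
move=> k0 a01 z01 zk.
rewrite cardE -!(big_enum) /=.
elim: (enum T) => [|x s IH]; first by rewrite !big_nil mul0r subr0.
rewrite !big_cons /= -natr1.
have A : 0 <= \prod_(i <- s) a i <= 1.
  by apply/andP; split; [apply: prodr_ge0 => y _; case/andP: (a01 y)|
    apply: prodr_ile1 => y _; exact: a01].
have Z : 0 <= \prod_(i <- s) z i <= 1.
  by apply/andP; split; [apply: prodr_ge0 => y _; case/andP: (z01 y)|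
    apply: prodr_ile1 => y _; exact: z01].
move: IH A Z (a01 x) (z01 x) (zk x).
move: (\prod_(j <- s) a j) (\prod_(j <- s) z j) => p1 p2.
have : 0 <= (size s)%:R * k by rewrite mulr_ge0 ?ler0n.
move: (size s)%:R => m mk IH /andP[A0 A1] /andP[Z0 Z1] /andP[x0 x1] /andP[y0 y1] h.
have H1 : z x * p2 <= a x * p2 + k by nra.
have H2 : a x * (p2 - m * k) <= a x * p1 by rewrite ler_wpM2l.
have H3 : a x * (m * k) <= m * k by rewrite ler_piMl.
lra.
Qed.

End Sums.

(** * Resampling one coordinate of a random function *)

Section Resample.
Variables (R : realType) (J T : finType).
Implicit Types (phi : {ffun J -> T}) (i w : J) (a : T).

Definition upd phi w a : {ffun J -> T} := [ffun z => if z == w then a else phi z].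

Lemma updE phi w a z : upd phi w a z = if z == w then a else phi z.
Proof. by rewrite ffunE. Qed.

Lemma upd_upd phi w a b : upd (upd phi w a) w b = upd phi w b.
Proof. by apply/ffunP => z; rewrite !ffunE; case: eqP. Qed.

Lemma updC phi i w a b : i != w -> upd (upd phi i a) w b = upd (upd phi w b) i a.
Proof.
move=> iw; apply/ffunP => z; rewrite !ffunE.
by case: (eqVneq z w) => [->|//]; rewrite eq_sym (negbTE iw).
Qed.

Lemma upd_id phi w : upd phi w (phi w) = phi.
Proof. by apply/ffunP => z; rewrite !ffunE; case: eqP => [->|]. Qed.

Lemma sum_upd w (h : {ffun J -> T} -> R) :
  \sum_phi \sum_a h (upd phi w a) = #|T|%:R * \sum_phi h phi.
Proof.
rewrite pair_bigA /=.
(* Swapping the spare value with the coordinate [w] is an involution on the pairs, so the updated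
   function is again uniform. *)
pose sw (p : {ffun J -> T} * T) := (upd p.1 w p.2, p.1 w).
have swK : cancel sw sw.
  by move=> [phi a]; rewrite /sw /= upd_upd upd_id updE eqxx.
rewrite (reindex sw) /=; last by exists sw => p _; exact: swK.
transitivity (\sum_(p : {ffun J -> T} * T) h p.1).
  by apply: eq_bigr => -[phi a] _ /=; rewrite upd_upd upd_id.
rewrite -(pair_bigA _ (fun phi (a : T) => h phi)) /=.
under eq_bigr do rewrite sumr_const.
by rewrite sumrMnl -[LHS]mulr_natl.
Qed.

(* Conditionally on the other coordinates, [phi i] and [phi w] are independent
   and equidistributed, so this is the Cauchy-Schwarz bound for a second
   moment. *)
Lemma resample_cs i w (g h : {ffun J -> T} -> R) : i != w -> (0 < #|T|)%N ->
  (forall phi a, g (upd phi w a) = g phi) ->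
  (forall phi a, h (upd phi i a) = h phi) ->
  (forall phi, h phi ^+ 2 = h phi) ->
  (forall phi, h phi * g phi = g phi) ->
  (\sum_phi g phi) ^+ 2 <=
    (\sum_phi h phi) * (\sum_phi g phi * g (upd phi i (phi w))).
Proof.
move=> iw T0 gw hi h2 hg.
pose G phi := \sum_a g (upd phi i a).
have SG : \sum_phi G phi = #|T|%:R * \sum_phi g phi by exact: sum_upd.
have hG phi : h phi * G phi = G phi.
  rewrite mulr_sumr; apply: eq_bigr => a _.
  by rewrite -(hi phi a) hg.
have SG2 : \sum_phi G phi ^+ 2 =
    #|T|%:R ^+ 2 * \sum_phi g phi * g (upd phi i (phi w)).
  rewrite expr2 -mulrA -(sum_upd w) -(sum_upd i); apply: eq_bigr => phi _.
  rewrite expr2 mulr_suml; apply: eq_bigr => a _.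
  rewrite mulr_sumr; apply: eq_bigr => b _.
  by rewrite gw updE eqxx [upd (upd (upd phi i a) w b) i b]updC 1?eq_sym // upd_upd gw.
have := cauchy_schwarz h G.
rewrite (eq_bigr _ (fun phi _ => hG phi)) SG SG2 (eq_bigr _ (fun phi _ => h2 phi)).
rewrite exprMn [X in _ <= X]mulrCA ler_pM2l //.
by rewrite exprn_gt0 // ltr0n.
Qed.
End Resample.

(** * Stability from clique counts *)

Section Cliques.
Variables (R : realType) (J T : finType) (e : rel T).
Hypotheses (e_sym : symmetric e) (T_gt0 : (0 < #|T|)%N).
Implicit Types (phi : {ffun J -> T}) (S : {set J}) (i w : J).

Let N : R := #|T|%:R.
Let N_gt0 : 0 < N. Proof. by rewrite ltr0n. Qed.

Definition clq S phi := [forall i in S, forall j in S, (i != j) ==> e (phi i) (phi j)].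

Definition nclq S : R := \sum_phi (clq S phi)%:R.

Lemma clqP S phi :
  reflect {in S &, forall i j, i != j -> e (phi i) (phi j)} (clq S phi).
Proof.
apply: (iffP forall_inP) => [h i j iS jS|h i iS].
  by have /forall_inP/(_ j jS)/implyP := h i iS.
by apply/forall_inP => j jS; apply/implyP; exact: h.
Qed.

Lemma clq_upd S phi w a : w \notin S -> clq S (upd phi w a) = clq S phi.
Proof.
move=> wS; apply/clqP/clqP => h i j iS jS ij; have := h i j iS jS ij;
  rewrite !updE; case: eqP => [iw|_]; rewrite ?iw ?(negbTE wS) in iS *;
  by case: eqP => [jw|_] //; rewrite ?jw ?(negbTE wS) in jS *.
Qed.

Lemma clqS S S' phi : S \subset S' -> clq S' phi -> clq S phi.
Proof.
by move=> /fintype.subsetP sub /clqP h; apply/clqP => i j iS jS; apply: h; exact: sub.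
Qed.

Lemma clqU1 S phi w : w \notin S ->
  clq (w |: S) phi = clq S phi && [forall i in S, e (phi w) (phi i)].
Proof.
move=> wS; apply/clqP/andP => [h|[/clqP h /forall_inP h'] i j].
  split; first by apply/clqP => i j iS jS; apply: h; rewrite !inE ?iS ?jS orbT.
  by apply/forall_inP => i iS; apply: h; rewrite ?inE ?eqxx ?iS ?orbT //;
     apply: contraNneq wS => ->.
rewrite !inE => /orP[/eqP->|iS] /orP[/eqP->|jS]; rewrite ?eqxx // => ij.
- exact: h'.
- by rewrite e_sym; exact: h'.
- exact: h.
Qed.

Lemma nclq_ge0 S : 0 <= nclq S.
Proof. by apply: sumr_ge0 => phi _; rewrite ler0n. Qed.

(* The number of coordinates [i] of a clique on [S] that a further vertex [y]
   may replace is [#|S|] when [y] is adjacent to the whole clique, and at most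
   one otherwise. *)
Lemma sum_replace_le S w phi y : w \notin S -> (0 < #|S|)%N -> clq S phi ->
  \sum_(i in S) (clq S (upd phi i y))%:R <=
  1 + (#|S|%:R - 1) * (clq (w |: S) (upd phi w y))%:R :> R.
Proof.
move=> wS S0 cS.
have S1 : 1 <= #|S|%:R :> R by rewrite ler1n.
have sle : \sum_(i in S) (clq S (upd phi i y))%:R <= #|S|%:R :> R.
  rewrite -sum1_card natr_sum; apply: ler_sum => i _; rewrite ler_nat.
  exact: leq_b1.
case c: (clq (w |: S) (upd phi w y)); first by rewrite mulr1 addrC subrK.
rewrite mulr0 addr0.
move: c; rewrite clqU1 // clq_upd // cS /= => /negbT.
rewrite negb_forall_in => /exists_inP[i0 i0S].
rewrite !updE eqxx (_ : (i0 == w) = false); last by apply: contraNF wS => /eqP <-.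
move=> ne.
rewrite (bigD1 i0) //= big1 ?addr0; first by rewrite lern1 leq_b1.
move=> i /andP[iS ii0]; rewrite (_ : clq _ _ = false) //; apply/negP => /clqP.
move/(_ i i0 iS i0S ii0); rewrite !updE eqxx eq_sym (negbTE ii0).
by apply/negP.
Qed.

(** The coordinate [w], meant to lie outside [S], acts as an independent uniform vertex proposed as
    a replacement of [phi i]. *)
Definition nreplace S i w : R :=
  \sum_phi (clq S phi)%:R * (clq S (upd phi i (phi w)))%:R.

(** A second moment bound: given a clique on [S :\ i], the vertices [phi i] and [phi w] are two
    independent attempts to extend it. *)
Lemma nreplace_ge S i w c : w \notin S -> i \in S ->
  c * nclq (S :\ i) <= nclq S -> c * nclq S <= nreplace S i w.
Proof.
move=> wS iS hc.
have iw : i != w by apply: contraNneq wS => <-.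
have cs : nclq S ^+ 2 <= nclq (S :\ i) * nreplace S i w.
  apply: resample_cs => //.
  - by move=> phi a; rewrite clq_upd.
  - by move=> phi a; rewrite clq_upd // !inE eqxx.
  - by move=> phi; case: clq; rewrite ?expr1n ?expr0n.
  - move=> phi; case c1: (clq S phi); last by rewrite mulr0.
    by rewrite (clqS _ c1) ?mulr1 // subD1set.
have A0 : 0 <= nreplace S i w by apply: sumr_ge0 => phi _; rewrite mulr_ge0 ?ler0n.
have := nclq_ge0 S; rewrite le_eqVlt => /orP[/eqP <-|K0]; first by rewrite mulr0.
have K1 : 0 < nclq (S :\ i).
  have := nclq_ge0 (S :\ i); rewrite le_eqVlt => /orP[/eqP E|//].
  by move: cs; rewrite -E mul0r leNgt exprn_gt0.
rewrite -(ler_pM2l K1); apply: le_trans cs.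
by rewrite mulrCA mulrA expr2 ler_pM2r // mulrC [_ * c]mulrC mulrC.
Qed.

Lemma sum_nreplace_le S w : w \notin S -> (0 < #|S|)%N ->
  \sum_(i in S) nreplace S i w <= nclq S + (#|S|%:R - 1) * nclq (w |: S).
Proof.
move=> wS S0; rewrite exchange_big /= /nclq mulr_sumr -big_split /=.
apply: ler_sum => phi _; rewrite -mulr_sumr.
have := @sum_replace_le S w phi (phi w) wS S0; rewrite upd_id.
case c: (clq S phi) => h; first by rewrite mul1r h.
by rewrite mul0r add0r mulr_ge0 ?ler0n // subr_ge0 ler1n.
Qed.

Lemma nclq0 : nclq finset.set0 = N ^+ #|J|.
Proof.
rewrite /nclq (eq_bigr (fun _ => 1)); last first.
  by move=> phi _; rewrite (_ : clq _ _) //; apply/clqP => i j; rewrite inE.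
by rewrite sumr_const card_ffun natrX.
Qed.

Variable r : nat.
Hypotheses (r_gt0 : (0 < r)%N)
  (dense : (1 - r%:R^-1) * N ^+ 2 <= \sum_x \sum_y (e x y)%:R).

Lemma nclq1 w : nclq [set w] = nclq finset.set0.
Proof.
apply: eq_bigr => phi _; congr (_%:R); congr (nat_of_bool _).
by apply/clqP/clqP => _ i j; rewrite !inE // => /eqP-> /eqP->; rewrite eqxx.
Qed.

(* The Moon-Moser inequality; it follows by induction from the two bounds on
   [\sum_i nreplace S i w]. *)
Lemma nclq_growth S w : w \notin S -> (#|S| <= r)%N ->
  (1 - #|S|%:R / r%:R) * nclq S <= nclq (w |: S).
Proof.
have r0 : 0 < r%:R :> R by rewrite ltr0n.
move sE : #|S| => s; elim: s S w sE => [|s IH] S w sE wS sr.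
  by rewrite mul0r subr0 mul1r (cards0_eq sE) finset.setU0 nclq1.
case: s IH sE sr => [|s] IH sE sr.
  (* For a singleton the claim is the density hypothesis itself, averaged over the remaining
     coordinates. *)
  have /eqP/cards1P[i Si] := sE; rewrite {}Si in wS *.
  have iw : i != w by move: wS; rewrite inE eq_sym.
  rewrite nclq1 mul1r.
  have N2 : 0 < N ^+ 2 by rewrite exprn_gt0.
  rewrite -(ler_pM2l N2).
  have -> : N ^+ 2 * nclq (w |: [set i]) = \sum_(phi : {ffun J -> T})
      \sum_x \sum_y (clq (w |: [set i]) (upd (upd phi i x) w y))%:R.
    rewrite (@sum_upd R J T i (fun phi => \sum_y (clq (w |: [set i]) (upd phi w y))%:R)).
    by rewrite (@sum_upd R J T w (fun phi => (clq (w |: [set i]) phi)%:R)) expr2 mulrA.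
  rewrite mulrA [N ^+ 2 * _]mulrC mulr_sumr; apply: ler_sum => phi _.
  rewrite (_ : clq finset.set0 phi) ?mulr1; last by apply/clqP => j j'; rewrite inE.
  apply: (le_trans dense); apply: ler_sum => x _; apply: ler_sum => y _.
  rewrite clqU1 ?inE 1?eq_sym // ler_nat.
  case exy: (e x y) => //; rewrite (_ : _ && _) //; apply/andP; split.
    by apply/clqP => j j'; rewrite !inE => /eqP-> /eqP->; rewrite eqxx.
  by apply/forall_inP => j; rewrite inE => /eqP->;
     rewrite !updE !eqxx (negbTE iw) e_sym.
have S0 : (0 < #|S|)%N by rewrite sE.
have := sum_nreplace_le wS S0.
have h : \sum_(i in S) (1 - s.+1%:R / r%:R) * nclq S <= \sum_(i in S) nreplace S i w.
  apply: ler_sum => i iS; apply: nreplace_ge => //.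
  have := IH (S :\ i) i; rewrite finset.setD1K //; apply.
  - by apply/eqP; rewrite -(eqn_add2l (i \in S)) -cardsD1 sE iS.
  - by rewrite !inE eqxx.
  - exact: ltnW.
move/(le_trans h); rewrite sumr_const sE -mulr_natl.
have -> : s.+2%:R - 1 = s.+1%:R :> R by rewrite -[s.+2%:R]natr1; ring.
rewrite -lerBlDl -[s.+2%:R]natr1 => H.
have s0 : 0 < s.+1%:R :> R by rewrite ltr0n.
rewrite -(ler_pM2l s0); apply: le_trans H; rewrite le_eqVlt; apply/orP; left.
by apply/eqP; field; rewrite gt_eqF.
Qed.

Lemma nclq_lower S : (#|S| <= r)%N ->
  \prod_(s < #|S|) (1 - s%:R / r%:R) * N ^+ #|J| <= nclq S.
Proof.
have r0 : 0 < r%:R :> R by rewrite ltr0n.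
move sE : #|S| => s; elim: s S sE => [|s IH] S sE sr.
  by rewrite big_ord0 mul1r (cards0_eq sE) nclq0.
have /card_gt0P[i iS] : (0 < #|S|)%N by rewrite sE.
have sE' : #|S :\ i| = s.
  by apply/eqP; rewrite -(eqn_add2l (i \in S)) -cardsD1 sE iS.
have := @nclq_growth (S :\ i) i; rewrite finset.setD1K // sE' !inE eqxx => /(_ isT (ltnW sr)).
apply: le_trans; rewrite big_ord_recr /= [_ * (1 - _)]mulrC -mulrA ler_wpM2l //.
  by rewrite subr_ge0 ler_pdivrMr // mul1r ler_nat ltnW.
by apply: IH => //; exact: ltnW.
Qed.

(* For a clique [phi] on [S] this is the number of vertices lying in none of the
   parts, the [i]-th part being the common neighbourhood of [phi] off [i]; the
   shape of the summand makes it computable on average. *)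
Definition defect S w phi : R := \sum_y (1 - \sum_(i in S) (clq S (upd phi i y))%:R
  + (#|S|%:R - 1) * (clq (w |: S) (upd phi w y))%:R).

Definition inner S phi : R := \sum_(i in S) \sum_y \sum_z
  (clq S (upd phi i y) && clq S (upd phi i z) && e y z)%:R.

(** An edge inside the [i]-th candidate part, together with the clique off [i], is a clique with one
    more vertex: one end takes coordinate [i], the other takes [w]. *)
Lemma sum_inner_le S w : w \notin S ->
  \sum_phi (clq S phi)%:R * inner S phi <= #|S|%:R * (N ^+ 2 * nclq (w |: S)).
Proof.
move=> wS.
rewrite (_ : #|S|%:R * _ = \sum_(i in S) N ^+ 2 * nclq (w |: S)); last first.
  by rewrite sumr_const mulr_natl.
under eq_bigr do rewrite mulr_sumr.
rewrite exchange_big /=; apply: ler_sum => i iS.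
have iw : i != w by apply: contraNneq wS => <-.
have -> : N ^+ 2 * nclq (w |: S) = \sum_(phi : {ffun J -> T})
    \sum_y \sum_z (clq (w |: S) (upd (upd phi i y) w z))%:R.
  rewrite (@sum_upd R J T i (fun phi => \sum_y (clq (w |: S) (upd phi w y))%:R)).
  by rewrite (@sum_upd R J T w (fun phi => (clq (w |: S) phi)%:R)) expr2 mulrA.
apply: ler_sum => phi _; rewrite mulr_sumr; apply: ler_sum => y _.
rewrite mulr_sumr; apply: ler_sum => z _.
rewrite -natrM mulnb ler_nat.
case c: [&& _, _ && _ & _] => //.
case/and3P: c => c0 /andP[cy cz] eyz.
rewrite (_ : clq _ _) // clqU1 // clq_upd // cy /=.
apply/forall_inP => j jS; rewrite updE eqxx updE.
have /negbTE -> : j != w by apply: contraNneq wS => <-.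
rewrite updE; case: eqP => [_|/eqP ji]; first by rewrite e_sym.
have /clqP/(_ i j iS jS) := cz.
by rewrite !updE eqxx (negbTE ji) eq_sym ji; apply.
Qed.

(** At [#|S| = r] the growth factor from [S :\ i] to [S] is [1 / r], so the [r] replacement counts
    together already reach [nclq S], and only the term of the larger cliques is left. *)
Lemma sum_defect_le S w : w \notin S -> #|S| = r ->
  \sum_phi (clq S phi)%:R * defect S w phi <= N * ((r%:R - 1) * nclq (w |: S)).
Proof.
move=> wS Sr; have r0 : r%:R != 0 :> R by rewrite pnatr_eq0 -lt0n.
have -> : \sum_phi (clq S phi)%:R * defect S w phi =
   N * (nclq S - \sum_(i in S) nreplace S i w + (r%:R - 1) * nclq (w |: S)).
  have e1 : N * nclq S = \sum_(phi : {ffun J -> T}) \sum_(y : T) (clq S phi)%:R.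
    by rewrite -(@sum_upd R J T w); apply: eq_bigr => phi _;
       apply: eq_bigr => y _; rewrite clq_upd.
  have e2 i : N * nreplace S i w = \sum_(phi : {ffun J -> T}) \sum_(y : T)
      (clq S phi)%:R * (clq S (upd phi i y))%:R.
    rewrite -(@sum_upd R J T w); apply: eq_bigr => phi _; apply: eq_bigr => y _.
    rewrite clq_upd // updE eqxx; congr (_ * _).
    have [->|iw] := eqVneq i w; first by rewrite !clq_upd.
    by rewrite -updC // clq_upd.
  have e3 : N * nclq (w |: S) = \sum_(phi : {ffun J -> T}) \sum_(y : T)
      (clq S phi)%:R * (clq (w |: S) (upd phi w y))%:R.
    rewrite -(@sum_upd R J T w); apply: eq_bigr => phi _; apply: eq_bigr => y _.
    by rewrite clqU1 // clq_upd //; case: clq; rewrite ?mul1r ?mul0r.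
  transitivity (\sum_phi (\sum_(y : T) (clq S phi)%:R -
      \sum_(i in S) \sum_y (clq S phi)%:R * (clq S (upd phi i y))%:R +
      (r%:R - 1) * \sum_y (clq S phi)%:R * (clq (w |: S) (upd phi w y))%:R) : R).
    apply: eq_bigr => phi _; rewrite /defect mulr_sumr exchange_big /=.
    rewrite mulr_sumr -sumrB -big_split /=; apply: eq_bigr => y _.
    by rewrite mulrDr mulrBr mulr1 mulr_sumr Sr mulrCA.
  rewrite big_split sumrB /= -mulr_sumr -e1 -e3 exchange_big /=.
  by rewrite -(eq_bigr _ (fun i _ => e2 i)) -mulr_sumr mulrDr mulrBr mulrCA.
rewrite ler_pM2l // gerDr subr_le0.
have -> : nclq S = \sum_(i in S) r%:R^-1 * nclq S.
  by rewrite sumr_const Sr -[RHS]mulr_natl mulrA divff // mul1r.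
apply: ler_sum => i iS; apply: nreplace_ge => //.
have sE' : #|S :\ i| = r.-1 by have := cardsD1 i S; rewrite iS Sr => ->.
have := @nclq_growth (S :\ i) i; rewrite finset.setD1K // sE' !inE eqxx => /(_ isT (leq_pred _)).
rewrite (_ : 1 - _ = r%:R^-1) //.
move: r0; have -> : r%:R = r.-1%:R + 1 :> R by rewrite natr1 prednK.
by move: (r.-1)%:R => a a0; field.
Qed.

Theorem stability (t : 'I_r -> J) w (g : R) : injective t ->
  w \notin [set t x | x : 'I_r] ->
  nclq (w |: [set t x | x : 'I_r]) <= g * N ^+ #|J| ->
  exists cl : {ffun T -> 'I_r}, \sum_y \sum_z (e y z && (cl y == cl z))%:R <=
    (3 * r%:R / \prod_(s < r) (1 - s%:R / r%:R)) * g * N ^+ 2.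
Proof.
move=> t_inj; set S := [set t x | x : 'I_r] => wS Kg.
have Sr : #|S| = r by rewrite card_imset ?card_ord.
have r0 : 0 < r%:R :> R by rewrite ltr0n.
have S_gt0 : (0 < #|S|)%N by rewrite Sr.
pose kap : R := \prod_(s < r) (1 - s%:R / r%:R).
have kap0 : 0 < kap.
  by apply: prodr_gt0 => s _; rewrite subr_gt0 ltr_pdivrMr // mul1r ltr_nat.
have K0 : kap * N ^+ #|J| <= nclq S.
  by have := @nclq_lower S; rewrite Sr; apply.
(* A vertex in no candidate part gets an arbitrary colour and may spoil up to [2 * N] ordered pairs;
   hence the weight of [defect]. The average of [Q] over cliques then costs
   [r + 2 * (r - 1) <= 3 * r]. *)
pose Q phi := inner S phi + 2 * N * defect S w phi.
pose B := (3 * r%:R / kap) * g * N ^+ 2.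
(* Averaging: there are at least [kap * N ^+ #|J|] cliques on [S], so [Q] cannot exceed [B] on all
   of them. *)
have /existsP[phi /andP[cS QB]] : [exists phi, clq S phi && (Q phi <= B)].
  apply: contraT; rewrite negb_exists => /forallP h.
  have : \sum_phi (clq S phi)%:R * Q phi <= 3 * r%:R * g * N ^+ 2 * N ^+ #|J|.
    have -> : \sum_phi (clq S phi)%:R * Q phi = \sum_phi (clq S phi)%:R * inner S phi
       + 2 * N * \sum_phi (clq S phi)%:R * defect S w phi.
      rewrite mulr_sumr -big_split /=; apply: eq_bigr => phi _.
      by rewrite /Q mulrDr; congr (_ + _); rewrite mulrCA.
    have /(ler_wpM2l (ltW N_gt0)) := sum_defect_le wS Sr.
    have := sum_inner_le wS; rewrite Sr.
    have N2 : 0 < N ^+ 2 by rewrite exprn_gt0.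
    have := ler_wpM2l (ltW N2) Kg; have := nclq_ge0 (w |: S).
    move: (nclq (w |: S)) (\sum_phi _ * inner _ _) (\sum_phi _ * defect _ _ _) (N ^+ #|J|) N2 => K x1 x2 NJ.
    rewrite expr2 => N2 KN Kge h1 h2.
    have r1 : 1 <= r%:R :> R by rewrite ler1n.
    have rr : 0 <= r%:R :> R by [].
    have h3 : r%:R * (N * N * K) <= r%:R * (N * N * (g * NJ)) by rewrite ler_wpM2l.
    have h4 : 0 <= N * N * K by rewrite mulr_ge0 // ltW.
    have h5 : N * x2 <= N * (N * ((r%:R - 1) * K)) by [].
    nra.
  have NJ0 : 0 < N ^+ #|J| by rewrite exprn_gt0.
  have g0 : 0 <= g.
    by rewrite -(pmulr_lge0 _ NJ0); apply: le_trans Kg; exact: nclq_ge0.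
  have B0 : 0 <= B.
    by rewrite !mulr_ge0 ?invr_ge0 ?exprn_ge0 // ltW.
  have K1 : 0 < nclq S by apply: lt_le_trans K0; rewrite mulr_gt0.
  have -> : 3 * r%:R * g * N ^+ 2 * N ^+ #|J| = B * (kap * N ^+ #|J|).
    by rewrite /B; field; rewrite gt_eqF.
  move=> le1.
  have : \sum_phi (clq S phi)%:R * (Q phi - B) <= 0.
    under eq_bigr do rewrite mulrBr.
    rewrite sumrB -mulr_suml subr_le0; apply: le_trans le1 _.
    by rewrite [_ * B]mulrC ler_wpM2l.
  have nn psi : 0 <= (clq S psi)%:R * (Q psi - B).
    have := h psi; case: (clq S psi); last by rewrite mul0r.
    by rewrite /= -ltNge mul1r subr_ge0 => /ltW.
  have [psi cpsi] : exists psi, clq S psi.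
    apply/existsP; apply: contraTT K1; rewrite negb_exists -leNgt => /forallP h'.
    by rewrite /nclq big1 // => psi _; rewrite (negbTE (h' psi)).
  rewrite leNgt => /negP[]; rewrite (bigD1 psi) //= ltr_wpDr //; first exact: sumr_ge0.
  by have := h psi; rewrite cpsi /= -ltNge mul1r subr_gt0.
(* Vertices in no candidate part fall into the default colour; [defect] bounds their number. *)
pose cl := [ffun y => odflt (Ordinal r_gt0) [pick i | clq S (upd phi (t i) y)]].
exists cl; apply: le_trans QB.
pose out y := ~~ [exists i, clq S (upd phi (t i) y)].
have out_le y : (out y)%:R <= 1 - \sum_(i in S) (clq S (upd phi i y))%:R
    + (#|S|%:R - 1) * (clq (w |: S) (upd phi w y))%:R :> R.
  rewrite /out; case: existsP => [_|h] /=.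
    have := sum_replace_le y wS S_gt0 cS; lra.
  rewrite big1 ?subr0; first by rewrite lerDl mulr_ge0 // subr_ge0 ler1n.
  move=> i /imsetP[j _ ->]; case c: clq => //.
  by case: h; exists j.
have D_le : \sum_y (out y)%:R <= defect S w phi by apply: ler_sum => y _.
have clP y : ~~ out y -> clq S (upd phi (t (cl y)) y).
  rewrite /out negbK ffunE => /existsP[i ci].
  by case: pickP => [//|/(_ i)]; rewrite ci.
have pt y z : (e y z && (cl y == cl z))%:R <= \sum_(i in S)
   (clq S (upd phi i y) && clq S (upd phi i z) && e y z)%:R + (out y)%:R + (out z)%:R :> R.
  have ss0 : 0 <= \sum_(i in S) (clq S (upd phi i y) && clq S (upd phi i z) && e y z)%:R :> R.
    exact: sumr_ge0.
  case c: (_ && _); last by rewrite !addr_ge0.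
  case oy: (out y); first by rewrite addrAC lerDr addr_ge0.
  case oz: (out z); first by rewrite lerDr addr_ge0.
  rewrite !addr0; case/andP: c => eyz /eqP cyz.
  have cy := clP y (negbT oy); have cz := clP z (negbT oz).
  rewrite (bigD1 (t (cl y))) ?imset_f //= cy {1}cyz cz eyz lerDl.
  exact: sumr_ge0.
apply: (@le_trans _ _ (\sum_y \sum_z (\sum_(i in S)
   (clq S (upd phi i y) && clq S (upd phi i z) && e y z)%:R + (out y)%:R + (out z)%:R))).
  by apply: ler_sum => y _; apply: ler_sum => z _.
under eq_bigr do rewrite !big_split /=.
rewrite !big_split /=.
have -> : \sum_y \sum_z \sum_(i in S)
   (clq S (upd phi i y) && clq S (upd phi i z) && e y z)%:R = inner S phi.
  by rewrite /inner [RHS]exchange_big; apply: eq_bigr => y _; rewrite exchange_big.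
have -> : \sum_(y : T) \sum_(z : T) (out y)%:R = N * \sum_y (out y)%:R :> R.
  by rewrite mulr_sumr; apply: eq_bigr => y _; rewrite sumr_const mulr_natl.
rewrite sumr_const -[X in _ + X]mulr_natl -/N /Q -addrA lerD2l.
by have := ler_wpM2l (ltW N_gt0) D_le; rewrite -mulrA mulr2n mulrDl mul1r => ?; rewrite lerD.
Qed.

End Cliques.

(** * Cloning and counting embeddings *)

Section Cloning.
Variables (R : realType) (J T K : finType) (e : rel T) (col : J -> K).
Hypotheses (e_sym : symmetric e) (T_gt0 : (0 < #|T|)%N).
Implicit Types (phi : {ffun J -> T}) (S : {set J}) (i w : J).

Let N : R := #|T|%:R.
Let N_gt0 : 0 < N. Proof. by rewrite ltr0n. Qed.

(* Homomorphisms into [e] of the complete multipartite graph on [S] with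
   classes given by [col]. *)
Definition mhom S phi :=
  [forall i in S, forall j in S, (col i != col j) ==> e (phi i) (phi j)].

Definition nmhom S : R := \sum_phi (mhom S phi)%:R.

Lemma mhomP S phi :
  reflect {in S &, forall i j, col i != col j -> e (phi i) (phi j)} (mhom S phi).
Proof.
apply: (iffP forall_inP) => [h i j iS jS|h i iS].
  by have /forall_inP/(_ j jS)/implyP := h i iS.
by apply/forall_inP => j jS; apply/implyP; exact: h.
Qed.

(** The new vertex is a twin of [i]. Given the other coordinates, [phi i] and [phi w] are
    independent attempts to extend them, and no edge is asked between vertices of one class. *)
Lemma nmhom_clone S i w : i \in S -> w \notin S -> col w = col i ->
  nmhom S ^+ 2 <= N ^+ #|J| * nmhom (w |: S).
Proof.
move=> iS wS cwi.
have iw : i != w by apply: contraNneq wS => <-.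
apply: (@le_trans _ _ ((\sum_(phi : {ffun J -> T}) 1) *
    \sum_phi (mhom S phi)%:R * (mhom S (upd phi i (phi w)))%:R)).
  apply: (@resample_cs R J T i w (fun phi => (mhom S phi)%:R) (fun _ => 1)) => //=;
    [|by move=> _; rewrite expr1n|by move=> phi; rewrite mul1r].
  move=> phi a; congr (_%:R); congr (nat_of_bool _).
  apply/mhomP/mhomP => h k j kS jS kj; have := h k j kS jS kj;
  rewrite !updE; case: eqP => [kw|_]; rewrite ?kw ?(negbTE wS) in kS *;
  by case: eqP => [jw|_] //; rewrite ?jw ?(negbTE wS) in jS *.
rewrite sumr_const card_ffun -natrX ler_wpM2l // ?natrX //.
apply: ler_sum => phi _; rewrite -natrM mulnb ler_nat.
case c: (_ && _) => //; case/andP: c => /mhomP h1 /mhomP h2.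
rewrite (_ : mhom _ _) //; apply/mhomP.
have wj j : j \in S -> col w != col j -> e (phi w) (phi j).
  move=> jS cwj; have := h2 i j iS jS; rewrite -cwi => /(_ cwj).
  have ji : j != i by apply: contraNneq cwj => ->; rewrite cwi.
  by rewrite !updE eqxx (negbTE ji).
move=> k j; rewrite !inE => /orP[/eqP->|kS] /orP[/eqP->|jS]; rewrite ?eqxx //.
- exact: wj.
- by rewrite e_sym eq_sym; exact: wj.
- exact: h1.
Qed.

(** Each cloning squares the density, whence the exponent [2 ^ #|J|]. A vertex already in [S] is
    charged a squaring too, which is harmless as [g <= 1]. *)
Lemma nmhom_all S (g : R) : (forall w, exists2 i, i \in S & col w = col i) ->
  0 <= g <= 1 -> g * N ^+ #|J| <= nmhom S ->
  g ^+ (2 ^ #|J|) * N ^+ #|J| <= nmhom [set: J].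
Proof.
move=> Scol /andP[g0 g1] gS.
have NJ : 0 < N ^+ #|J| by rewrite exprn_gt0.
have step (l : seq J) : g ^+ (2 ^ size l) * N ^+ #|J| <= nmhom (S :|: [set x in l]).
  elim: l => [|w l IH].
    rewrite (_ : S :|: _ = S) ?expr1 //.
    by apply/setP => x; rewrite !inE orbF.
  rewrite (_ : S :|: _ = w |: (S :|: [set x in l])); last first.
    by apply/setP => x; rewrite !inE; case: (x == w); rewrite ?orbT.
  have [wS|wS] := boolP (w \in S :|: [set x in l]).
    rewrite (finset.setUidPr _) ?finset.sub1set //; apply: le_trans IH.
    by rewrite ler_pM2r // ler_wiXn2l // leq_exp2l.
  have [i iS cwi] := Scol w.
  have iS' : i \in S :|: [set x in l] by rewrite inE iS.
  have := nmhom_clone iS' wS cwi.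
  have h0 : 0 <= g ^+ (2 ^ size l) * N ^+ #|J| by rewrite mulr_ge0 ?exprn_ge0 // ltW.
  have := lerXn2r 2 h0 (le_trans h0 IH) IH.
  move=> h1 /(le_trans h1); rewrite exprMn -exprM -expnSr [(N ^+ _) ^+ 2]expr2.
  by rewrite mulrCA ler_pM2l.
by have := step (enum J); rewrite -cardE (_ : _ :|: _ = [set: J]) //;
   apply/setP => x; rewrite !inE mem_enum orbT.
Qed.
End Cloning.

(** * Tuples from prescribed sets with few bad pairs *)

Section CountGood.
Variables (R : realType) (J T : finType).
Hypothesis T_gt0 : (0 < #|T|)%N.
Implicit Types (phi : {ffun J -> T}).
Variable A : J -> {set T}.

Let N : R := #|T|%:R.
Let N_gt0 : 0 < N. Proof. by rewrite ltr0n. Qed.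

Definition in_box phi := [forall z, phi z \in A z].

Lemma in_boxE phi : (in_box phi)%:R = \prod_z (phi z \in A z)%:R :> R.
Proof.
rewrite /in_box; case: forallP => [h|/forallP].
  by rewrite big1 // => z _; rewrite h.
rewrite negb_forall => /existsP[z /negbTE zA].
by rewrite (bigD1 z) //= zA mul0r.
Qed.

Lemma card_in_set (B : {set T}) : \sum_a (a \in B)%:R = #|B|%:R :> R.
Proof. by rewrite natr_card. Qed.

Lemma sum_in_box : \sum_phi (in_box phi)%:R = \prod_z #|A z|%:R :> R.
Proof.
rewrite (eq_bigr _ (fun phi _ => in_boxE phi)).
by rewrite -(bigA_distr_bigA (fun z a => (a \in A z)%:R)) /=; apply: eq_bigr => z _; rewrite card_in_set.
Qed.

Lemma sum_in_box_pair w w' (Q : rel T) : w != w' ->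
  \sum_phi (in_box phi && Q (phi w) (phi w'))%:R =
  (\prod_(z | (z != w) && (z != w')) #|A z|%:R) *
  \sum_a \sum_a' ([&& a \in A w, a' \in A w' & Q a a'])%:R :> R.
Proof.
move=> ww.
have w'w : w' != w by rewrite eq_sym.
(* The factor [N * N] makes room for resampling both [w] and [w'], which separates them from the
   other coordinates. *)
apply: (mulfI (lt0r_neq0 (mulr_gt0 N_gt0 N_gt0))).
rewrite -[LHS]mulrA.
rewrite -(@sum_upd R J T w') -(@sum_upd R J T w).
transitivity (\sum_(phi : {ffun J -> T}) ((\prod_(z | (z != w) && (z != w')) (phi z \in A z)%:R) *
    \sum_a \sum_a' ([&& a \in A w, a' \in A w' & Q a a'])%:R) : R).
  apply: eq_bigr => phi _; rewrite mulr_sumr; apply: eq_bigr => a _.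
  rewrite mulr_sumr; apply: eq_bigr => a' _.
  rewrite !updE !eqxx (negbTE ww) -mulnb natrM in_boxE (bigD1 w) //= (bigD1 w') //=.
  rewrite !updE !eqxx (negbTE ww) -[(_ && (_ && _) : nat)]mulnb -mulnb !natrM.
  rewrite (eq_bigr (fun z => (phi z \in A z)%:R)); last first.
    by move=> z /andP[zw zw']; rewrite !updE (negbTE zw) (negbTE zw').
  by ring.
rewrite -mulr_suml [RHS]mulrA; congr (_ * _).
transitivity (\sum_(phi : {ffun J -> T}) \prod_z (if (z != w) && (z != w') then (phi z \in A z)%:R else 1) : R).
  by apply: eq_bigr => phi _; rewrite -big_mkcond.
rewrite -(bigA_distr_bigA (fun z a => if (z != w) && (z != w') then (a \in A z)%:R else 1)) /=.
rewrite (bigD1 w) //= (bigD1 w') //= !eqxx /= andbF !sumr_const mulrA; congr (_ * _).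
by apply: eq_bigr => z ->; rewrite card_in_set.
Qed.

(** Union bound over ordered pairs of coordinates. The bad pairs are measured against the reference
    sizes [b], not against the sets [A], which may be much smaller. *)
Lemma count_good (b : J -> R) (eta : R) (Bad : J -> J -> rel T) :
  0 <= eta -> (forall z, 0 <= b z) -> (forall z, #|A z|%:R <= b z) ->
  (forall w w', w != w' -> \sum_a \sum_a'
     ([&& a \in A w, a' \in A w' & Bad w w' a a'])%:R <= eta * (b w * b w')) ->
  \prod_z #|A z|%:R - #|J|%:R ^+ 2 * eta * \prod_z b z <=
  \sum_phi (in_box phi && [forall w, forall w', (w != w') ==> ~~ Bad w w' (phi w) (phi w')])%:R.
Proof.
move=> eta0 b0 Ab hB.
rewrite lerBlDr -sum_in_box.
apply: (@le_trans _ _ (\sum_(phi : {ffun J -> T}) ((in_box phi && [forall w, forall w', (w != w') ==> ~~ Bad w w' (phi w) (phi w')])%:R +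
   \sum_w \sum_(w' | w != w') (in_box phi && Bad w w' (phi w) (phi w'))%:R))).
  apply: ler_sum => phi _; case: (in_box phi) => /=; last first.
    by rewrite add0r; do 2!(apply: sumr_ge0 => ? _).
  case: forallP => [_|/forallP]; first by rewrite lerDl; do 2!(apply: sumr_ge0 => ? _).
  rewrite negb_forall => /existsP[w]; rewrite negb_forall => /existsP[w'].
  rewrite negb_imply negbK => /andP[ww Bww].
  rewrite add0r (bigD1 w) //= (bigD1 w') //= Bww -addrA lerDl addr_ge0 //.
    by apply: sumr_ge0.
  by do 2!(apply: sumr_ge0 => ? _).
rewrite big_split lerD2l /=.
rewrite exchange_big /=.
have -> : #|J|%:R ^+ 2 * eta * \prod_z b z = \sum_(w : J) \sum_(w' : J) eta * \prod_z b z.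
  by rewrite !sumr_const -mulrnA -[RHS]mulr_natl natrM mulrA expr2.
apply: ler_sum => w _; rewrite exchange_big /= big_mkcond /=.
apply: ler_sum => w' _; case: ifP => [ww|_]; last by rewrite mulr_ge0 ?prodr_ge0.
rewrite (@sum_in_box_pair w w' (Bad w w')) //.
have w'w : w' != w by rewrite eq_sym.
rewrite [X in _ <= _ * X](bigD1 w) //= [X in _ <= _ * (_ * X)](bigD1 w') //=.
rewrite [X in _ <= X](_ : _ = (\prod_(z | (z != w) && (z != w')) b z) * (eta * (b w * b w'))); last by ring.
apply: ler_pM; rewrite ?prodr_ge0 //.
- by do 2!(apply: sumr_ge0 => ? _).
- by apply: ler_prod => z _; rewrite Ab ler0n.
- exact: hB.
Qed.

(* The sets [A z] occupy at least the proportion [x z - k] of a reference size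
   [b z]. *)
Lemma count_good_lip (b x : J -> R) (k eta : R) (Bad : J -> J -> rel T) :
  0 <= eta -> 0 <= k -> (forall z, 0 < b z) -> (forall z, #|A z|%:R <= b z) ->
  (forall z, 0 <= x z <= 1) -> (forall z, (x z - k) * b z <= #|A z|%:R) ->
  (forall w w', w != w' -> \sum_a \sum_a'
     ([&& a \in A w, a' \in A w' & Bad w w' a a'])%:R <= eta * (b w * b w')) ->
  (\prod_z b z) * (\prod_z x z - #|J|%:R * k - #|J|%:R ^+ 2 * eta) <=
  \sum_phi (in_box phi && [forall w, forall w', (w != w') ==> ~~ Bad w w' (phi w) (phi w')])%:R.
Proof.
move=> eta0 k0 b0 Ab x01 xA hB.
apply: le_trans (count_good eta0 (fun z => ltW (b0 z)) Ab hB).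
rewrite mulrBr [X in _ - X]mulrC lerD2r.
have -> : \prod_z #|A z|%:R = (\prod_z b z) * \prod_z (#|A z|%:R / b z).
  rewrite -big_split; apply: eq_bigr => z _ /=.
  by rewrite mulrC divfK // gt_eqF.
apply: ler_wpM2l; first by apply: prodr_ge0 => z _; exact: ltW.
apply: prodr_lip => // z; first by rewrite divr_ge0 ?ler0n ?(ltW (b0 z)) //= ler_pdivrMr // mul1r.
by rewrite ler_pdivlMr.
Qed.
End CountGood.

(** * Copies and embeddings *)

Section Embeddings.
Variables (f : nat) (EF : {set {set 'I_f}}).
Hypothesis simpleF : simple_graph EF.

Definition emb (T : finType) (e : rel T) (phi : {ffun 'I_f -> T}) : bool :=
  injectiveb phi && [forall x, forall y, adj EF x y ==> e (phi x) (phi y)].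

Definition nemb (T : finType) (e : rel T) : nat := #|[set phi | emb e phi]|.

Lemma embP (T : finType) (e : rel T) (phi : {ffun 'I_f -> T}) :
  reflect (injective phi /\ forall x y, adj EF x y -> e (phi x) (phi y)) (emb e phi).
Proof.
apply: (iffP andP) => -[/injectiveP h1 h2]; split => //.
  by move=> x y; apply/implyP; move: y; apply/forallP; move: x; apply/forallP.
by apply/forallP => x; apply/forallP => y; apply/implyP; exact: h2.
Qed.

Lemma adjE n (E : {set {set 'I_n}}) x y : simple_graph E ->
  adj E x y = ([set x; y] \in E).
Proof.
move=> /forall_inP sE; rewrite /adj; case: eqVneq => [->|//] /=.
by apply/esym/negbTE/negP => /sE; rewrite finset.setUid cards1.
Qed.

Lemma adj_sym n (E : {set {set 'I_n}}) : symmetric (adj E).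
Proof. by move=> x y; rewrite /adj eq_sym finset.setUC. Qed.

Lemma adj_irr n (E : {set {set 'I_n}}) x : adj E x x = false.
Proof. by rewrite /adj eqxx. Qed.

Section Copies.
Variables (n : nat) (E : {set {set 'I_n}}).
Hypothesis simpleE : simple_graph E.
Implicit Types (phi : {ffun 'I_f -> 'I_n}) (UH : {set 'I_n} * {set {set 'I_n}}).

Let imE phi : {set {set 'I_n}} := [set phi @: (h : {set 'I_f}) | h in EF].

Let wit phi UH := [&& injectiveb phi, phi @: [set: 'I_f] == UH.1 &
  [forall x, forall y, ([set x; y] \in EF) == ([set phi x; phi y] \in UH.2)]].

Let isC UH := [&& UH.2 \subset E, [forall h in UH.2, h \subset UH.1] &
  [exists phi, wit phi UH]].

Let imset2 phi x y : phi @: [set x; y] = [set phi x; phi y].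
Proof. by rewrite finset.imsetU !imset_set1. Qed.

Let set2_of m (D : {set {set 'I_m}}) h : simple_graph D -> h \in D ->
  exists x y, h = [set x; y] /\ x != y.
Proof.
move=> /forall_inP sD /sD /cards2P[x [y [xy ->]]]; by exists x, y.
Qed.

Let wit_emb phi UH : wit phi UH -> UH.2 \subset E -> emb (adj E) phi.
Proof.
case/and3P => i _ h /fintype.subsetP s; rewrite /emb i /=.
apply/forallP => x; apply/forallP => y; apply/implyP => /andP[xy xyE].
have /forallP/(_ y)/eqP := forallP h x; rewrite xyE => /esym/s k.
by rewrite /adj k andbT; apply: contraNneq xy => /(injectiveP _ i) ->.
Qed.

Let wit_eq phi UH : wit phi UH -> isC UH -> UH = (phi @: [set: 'I_f], imE phi).
Proof.
case: UH => U H /and3P[/= /injectiveP i /eqP <- h] /and3P[/= sE /forall_inP sU _].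
congr pair; apply/setP => k; apply/idP/imsetP => [kH|[l lF ->]].
  have [a [b [kab ab]]] := set2_of simpleE (fintype.subsetP sE _ kH).
  have /fintype.subsetP s := sU k kH.
  have /imsetP[x _ ax] : a \in phi @: [set: 'I_f] by apply: s; rewrite kab !inE eqxx.
  have /imsetP[y _ bx] : b \in phi @: [set: 'I_f] by apply: s; rewrite kab !inE eqxx orbT.
  exists [set x; y]; last by rewrite imset2 -ax -bx.
  by have /forallP/(_ y)/eqP -> := forallP h x; rewrite -ax -bx -kab.
have [x [y [lxy xy]]] := set2_of simpleF lF.
by rewrite lxy imset2; have /forallP/(_ y)/eqP <- := forallP h x; rewrite -lxy.
Qed.

Let emb_wit phi : emb (adj E) phi ->
  wit phi (phi @: [set: 'I_f], imE phi) && isC (phi @: [set: 'I_f], imE phi).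
Proof.
move=> /embP[i h].
have W : wit phi (phi @: [set: 'I_f], imE phi).
  apply/and3P; split => //=; first exact/injectiveP.
  apply/forallP => x; apply/forallP => y; rewrite -imset2; apply/eqP.
  by apply/idP/imsetP => [xF|[l lF /imset_inj ->//]]; exists [set x; y].
rewrite W /=; apply/and3P; split => /=.
- apply/fintype.subsetP => k /imsetP[l lF ->].
  have [x [y [lxy xy]]] := set2_of simpleF lF.
  by rewrite lxy imset2 -adjE // h // /adj xy -lxy.
- by apply/forall_inP => k /imsetP[l lF ->]; apply: imsetS; exact: finset.subsetT.
- by apply/existsP; exists phi.
Qed.

(** Two embeddings onto the same copy differ by a unique automorphism, so composing a fixed one,
    [p0], with the automorphisms reaches each of them once. *)
Let card_wit UH : isC UH -> #|[set phi | wit phi UH]| = Defs.aut EF.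
Proof.
move=> C; have /and3P[_ _ /existsP[p0 w0]] := C.
have /and3P[/injectiveP i0 /eqP im0 /forallP h0] := w0.
pose F (s : {perm 'I_f}) : {ffun 'I_f -> 'I_n} := [ffun x => p0 (s x)].
have Finj : injective F.
  by move=> s t /ffunP st; apply/permP => x; have := st x; rewrite !ffunE => /i0.
rewrite /Defs.aut -(card_imset _ Finj); apply: eq_card => phi.
rewrite inE; apply/idP/imsetP => [W|[s]].
  have /and3P[/injectiveP i /eqP im /forallP h] := W.
  have pre x : exists y, p0 y == phi x.
    have : phi x \in p0 @: [set: 'I_f] by rewrite im0 -im imset_f.
    by case/imsetP => y _ ->; exists y.
  pose g x := xchoose (pre x).
  have gE x : p0 (g x) = phi x by apply/eqP; exact: (xchooseP (pre x)).
  have ginj : injective g by move=> x y gxy; apply: i; rewrite -!gE gxy.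
  exists (perm ginj); last by apply/ffunP => x; rewrite ffunE permE gE.
  rewrite inE; apply/forallP => x; apply/forallP => y; rewrite !permE.
  have /forallP/(_ (g y))/eqP -> := h0 (g x).
  by have /forallP/(_ y)/eqP -> := h x; rewrite !gE.
rewrite inE => /forallP hs ->; apply/and3P; split.
- by apply/injectiveP => x y; rewrite !ffunE => /i0/perm_inj.
- rewrite -im0; apply/eqP/setP => a; apply/imsetP/imsetP => -[x _ ->].
    by exists (s x) => //; rewrite ffunE.
  by exists ((s^-1)%g x) => //; rewrite ffunE permKV.
- apply/forallP => x; apply/forallP => y; rewrite !ffunE.
  have /forallP/(_ y)/eqP <- := hs x.
  by have /forallP/(_ (s y))/eqP -> := h0 (s x).
Qed.

Lemma copies_aut : (copies EF E * Defs.aut EF)%N = nemb (adj E).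
Proof.
have -> : copies EF E = #|[set UH | isC UH]| by [].
rewrite -sum1_card big_distrl /=.
transitivity (\sum_(UH in [set UH | isC UH]) \sum_(phi in [set phi | wit phi UH]) 1)%N.
  by apply: eq_bigr => UH; rewrite inE => C; rewrite sum1_card card_wit // mul1n.
rewrite (exchange_big_dep (fun phi => phi \in [set phi | emb (adj E) phi])) /=; last first.
  by move=> UH phi; rewrite !inE => /and3P[s _ _] w; exact: wit_emb w s.
rewrite /nemb -sum1_card; apply: eq_bigr => phi; rewrite inE => ephi.
have /andP[w c] := emb_wit ephi.
rewrite (big_pred1 (phi @: [set: 'I_f], imE phi)) // => UH; rewrite !inE.
apply/andP/eqP => [[c' w']|->]; last by split.
exact: wit_eq.
Qed.

End Copies.

Lemma aut_gt0 : (0 < Defs.aut EF)%N.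
Proof.
apply/card_gt0P; exists 1%g; rewrite inE; apply/forallP => x; apply/forallP => y.
by rewrite !perm1.
Qed.

Lemma nembS (T : finType) (e e' : rel T) : subrel e e' -> (nemb e <= nemb e')%N.
Proof.
move=> s; apply/subset_leq_card/fintype.subsetP => phi; rewrite !inE => /embP[i h].
by apply/embP; split => // x y /h /s.
Qed.

End Embeddings.

(** * Colourings of a critical graph *)

Section Colorings.
Variables (f r : nat) (EF : {set {set 'I_f}}).

Lemma colorableP (n : nat) (E : {set {set 'I_n}}) (U : {set 'I_n}) k :
  reflect (exists c : 'I_n -> 'I_k, {in U &, forall x y, adj E x y -> c x != c y})
    (colorable_on E U k).
Proof.
apply: (iffP existsP) => [[c h]|[c h]].
  exists c => x y xU yU; apply/implyP; move: y yU; apply/forall_inP.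
  by move: x xU; apply/forall_inP.
exists (finfun c); apply/forall_inP => x xU; apply/forall_inP => y yU.
by rewrite !ffunE; apply/implyP; exact: h.
Qed.

Lemma chi_on_le (n : nat) (E : {set {set 'I_n}}) (U : {set 'I_n}) k :
  colorable_on E U k -> (chi_on E U <= k)%N.
Proof. by rewrite /chi_on; case: ex_minnP => m _ h /h. Qed.

Lemma chi_on_colorable (n : nat) (E : {set {set 'I_n}}) (U : {set 'I_n}) :
  colorable_on E U (chi_on E U).
Proof. by rewrite /chi_on; case: ex_minnP. Qed.

Lemma chi_coloring (n : nat) (E : {set {set 'I_n}}) :
  exists c : 'I_n -> 'I_(chi E), forall x y, adj E x y -> c x != c y.
Proof.
have /colorableP[c hc] := chi_on_colorable E [set: 'I_n].
by exists c => x y; apply: hc; rewrite inE.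
Qed.

Hypotheses (simpleF : simple_graph EF) (r_gt0 : (0 < r)%N) (critF : r_critical r EF).

Lemma not_colorable (c : 'I_f -> 'I_r) :
  exists x y, adj EF x y /\ c x = c y.
Proof.
have [/eqP chiF _] := critF.
apply/not_existsP => h; suff : (chi EF <= r)%N by rewrite (eqP chiF) ltnn.
apply: chi_on_le; apply/colorableP; exists c => x y _ _ xy.
by apply/eqP => cxy; apply: (h x); exists y.
Qed.

Lemma full_coloring : exists col : {ffun 'I_f -> 'I_r.+1},
  (forall x y, adj EF x y -> col x != col y) /\ (forall i, exists x, col x = i).
Proof.
have [chiF _] := critF.
have := chi_coloring EF; rewrite chiF => -[c hc].
exists (finfun c); split=> [x y xy|i]; first by rewrite !ffunE; apply: hc.
apply/not_existsP => h.
have ci x : i != c x by apply/eqP => e; apply: (h x); rewrite ffunE e.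
pose d x := odflt (Ordinal r_gt0) (unlift i (c x)).
have [x [y [xy dxy]]] := not_colorable d.
have := hc x y xy => /negP; apply; apply/eqP; move: dxy.
by rewrite /d; case: (unlift_some (ci x)) => j -> ->;
   case: (unlift_some (ci y)) => k -> -> /= ->.
Qed.

Lemma coloring_minusP (u : 'I_f) (c : {ffun 'I_f -> option 'I_r}) :
  reflect ((forall x, (c x == None) = (x == u)) /\
           (forall x y, adj EF x y -> c x != c y)) (coloring_minus EF u c).
Proof.
apply: (iffP andP) => [[/forallP h1 /forallP h2]|[h1 h2]]; split.
- by move=> x; have /eqP := h1 x.
- by move=> x y; apply/implyP; move: y; apply/forallP.
- by apply/forallP => x; rewrite h1.
- by apply/forallP => x; apply/forallP => y; apply/implyP; exact: h2.
Qed.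

Lemma coloring_minus_some (u w : 'I_f) (c : {ffun 'I_f -> option 'I_r}) :
  coloring_minus EF u c -> w != u -> exists i, c w = Some i.
Proof.
move=> /coloring_minusP[h _] /negbTE; rewrite -h.
by case: (c w) => // i _; exists i.
Qed.

(** Giving [u] a colour of its own shows that [F - u] cannot be coloured with fewer than [r]
    colours. The sum in [PF] thus runs over all pairs of a vertex and a proper colouring of the
    rest. *)
Lemma coloring_minus_critical (u : 'I_f) (c : {ffun 'I_f -> option 'I_r}) :
  coloring_minus EF u c -> critical_vertex r EF u.
Proof.
move=> hc; have /coloring_minusP[h1 h2] := hc.
have [chiF _] := critF.
rewrite /critical_vertex eqn_leq; apply/andP; split.
  apply: chi_on_le; apply/colorableP; exists (fun x => odflt (Ordinal r_gt0) (c x)).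
  move=> x y; rewrite !inE !andbT => xu yu /h2.
  have [i ->] := coloring_minus_some hc xu.
  by have [j ->] := coloring_minus_some hc yu.
have := chi_on_colorable EF ([set: 'I_f] :\ u).
move: (chi_on _ _) => k /colorableP[d hd].
rewrite -ltnS -chiF; apply: chi_on_le; apply/colorableP.
exists (fun x => if x == u then ord_max else widen_ord (leqnSn k) (d x)).
move=> x y _ _ xy; have yx : y != x by case/andP: xy; rewrite eq_sym.
case: (eqVneq x u) => [xu|xu].
  rewrite -xu (negbTE yx); apply/eqP => /(congr1 val) /= e.
  by have := ltn_ord (d y); rewrite -e ltnn.
case: (eqVneq y u) => [_|yu].
  apply/eqP => /(congr1 val) /= e.
  by have := ltn_ord (d x); rewrite e ltnn.
have := hd x y; rewrite !inE xu yu => /(_ isT isT xy).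
by apply: contra => /eqP/(congr1 val) /= e; apply/eqP/val_inj.
Qed.

(** Let [uv] be the critical edge. An [r]-colouring of [F - uv] must give [u] and [v] the same
    colour, and [v] is then the only neighbour of [u] in [F] with that colour. A transposition of
    colours moves it to any [i]. *)
Lemma star_coloring : exists u, forall i : 'I_r, exists c,
  coloring_minus EF u c /\ ycnt EF u c i = 1%N.
Proof.
have [_ [e eF chie]] := critF.
have /forall_inP/(_ e eF)/cards2P[u [v [uv ee]]] := simpleF.
have := chi_coloring (EF :\ e); rewrite chie => -[d hd].
have adjD x y : adj EF x y -> [set x; y] != e -> adj (EF :\ e) x y.
  by move=> /andP[xy xyF] ne; rewrite /adj xy !inE ne.
have duv : d u = d v.
  have [x [y [xy dxy]]] := not_colorable d.
  have xye : [set x; y] = e.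
    apply/eqP; apply: contraT => ne.
    by have := hd x y (adjD x y xy ne); rewrite dxy eqxx.
  have : u \in [set x; y] by rewrite xye ee !inE eqxx.
  have : v \in [set x; y] by rewrite xye ee !inE eqxx orbT.
  by rewrite !inE => /orP[]/eqP-> /orP[]/eqP->.
have adjuv : adj EF u v by rewrite /adj uv -ee.
exists u => i.
pose c := [ffun x => if x == u then None else Some (tperm i (d u) (d x))].
exists c; split.
  apply/coloring_minusP; split=> [x|x y xy]; first by rewrite ffunE; case: (x == u).
  rewrite !ffunE; have /andP[xny _] := xy.
  case: (eqVneq x u) => [xu|xu].
    by case: (eqVneq y u) => [yu|//]; move: xny; rewrite xu yu eqxx.
  case: (eqVneq y u) => [//|yu].
  apply/eqP => -[] /perm_inj dxy.
  have /(hd x y) : adj (EF :\ e) x y.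
    apply: adjD => //; apply: contraTneq isT => xye; move/setP/(_ u): xye.
    by rewrite ee !inE eqxx /= [u == x]eq_sym [u == y]eq_sym (negbTE xu) (negbTE yu).
  by rewrite dxy eqxx.
rewrite /ycnt (_ : [set x | _] = [set v]) ?cards1 //.
apply/setP => x; rewrite !inE ffunE; apply/andP/eqP => [[ux cx]|->]; last first.
  by split => //; rewrite [v == u]eq_sym (negbTE uv) -duv tpermR.
have /andP[unx _] := ux.
move: cx; rewrite eq_sym in unx; rewrite (negbTE unx) => /eqP[] dx.
have {}dx : d x = d u by apply: (@perm_inj _ (tperm i (d u))); rewrite tpermR.
have xue : [set u; x] = e.
  apply/eqP; apply: contraT => ne.
  by have := hd u x (adjD u x ux ne); rewrite dx eqxx.
move/setP/(_ x): xue; rewrite ee !inE eqxx orbT (negbTE unx) /=.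
by move/esym/eqP.
Qed.

(** Otherwise [u] could itself take the colour [i], and [F] would be [r]-colourable. *)
Lemma ycnt_gt0 u (c : {ffun _ -> option _}) (i : 'I_r) : coloring_minus EF u c -> (0 < ycnt EF u c i)%N.
Proof.
move=> hc; have /coloring_minusP[h1 h2] := hc.
rewrite lt0n cards_eq0; apply/negP => /eqP Y0.
pose d x := if c x is Some j then j else i.
have [x [y [xy dxy]]] := not_colorable d.
have Y z : adj EF u z -> c z = Some i -> False.
  by move=> uz cz; move/setP/(_ z): Y0; rewrite !inE uz cz eqxx.
have := h2 x y xy; move: dxy; rewrite /d.
case cx: (c x) => [j|]; case cy: (c y) => [k|] //.
- by move=> ->; rewrite eqxx.
- move=> ji _; have /eqP yu : y == u by rewrite -h1 cy.
  by apply: (Y x); rewrite -?yu 1?adj_sym // cx ji.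
- move=> ji _; have /eqP xu : x == u by rewrite -h1 cx.
  by apply: (Y y); rewrite -?xu // cy ji.
Qed.

End Colorings.

(** * The constant betaF *)

Section Beta.
Variables (R : realType) (f r : nat) (EF : {set {set 'I_f}}).
Hypotheses (simpleF : simple_graph EF) (r_ge2 : (2 <= r)%N) (critF : r_critical r EF).

Let r_gt0 : (0 < r)%N := ltnW r_ge2.
Let rR : 0 < r%:R :> R. Proof. by rewrite ltr0n. Qed.
Let rV : 0 < r%:R^-1 :> R. Proof. by rewrite invr_gt0. Qed.
Let rV1 : r%:R^-1 <= 1 :> R. Proof. by rewrite invf_le1 // ler1n. Qed.

Definition starpair : finType := ('I_f * {ffun 'I_f -> option 'I_r})%type.
Implicit Types (xi : 'I_r -> R) (p : starpair) (i : 'I_r).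

Definition is_star p := coloring_minus EF p.1 p.2.
Definition autR : R := (Defs.aut EF)%:R.

Lemma autR_gt0 : 0 < autR. Proof. by rewrite ltr0n aut_gt0. Qed.

(* [PF] is, up to [autR], the sum over the pairs [p] of a vertex [u] and a
   colouring of [F - u] of the product of these vertex weights. *)
Definition zeta xi p (w : 'I_f) : R :=
  if p.2 w is Some i then (if adj EF p.1 w then xi i else r%:R^-1) else 1.

Definition cube xi := forall i, 0 <= xi i <= r%:R^-1.

Lemma prod_zeta xi p : is_star p ->
  \prod_(i < r) (r%:R ^- (xcnt EF p.1 p.2 i) * xi i ^+ (ycnt EF p.1 p.2 i)) =
  \prod_w zeta xi p w.
Proof.
move=> /coloring_minusP[h _].
transitivity (\prod_(i < r) \prod_w (if p.2 w == Some i then zeta xi p w else 1)).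
  apply: eq_bigr => i _.
  rewrite -exprVn -!prodr_const /= [X in X * _]big_mkcond [X in _ * X]big_mkcond -big_split /=.
  apply: eq_bigr => w _; rewrite !inE /zeta.
  case: (eqVneq (p.2 w) (Some i)) => [E|_]; last by rewrite !andbF mulr1.
  have wu : w != p.1 by rewrite -h E.
  by rewrite wu E andbT andbT; case: (adj _ _ _) => /=; rewrite ?mul1r ?mulr1.
rewrite exchange_big /=; apply: eq_bigr => w _.
case E: (p.2 w) => [j|]; last by rewrite big1 // /zeta E.
rewrite (bigD1 j) //= eqxx big1 ?mulr1 // => k kj.
by case: eqP => // -[] jk; rewrite jk eqxx in kj.
Qed.

Lemma PF_E xi : autR * PF EF xi = \sum_(p | is_star p) \prod_w zeta xi p w.
Proof.
rewrite /PF mulrA divff ?mul1r; last by rewrite gt_eqF // autR_gt0.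
rewrite pair_big_dep /=; apply: eq_big => [p|p /andP[_ hp]].
  rewrite /is_star; case c: (coloring_minus _ _ _); rewrite ?andbF ?andbT //.
  exact: (coloring_minus_critical r_gt0 critF c).
by rewrite -prod_zeta.
Qed.

Lemma zeta01 xi p w : cube xi -> 0 <= zeta xi p w <= 1.
Proof.
move=> hx; rewrite /zeta; case: (p.2 w) => [i|]; last by rewrite ler01 lexx.
case: (adj _ _ _); last by rewrite rV1 ltW.
by have /andP[-> h] := hx i; exact: le_trans rV1.
Qed.

Lemma PF_ge0 xi : cube xi -> 0 <= PF EF xi.
Proof.
move=> hx; rewrite -(pmulr_rge0 _ autR_gt0) PF_E; apply: sumr_ge0 => p _.
by apply: prodr_ge0 => w _; have /andP[] := zeta01 p w hx.
Qed.

(** One term of the sum suffices, that of [star_coloring]: its single neighbour of colour [i]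
    contributes [xi i], and every other factor is at least [m]. *)
Lemma PF_lower xi i (m : R) : cube xi -> 0 <= m <= r%:R^-1 ->
  (forall j, j != i -> m <= xi j) -> xi i * m ^+ f <= autR * PF EF xi.
Proof.
move=> hx /andP[m0 mr] hm.
have m1 : m <= 1 by exact: le_trans rV1.
have [u /(_ i)[c [hc yc]]] := star_coloring simpleF critF.
have hp : is_star (u, c) by [].
rewrite PF_E (bigD1 (u, c)) //= -[leLHS]addr0; apply: lerD; last first.
  apply: sumr_ge0 => p _; apply: prodr_ge0 => w _.
  by have /andP[] := zeta01 p w hx.
have /eqP/cards1P[v vE] := yc.
have : v \in [set x | adj EF u x && (c x == Some i)] by rewrite vE inE.
rewrite inE => /andP[uv /eqP cv].
rewrite (bigD1 v) //= {1}/zeta /= cv uv; apply: ler_wpM2l; first by have /andP[] := hx i.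
have -> : m ^+ f = \prod_(w : 'I_f) m by rewrite prodr_const card_ord.
rewrite (bigD1 v) //=; apply: (@le_trans _ _ (\prod_(w | w != v) m)).
  by rewrite ler_piMl // prodr_ge0.
apply: ler_prod => w wv; rewrite m0 /= /zeta /=.
case cw: (c w) => [j|] //; case: ifP => // uw.
apply: hm; apply: contraNneq wv => ji.
have : w \in [set x | adj EF u x && (c x == Some i)] by rewrite inE uw cw ji /=.
by rewrite vE inE.
Qed.

(* To leading order, and in units of [n ^ (f - 2)], the number of embeddings of
   [F] through an edge added inside the [i]-th part of the Turan graph on [n]
   vertices; it is also the derivative of [autR * PF] along [xi i] at the point
   with [xi i = 0] and all other coordinates [1 / r]. *)
Definition edge_weight i : R :=
  \sum_(p | is_star p && (ycnt EF p.1 p.2 i == 1%N)) r%:R^-1 ^+ (f - 2).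

Definition excess xi : R := \sum_i xi i - (1 - r%:R^-1).

Lemma sum_rV : \sum_(j < r) r%:R^-1 = 1 :> R.
Proof. by rewrite sumr_const card_ord -[LHS]mulr_natl divff // gt_eqF. Qed.

Lemma sum_le1 xi : cube xi -> \sum_i xi i <= 1.
Proof.
move=> hx; apply: (@le_trans _ _ (\sum_(i < r) r%:R^-1)).
  by apply: ler_sum => i _; have /andP[] := hx i.
by rewrite sum_rV.
Qed.

Lemma p_min_lbound rho : lbound [set PF EF xi | xi in S_rho r rho]%classic (0 : R).
Proof. by move=> _ /= [xi [hx _] <-]; exact: PF_ge0. Qed.

Lemma p_min_ge0 rho : 0 <= p_min r EF rho :> R.
Proof.
(* When no vector of the cube has coordinate sum [rho], the infimum takes its default value 0. *)
rewrite /p_min; have [->|/set0P ne] := eqVneq [set PF EF xi | xi in S_rho r rho]%classic classical_sets.set0.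
  by rewrite inf0.
exact: lb_le_inf ne (@p_min_lbound rho).
Qed.

Lemma p_min_le xi : cube xi -> p_min r EF (\sum_i xi i) <= PF EF xi.
Proof.
move=> hx; apply: ge_inf; last by exists xi.
by exists 0; exact: p_min_lbound.
Qed.

Let ratios := [set p_min r EF rho / (rho - (1 - r%:R^-1)) |
  rho in [set rho : R | 1 - r%:R^-1 < rho <= 1]]%classic.

Lemma ratios_lbound : lbound ratios 0.
Proof.
move=> _ /= [rho /andP[h _] <-].
by rewrite divr_ge0 ?p_min_ge0 // subr_ge0 ltW.
Qed.

Lemma ratios_nonempty : (ratios !=set0)%classic.
Proof.
by exists (p_min r EF 1 / (1 - (1 - r%:R^-1))); exists 1 => //=;
  rewrite lexx andbT ltrBlDr ltrDl.
Qed.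

Lemma betaF_ge0 : 0 <= betaF R r EF.
Proof. exact: lb_le_inf ratios_nonempty ratios_lbound. Qed.

Lemma betaF_le xi : cube xi -> betaF R r EF * excess xi <= PF EF xi.
Proof.
move=> hx; have [s0|s0] := ltP 0 (excess xi); last first.
  by apply: le_trans (PF_ge0 hx); rewrite mulr_ge0_le0 // betaF_ge0.
rewrite -ler_pdivlMr //; apply: (@le_trans _ _ (p_min r EF (\sum_i xi i) / excess xi)).
  apply: ge_inf; first by exists 0; exact: ratios_lbound.
  by exists (\sum_i xi i) => //=; rewrite sum_le1 // andbT -subr_gt0.
by rewrite ler_pM2r ?invr_gt0 // p_min_le.
Qed.

Lemma betaF_approx eps : 0 < eps ->
  exists xi, [/\ cube xi, 0 < excess xi & PF EF xi <= (betaF R r EF + eps) * excess xi].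
Proof.
move=> e0.
have e2 : 0 < eps / 2 by rewrite divr_gt0.
have [_ [rho /= /andP[h1 h2] <-] lt1] := @inf_adherent R ratios _ e2
  (conj ratios_nonempty (ex_intro _ 0 ratios_lbound)).
have s0 : 0 < rho - (1 - r%:R^-1) by rewrite subr_gt0.
have ne : ([set PF EF xi | xi in S_rho r rho] !=set0)%classic.
  exists (PF EF (fun _ : 'I_r => rho / r%:R)); exists (fun _ => rho / r%:R) => //; split.
    move=> i; rewrite divr_ge0 ?ler0n //=; first by rewrite ler_pdivrMr // mulVf // gt_eqF.
    by apply: le_trans (ltW h1); rewrite subr_ge0.
  by rewrite sumr_const card_ord -[LHS]mulr_natr divfK // gt_eqF.
have [_ [xi [hx sx] <-] lt2] := inf_adherent (mulr_gt0 e2 s0)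
  (conj ne (ex_intro _ 0 (@p_min_lbound rho))).
exists xi; rewrite /excess sx; split => //.
have : p_min r EF rho < (betaF R r EF + eps / 2) * (rho - (1 - r%:R^-1)).
  by rewrite -ltr_pdivrMr.
rewrite -/(p_min r EF rho) in lt2; move: lt2; rewrite !mulrDl; lra.
Qed.

(** Let [i] be a smallest coordinate of [xi]. As the others are at most [1 / r], the excess is at
    most [xi i]; and a positive excess forces [xi i + xi j > 1 / r], so every other [xi j] is at
    least [m]. Then [PF_lower] bounds the ratio below. *)
Lemma betaF_gt0 : 0 < betaF R r EF.
Proof.
pose m : R := (2 * r%:R)^-1.
have m0 : 0 < m by rewrite invr_gt0 mulr_gt0.
have mE : m + m = r%:R^-1 by rewrite /m; field; rewrite gt_eqF.
have mr : m <= r%:R^-1 by rewrite -mE lerDl ltW.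
have key xi : cube xi -> 0 < excess xi -> m ^+ f / autR * excess xi <= PF EF xi.
  move=> hx s0.
  rewrite mulrAC ler_pdivrMr ?autR_gt0 // [PF _ _ * _]mulrC.
  pose i0 : 'I_r := Ordinal r_gt0.
  pose i := [arg min_(i < i0) xi i]%O.
  have imin j : xi i <= xi j by rewrite /i; case: arg_minP => // k _ /(_ j isT).
  have others k : \sum_(j | j != k) xi j <= 1 - r%:R^-1.
    apply: (@le_trans _ _ (\sum_(j < r | j != k) r%:R^-1)).
      by apply: ler_sum => j _; have /andP[] := hx j.
    by have := sum_rV; rewrite (bigD1 k) //=; lra.
  have si : excess xi <= xi i.
    by rewrite /excess (bigD1 i) //= lerBlDr lerD2l.
  apply: (@le_trans _ _ (xi i * m ^+ f)).
    by rewrite mulrC ler_wpM2r // exprn_ge0 // ltW.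
  apply: PF_lower => //; first by rewrite mr ltW.
  move=> j ji.
  have : excess xi <= xi i + xi j - r%:R^-1.
    have sumr : \sum_(k | (k != i) && (k != j)) xi k <= 1 - r%:R^-1 - r%:R^-1.
      apply: (@le_trans _ _ (\sum_(k < r | (k != i) && (k != j)) r%:R^-1)).
        by apply: ler_sum => k _; have /andP[] := hx k.
      have := sum_rV; rewrite (bigD1 i) //= (bigD1 j) //=; lra.
    by rewrite /excess (bigD1 i) //= (bigD1 j) //=; lra.
  have := imin j; move: s0 mE; lra.
apply: (@lt_le_trans _ _ (m ^+ f / autR)); first by rewrite divr_gt0 ?exprn_gt0 ?autR_gt0.
apply: lb_le_inf; first exact: ratios_nonempty.
move=> _ /= [rho /andP[h1 h2] <-].
have s0 : 0 < rho - (1 - r%:R^-1) by rewrite subr_gt0.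
rewrite ler_pdivlMr //; apply: lb_le_inf.
  exists (PF EF (fun _ : 'I_r => rho / r%:R)); exists (fun _ => rho / r%:R) => //; split.
    move=> i; rewrite divr_ge0 ?ler0n //=; first by rewrite ler_pdivrMr // mulVf // gt_eqF.
    by apply: le_trans (ltW h1); rewrite subr_ge0.
  by rewrite sumr_const card_ord -[LHS]mulr_natr divfK // gt_eqF.
move=> _ /= [xi [hx sx] <-]; rewrite -sx; apply: key => //.
by rewrite /excess sx.
Qed.

(** Test [betaF] on the vector with [xi i = t] and all other coordinates [1 / r], whose excess is
    [t]. Since every colouring uses [i] around [u], [autR * PF] is [edge_weight i * t] up to a term
    of order [t ^ 2]; then [t] tends to 0. *)
Lemma autR_betaF_le_edge_weight i : autR * betaF R r EF <= edge_weight i.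
Proof.
pose C : R := #|starpair|%:R.
have C0 : 0 <= C by rewrite ler0n.
have key t : 0 < t <= r%:R^-1 -> autR * betaF R r EF <= edge_weight i + C * t.
  move=> /andP[t0 tr].
  pose xi j : R := if j == i then t else r%:R^-1.
  have hx : cube xi.
    by move=> j; rewrite /xi; case: eqP => _; rewrite ?tr ?lexx ltW.
  have sx : excess xi = t.
    rewrite /excess (bigD1 i) //= {1}/xi eqxx (eq_bigr (fun _ => r%:R^-1)); last first.
      by move=> j /negbTE ji; rewrite /xi ji.
    have := sum_rV; rewrite (bigD1 i) //=; lra.
  have := betaF_le hx; rewrite sx => h.
  have : autR * (betaF R r EF * t) <= autR * PF EF xi.
    by rewrite ler_wpM2l // ltW // autR_gt0.
  rewrite PF_E => h'.
  rewrite -(ler_pM2r t0) -mulrA; apply: le_trans h' _.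
  rewrite mulrDl /edge_weight [X in _ <= X * _ + _]big_mkcondr /= mulr_suml.
  apply: (@le_trans _ _ (\sum_(p | is_star p) ((if ycnt EF p.1 p.2 i == 1%N
       then r%:R^-1 ^+ (f - 2) else 0) * t + t * t))); last first.
    rewrite big_split /= lerD2l sumr_const -[X in X <= _]mulr_natl -mulrA.
    by rewrite ler_wpM2r ?mulr_ge0 ?(ltW t0) // ler_nat max_card.
  apply: ler_sum => p hp.
  have y0 := ycnt_gt0 critF i hp.
  have [cN _] := coloring_minusP _ _ _ hp.
  pose Y := [set x | adj EF p.1 x && (p.2 x == Some i)].
  have YE : ycnt EF p.1 p.2 i = #|Y| by [].
  have uY : p.1 \notin Y by rewrite inE adj_irr.
  have -> : \prod_w zeta xi p w = t ^+ #|Y| * r%:R^-1 ^+ #|~: (p.1 |: Y)|.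
    rewrite -!prodr_const [X in X * _]big_mkcond [X in _ * X]big_mkcond -big_split /=.
    apply: eq_bigr => w _; rewrite !inE /zeta /xi.
    case E: (p.2 w) => [j|]; last first.
      have /eqP -> : w == p.1 by rewrite -cN E.
      by rewrite andbF eqxx mul1r.
    have -> : (w == p.1) = false by rewrite -cN E.
    have -> : (Some j == Some i) = (j == i) by [].
    by case: (adj _ _ _); case: (j == i); rewrite /= ?mul1r ?mulr1.
  have := cardsC (p.1 |: Y); rewrite cardsU1 uY card_ord /= => cE.
  move: y0; rewrite YE; case: (#|Y|) cE => [//|[|k]] cE _ /=.
    have -> : #|~: (p.1 |: Y)| = (f - 2)%N by exact: (canRL (addKn 2) cE).
    by rewrite expr1 mulrC lerDl mulr_ge0 // ltW.
  rewrite mul0r add0r !exprS -!mulrA ler_wpM2l ?(ltW t0) // ler_piMr ?(ltW t0) //.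
  have t1 : t <= 1 by exact: le_trans rV1.
  by rewrite mulr_ile1 ?exprn_ge0 ?exprn_ile1 // ltW.
rewrite leNgt; apply/negP => lt.
pose d := autR * betaF R r EF - edge_weight i.
have d0 : 0 < d by rewrite subr_gt0.
pose t := Num.min (r%:R^-1) (d / (2 * (C + 1))).
have C1 : 0 < 2 * (C + 1) by lra.
have t0 : 0 < t by rewrite lt_min rV divr_gt0.
have := key t; rewrite t0 ge_min lexx => /(_ isT).
have td : t * (2 * (C + 1)) <= d by rewrite -ler_pdivlMr // ge_min lexx orbT.
by rewrite /d in d0 td *; move: t0 td C0; nra.
Qed.

End Beta.

(** * Embeddings at a vertex and through an edge *)

Section Stars.
Variables (R : realType) (f r : nat) (EF : {set {set 'I_f}}).
Variables (n : nat) (e : rel 'I_n) (cl : 'I_n -> 'I_r) (X : {set 'I_n}).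
Hypothesis n_gt0 : (0 < n)%N.
Hypotheses (e_sym : symmetric e) (e_irr : irreflexive e).
Implicit Types (phi : {ffun 'I_f -> 'I_n}) (x y a b : 'I_n) (p : starpair f r).

Let N : R := n%:R.
Let N_gt0 : 0 < N. Proof. by rewrite ltr0n. Qed.

Definition dpart x i : R := \sum_y (e x y && (cl y == i))%:R.
Definition dmiss x : R := \sum_y ((cl y != cl x) && ~~ e x y)%:R.
Definition psize i : R := \sum_y (cl y == i)%:R.
Definition miss : R := \sum_x dmiss x.

(** Coordinates in [S] are pinned to one vertex. A pair of free coordinates is bad if it collides or
    lacks a required edge; such edges cross the partition, so [N] and [miss] bound the two kinds of
    bad pairs. *)
Lemma box_embeddings (S : {set 'I_f}) (A : 'I_f -> {set 'I_n}) (x : 'I_f -> R)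
    (k eta : R) : 0 <= k -> miss + N <= eta * N ^+ 2 ->
  (forall z, 0 <= x z <= 1) ->
  {in S, forall z, #|A z| = 1%N /\ x z = 1} ->
  (forall z, z \notin S -> (x z - k) * N <= #|A z|%:R) ->
  (forall w w' a a', w \notin S -> w' \notin S -> adj EF w w' ->
     a \in A w -> a' \in A w' -> cl a != cl a') ->
  (forall w w' a a', w \in S -> w != w' -> a \in A w -> a' \in A w' ->
     a != a' /\ (adj EF w w' -> e a a')) ->
  N ^+ (f - #|S|) * (\prod_z x z - f%:R * k - f%:R ^+ 2 * eta) <=
    #|[set phi | emb EF e phi && in_box A phi]|%:R.
Proof.
move=> k0 heta x01 hS hA hcl hfix.
have N2 : 0 < N ^+ 2 by rewrite exprn_gt0.
have miss0 : 0 <= miss by do 2!(apply: sumr_ge0 => ? _).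
have eta0 : 0 <= eta.
  by rewrite -(pmulr_lge0 _ N2); apply: le_trans heta; rewrite addr_ge0 // ltW.
pose b z : R := if z \in S then 1 else N.
pose Bad (w w' : 'I_f) : rel 'I_n := fun a a' => (a == a') || (adj EF w w' && ~~ e a a').
have bE : \prod_z b z = N ^+ (f - #|S|).
  have -> : (f - #|S|)%N = #|~: S|.
    by have := cardsC S; rewrite card_ord => /(canRL (addKn #|S|)).
  rewrite -prodr_const [RHS]big_mkcond; apply: eq_bigr => z _.
  by rewrite /b inE; case: (z \in S).
have n0' : (0 < #|'I_n|)%N by rewrite card_ord.
have -> : f%:R = #|'I_f|%:R :> R by rewrite card_ord.
rewrite -bE; apply: le_trans (@count_good_lip R _ _ n0' A b x k eta Bad eta0 k0 _ _ x01 _ _) _.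
- by move=> z; rewrite /b; case: ifP.
- move=> z; rewrite /b; case: ifP => [/hS[-> _]//|_].
  by rewrite ler_nat -[n in (_ <= n)%N]card_ord max_card.
- move=> z; rewrite /b; case: ifP => [/hS[-> ->]|/negbT/hA//].
  by rewrite mulr1 gerBl.
- move=> w w' ww.
  have zero : (w \in S) || (w' \in S) -> \sum_a \sum_a'
     ([&& a \in A w, a' \in A w' & Bad w w' a a'])%:R = 0 :> R.
    move=> wS; rewrite big1 // => a _; rewrite big1 // => a' _.
    case c: [&& _, _ & _] => //; case/and3P: c => aA aA'; rewrite /Bad.
    case/orP: wS => wS.
      have [/negbTE -> h] := hfix _ _ _ _ wS ww aA aA'.
      by move=> /andP[/h ->].
    have w'w : w' != w by rewrite eq_sym.
    have [aa h] := hfix _ _ _ _ wS w'w aA' aA; rewrite eq_sym (negbTE aa).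
    by rewrite adj_sym => /andP[/h]; rewrite e_sym => ->.
  have b0 z : 0 <= b z by rewrite /b; case: ifP; rewrite ?ltW.
  have [wS|wS] := boolP (w \in S); first by rewrite zero ?wS // !mulr_ge0.
  have [wS'|wS'] := boolP (w' \in S); first by rewrite zero ?wS' ?orbT // !mulr_ge0.
  rewrite /b (negbTE wS) (negbTE wS') -expr2; apply: le_trans heta.
  have -> : N = \sum_(a : 'I_n) \sum_(a' : 'I_n) (a' == a)%:R.
    rewrite (eq_bigr (fun _ => 1)); first by rewrite sumr_const card_ord.
    move=> a _; rewrite (bigD1 a) //= eqxx big1 ?addr0 // => a' /negbTE -> //.
  rewrite -big_split /=; apply: ler_sum => a _; rewrite -big_split /=.
  apply: ler_sum => a' _; rewrite -natrD ler_nat.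
  case c: [&& _, _ & _] => //; case/and3P: c => aA aA'.
  rewrite /Bad eq_sym; case: eqP => _ /=; first by rewrite addn1.
  by case/andP => h ->; rewrite eq_sym (hcl w w' a a').
rewrite -card_in_set; apply: ler_sum => phi _; rewrite ler_nat inE.
case c: (_ && _) => //; case/andP: c => inb /forallP h; rewrite inb andbT.
have ne w w' : w != w' -> ~~ Bad w w' (phi w) (phi w').
  by move=> ww; have /forallP/(_ w')/implyP/(_ ww) := h w.
rewrite (_ : emb _ _ _) //; apply/embP; split=> [w w'|w w' ww].
  move=> pp; apply/eqP; apply: contraT => /ne; rewrite /Bad pp eqxx //.
have /ne : w != w' by case/andP: ww.
by rewrite /Bad ww /= negb_or negbK => /andP[].
Qed.
(** A part may be slightly larger than [n / r]; the truncation keeps the vector in the cube. *)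
Definition profile x i : R := Num.min (dpart x i / N) r%:R^-1.

(** [X] is to be the set of exceptional vertices. For [x] in [X], having all other vertices avoid
    [X] makes [x] and the pair [p] recoverable from the embedding. *)
Definition star_at x p := [set phi | [&& emb EF e phi, phi p.1 == x &
  [forall w, (w != p.1) ==> (phi w \notin X) && (p.2 w == Some (cl (phi w)))]]].

Definition star_through a b p := [set phi | [&& emb EF e phi, phi p.1 == a,
  [exists v, adj EF p.1 v && (phi v == b)], [forall w, phi w \notin X] &
  [forall w, (w != p.1) ==> (p.2 w == Some (cl (phi w)))]]].

Hypothesis r_ge2 : (2 <= r)%N.

Let r_gt0 : (0 < r)%N := ltnW r_ge2.

Let rV : 0 < r%:R^-1 :> R. Proof. by rewrite invr_gt0 ltr0n. Qed.

Lemma dpart_ge0 x i : 0 <= dpart x i.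
Proof. exact: sumr_ge0. Qed.

Lemma dmiss_ge0 x : 0 <= dmiss x.
Proof. exact: sumr_ge0. Qed.

Lemma cube_profile x : cube (profile x).
Proof.
by move=> i; rewrite /profile ge_min lexx orbT andbT le_min (ltW rV) divr_ge0 ?dpart_ge0 ?ltW.
Qed.

Variables (d kx eta : R).
Hypotheses (eta_ge : miss + N <= eta * N ^+ 2) (d_ge0 : 0 <= d) (kx_ge0 : 0 <= kx).
Hypotheses (psize_ge : forall i, (r%:R^-1 - d) * N <= psize i)
  (cardX : #|X|%:R <= kx * N).

(** The critical vertex is pinned to [x]; its neighbours range over the neighbourhood of [x] in
    their part, the other vertices over their whole part. The loss [d] covers small parts and [kx]
    the removal of [X]. *)
Lemma card_star_at x p : x \in X -> is_star EF p ->
  N ^+ (f - 1) * (\prod_w zeta EF (profile x) p w - f%:R * (d + kx) - f%:R ^+ 2 * eta) <=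
  #|star_at x p|%:R.
Proof.
move=> xX hp; have [cN cP] := coloring_minusP _ _ _ hp.
pose A z : {set 'I_n} := if z == p.1 then [set x] else
  [set y | [&& y \notin X, p.2 z == Some (cl y) & adj EF p.1 z ==> e x y]].
rewrite -[X in (f - X)%N](cards1 p.1).
apply: le_trans (@box_embeddings [set p.1] A (zeta EF (profile x) p) (d + kx) eta _ eta_ge _ _ _ _ _) _.
- by rewrite addr_ge0.
- by move=> z; exact: (zeta01 EF r_ge2 p z (cube_profile x)).
- move=> z; rewrite inE => /eqP ->; rewrite /A eqxx cards1; split => //.
  by rewrite /zeta; have := cN p.1; rewrite eqxx; case: (p.2 p.1).
- move=> z; rewrite inE => zu; rewrite /A (negbTE zu).
  have [i pz] : exists i, p.2 z = Some i by exact: coloring_minus_some hp zu.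
  rewrite -card_in_set /zeta pz mulrBl mulrDl.
  have dN : 0 <= d * N by rewrite mulr_ge0 // ltW.
  case uz: (adj EF p.1 z).
    have h1 : profile x i * N <= dpart x i by rewrite -ler_pdivlMr // ge_min lexx.
    have h2 : dpart x i <= \sum_y (y \in [set y | [&& y \notin X, Some i == Some (cl y) & true ==> e x y]])%:R + #|X|%:R.
      rewrite -card_in_set -big_split /=; apply: ler_sum => y _.
      rewrite inE -natrD ler_nat; have -> : (Some i == Some (cl y)) = (cl y == i) by rewrite eq_sym.
      by case: (y \in X); case: (cl y == i); case: (e x y).
    by move: h1 h2 dN cardX; lra.
  have h2 : psize i <= \sum_y (y \in [set y | [&& y \notin X, Some i == Some (cl y) & false ==> e x y]])%:R + #|X|%:R.
    rewrite -card_in_set -big_split /=; apply: ler_sum => y _.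
    rewrite inE -natrD ler_nat; have -> : (Some i == Some (cl y)) = (cl y == i) by rewrite eq_sym.
    by case: (y \in X); case: (cl y == i).
  by have := psize_ge i; rewrite mulrBl; move: h2 dN cardX; lra.
- move=> w w' a a'; rewrite !inE => wu w'u /cP ww.
  rewrite /A (negbTE wu) (negbTE w'u) !inE => /and3P[_ /eqP h _] /and3P[_ /eqP h' _].
  by apply: contraNneq ww => aa; rewrite h h' aa.
- move=> w w' a a'; rewrite inE => /eqP -> uw'.
  rewrite /A eqxx eq_sym (negbTE uw') !inE => /eqP -> /and3P[aX _ /implyP h].
  by split => //; apply: contraNneq aX => <-.
rewrite ler_nat; apply/subset_leq_card/fintype.subsetP => phi.
rewrite !inE => /andP[-> /forallP h] /=; apply/andP; split.
  by have := h p.1; rewrite /A eqxx inE.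
apply/forallP => w; apply/implyP => wu; have := h w; rewrite /A (negbTE wu) inE.
by case/and3P => -> ->.
Qed.

(** The critical vertex is pinned to [a] and its only neighbour [v] of colour [cl a] to [b]. All
    other neighbours of either lie in different parts, of which [a] and [b] miss at most [del * N]
    vertices each; the third [del] pays for removing [a] and [b] themselves. *)
Lemma card_star_through a b p del : a \notin X -> b \notin X -> e a b ->
  cl a = cl b -> is_star EF p -> ycnt EF p.1 p.2 (cl a) = 1%N ->
  dmiss a <= del * N -> dmiss b <= del * N -> 2 <= del * N ->
  N ^+ (f - 2) * (r%:R^-1 ^+ (f - 2) - f%:R * (d + kx + 3 * del) - f%:R ^+ 2 * eta) <=
  #|star_through a b p|%:R.
Proof.
move=> aX bX eab clab hp /eqP/cards1P[v vE] ma mb del2.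
have [cN cP] := coloring_minusP _ _ _ hp.
have : v \in [set w | adj EF p.1 w && (p.2 w == Some (cl a))] by rewrite vE inE.
rewrite inE => /andP[uv /eqP cv].
have vuniq w : adj EF p.1 w -> p.2 w = Some (cl a) -> w = v.
  move=> uw cw.
  have : w \in [set w | adj EF p.1 w && (p.2 w == Some (cl a))] by rewrite inE uw cw eqxx.
  by rewrite vE inE => /eqP.
have vu : v != p.1 by case/andP: uv; rewrite eq_sym.
have ab : a != b by apply: contraTneq eab => ->; rewrite e_irr.
have del0 : 0 <= del by rewrite -(pmulr_lge0 _ N_gt0); exact: le_trans del2.
pose A z : {set 'I_n} := if z == p.1 then [set a] else if z == v then [set b] else
  [set y | [&& y \notin X, y != a, y != b, p.2 z == Some (cl y) &
     (adj EF p.1 z ==> e a y) && (adj EF v z ==> e b y)]].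
pose S := [set p.1; v].
pose x z : R := if z \in S then 1 else r%:R^-1.
have S2 : #|S| = 2%N by rewrite cards2 eq_sym vu.
have xE : \prod_z x z = r%:R^-1 ^+ (f - 2).
  have -> : (f - 2)%N = #|~: S|.
    by have := cardsC S; rewrite card_ord S2 => /(canRL (addKn 2)).
  rewrite -prodr_const [RHS]big_mkcond; apply: eq_bigr => z _.
  by rewrite /x finset.in_setC; case: (z \in S).
rewrite -xE -[X in (f - X)%N]S2.
apply: le_trans (@box_embeddings S A x (d + kx + 3 * del) eta _ eta_ge _ _ _ _ _) _.
- by rewrite !addr_ge0 // mulr_ge0.
- move=> z; rewrite /x; case: ifP => _; first by rewrite ler01 lexx.
  by rewrite (ltW rV) invf_le1 ?ler1n // ltr0n.
- move=> z zS; rewrite /x zS; split => //; move: zS; rewrite !inE /A.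
  by case: (z == p.1); [rewrite cards1|move=> /= ->; rewrite cards1].
- move=> z zS; rewrite /x (negbTE zS); move: zS; rewrite !inE negb_or => /andP[zu zv].
  rewrite /A (negbTE zu) (negbTE zv).
  have [i pz] : exists i, p.2 z = Some i by exact: coloring_minus_some hp zu.
  have hu : adj EF p.1 z -> cl a != i.
    move=> uz; apply: contraNneq zv => ai; apply/eqP; apply: vuniq => //.
    by rewrite pz ai.
  have hv : adj EF v z -> cl b != i.
    by move=> /cP; rewrite cv pz -clab; apply: contraNneq => ->.
  rewrite -card_in_set pz.
  set B := [set y | _].
  have h2 : psize i <= \sum_y (y \in B)%:R + #|X|%:R + \sum_y (y == a)%:R +
      \sum_y (y == b)%:R + dmiss a + dmiss b.
    rewrite -card_in_set -!big_split /=; apply: ler_sum => y _.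
    rewrite inE -!natrD ler_nat; have -> : (Some i == Some (cl y)) = (cl y == i) by rewrite eq_sym.
    case yi: (cl y == i) => //; rewrite (eqP yi).
    have {}hu : adj EF p.1 z ==> (i != cl a) by rewrite eq_sym; apply/implyP.
    have {}hv : adj EF v z ==> (i != cl b) by rewrite eq_sym; apply/implyP.
    move: hu hv; case: (adj EF p.1 z); case: (adj EF v z); case: (i == cl a) => //;
      case: (i == cl b) => //; case: (y \in X) => //; case: (y == a) => //;
      case: (y == b) => //; case: (e a y) => //; by case: (e b y).
  have one (c : 'I_n) : \sum_y (y == c)%:R = 1 :> R.
    by rewrite (bigD1 c) //= eqxx big1 ?addr0 // => y /negbTE ->.
  rewrite !one in h2.
  have := psize_ge i; rewrite !mulrBl !mulrDl.
  by move: h2 cardX ma mb del2; lra.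
- move=> w w' y y'; rewrite !inE !negb_or => /andP[wu wv] /andP[w'u w'v] /cP ww.
  rewrite /A (negbTE wu) (negbTE w'u) (negbTE wv) (negbTE w'v) !inE.
  move=> /and5P[_ _ _ /eqP h _] /and5P[_ _ _ /eqP h' _].
  by apply: contraNneq ww => aa; rewrite h h' aa.
- move=> w w' y y'; rewrite !inE => /orP[]/eqP -> uw'; rewrite /A.
    rewrite eqxx eq_sym (negbTE uw') !inE => /eqP ->.
    case: eqVneq => [->|w'v]; rewrite !inE; first by move=> /eqP ->; rewrite ab eab.
    by case/and5P => _ ya _ _ /andP[/implyP h _]; rewrite eq_sym ya.
  rewrite (negbTE vu) eqxx inE => /eqP ->.
  case: eqVneq => [->|w'u]; rewrite ?inE; first by move=> /eqP ->; rewrite eq_sym ab e_sym eab.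
  rewrite eq_sym (negbTE uw') !inE.
  by case/and5P => _ _ yb _ /andP[_ /implyP h]; rewrite eq_sym yb.
rewrite ler_nat; apply/subset_leq_card/fintype.subsetP => phi.
rewrite !inE => /andP[-> /forallP h] /=.
have pu : phi p.1 = a by have := h p.1; rewrite /A eqxx inE => /eqP.
have pv : phi v = b by have := h v; rewrite /A (negbTE vu) eqxx inE => /eqP.
rewrite pu eqxx /=; apply/and3P; split.
- by apply/existsP; exists v; rewrite uv pv eqxx.
- apply/forallP => w; have := h w; rewrite /A.
  case: eqP => [->|_]; first by rewrite pu.
  case: eqP => [->|_]; first by rewrite pv.
  by rewrite inE => /andP[].
- apply/forallP => w; apply/implyP => wu; have := h w; rewrite /A (negbTE wu).
  case: eqP => [->|_]; first by rewrite inE => /eqP ->; rewrite cv clab.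
  by rewrite inE => /and5P[].
Qed.

End Stars.

(** * No embedding is counted twice *)

Section StarsDisjoint.
Variables (f r : nat) (EF : {set {set 'I_f}}).
Variables (n : nat) (e : rel 'I_n) (cl : 'I_n -> 'I_r).
Implicit Types (phi : {ffun 'I_f -> 'I_n}) (x y a b : 'I_n) (p : starpair f r) (X : {set 'I_n}).

(* The orientation [ab.1 < ab.2] makes each edge count once. *)
Definition inner_edge (X : {set 'I_n}) (ab : 'I_n * 'I_n) :=
  [&& (ab.1 < ab.2)%N, ab.1 \notin X, ab.2 \notin X, e ab.1 ab.2 & cl ab.1 == cl ab.2].

Lemma star_coloringE X x p phi : phi \in star_at EF e cl X x p -> is_star EF p ->
  forall w, p.2 w = if w == p.1 then None else Some (cl (phi w)).
Proof.
rewrite inE => /and3P[_ _ /forallP h] hp w; have [cN _] := coloring_minusP _ _ _ hp.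
case: eqVneq => [->|wu]; first by have := cN p.1; rewrite eqxx => /eqP.
by have := h w; rewrite wu /= => /andP[_ /eqP].
Qed.

(** The critical vertex is the only one sent into [X], and the colours of the others are read off
    the partition. *)
Lemma star_at_inj X x x' p p' phi : x \in X -> x' \in X -> is_star EF p -> is_star EF p' ->
  phi \in star_at EF e cl X x p -> phi \in star_at EF e cl X x' p' -> (x, p) = (x', p').
Proof.
move=> xX xX' hp hp' m m'; have c := star_coloringE m hp; have c' := star_coloringE m' hp'.
move: m m'; rewrite !inE => /and3P[_ /eqP ux /forallP h] /and3P[_ /eqP ux' _].
have uu : p'.1 = p.1.
  apply/eqP; apply: contraT => ne; have := h p'.1; rewrite ne ux' /=.
  by rewrite xX'.
move: ux'; rewrite uu ux => <-; congr pair.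
have gg : p.2 = p'.2 by apply/ffunP => w; rewrite c c' uu.
by case: (p) (p') uu gg => ? ? [? ?] /= -> ->.
Qed.

(** The embedding uses a single inner edge, so two descriptions can only differ in which end of it
    is the critical vertex; the orientation of [inner_edge] excludes the exchange. *)
Lemma star_through_inj X a b a' b' p p' phi :
  inner_edge X (a, b) -> inner_edge X (a', b') -> is_star EF p -> is_star EF p' ->
  ycnt EF p.1 p.2 (cl a) = 1%N -> ycnt EF p'.1 p'.2 (cl a') = 1%N ->
  phi \in star_through EF e cl X a b p -> phi \in star_through EF e cl X a' b' p' ->
  ((a, b), p) = ((a', b'), p').
Proof.
have main p0 a0 b0 : is_star EF p0 -> phi \in star_through EF e cl X a0 b0 p0 ->
  forall w w', adj EF w w' -> cl (phi w) = cl (phi w') -> (p0.1 == w) || (p0.1 == w').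
  move=> hp m w w' ww; have [_ cP] := coloring_minusP _ _ _ hp.
  move: m; rewrite inE => /and5P[_ _ _ _ /forallP h] cww.
  apply: contraT; rewrite negb_or => /andP[uw uw'].
  have := h w; have := h w'; rewrite [w' == _]eq_sym [w == _]eq_sym uw uw' /= => /eqP c1 /eqP c2.
  by have := cP w w' ww; rewrite c1 c2 cww eqxx.
have getv p0 a0 b0 : phi \in star_through EF e cl X a0 b0 p0 ->
  phi p0.1 = a0 /\ exists v, adj EF p0.1 v /\ phi v = b0.
  by rewrite inE => /and5P[_ /eqP ua /existsP[v /andP[uv /eqP vb]] _ _]; split=> //; exists v.
have colE p0 a0 b0 : is_star EF p0 -> phi \in star_through EF e cl X a0 b0 p0 ->
  forall w, p0.2 w = if w == p0.1 then None else Some (cl (phi w)).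
  move=> hp; rewrite inE => /and5P[_ _ _ _ /forallP h] w.
  have [cN _] := coloring_minusP _ _ _ hp.
  case: eqVneq => [->|wu]; first by have := cN p0.1; rewrite eqxx => /eqP.
  by have := h w; rewrite wu /= => /eqP.
move=> /and5P[/= ab _ _ _ /eqP clab] /and5P[/= ab' _ _ _ /eqP clab'] hp hp' y1 y1' m m'.
have [ua [v [uv vb]]] := getv _ _ _ m; have [ua' [v' [uv' vb']]] := getv _ _ _ m'.
have /orP[/eqP uu|/eqP uv''] := main p a b hp m p'.1 v' uv' (ltac:(by rewrite ua' vb')).
  have aa : a' = a by rewrite -ua' -uu ua.
  have c := colE _ _ _ hp m; have c' := colE _ _ _ hp' m'.
  have gg : p.2 = p'.2 by apply/ffunP => w; rewrite c c' uu.
  have vv : v = v'.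
    have [w0 wE] := cards1P (introT eqP y1).
    have mem w : adj EF p.1 w -> cl (phi w) = cl a -> w = w0.
      move=> uw cw; have : w \in [set w | adj EF p.1 w && (p.2 w == Some (cl a))].
        rewrite inE uw c cw /=; have /negbTE -> : w != p.1; last by rewrite eqxx.
        by case/andP: uw; rewrite eq_sym.
      by rewrite wE inE => /eqP.
    by rewrite (mem v uv) ?vb // (mem v') // ?uu ?vb' // -clab' aa.
  by rewrite aa -vb -vb' vv; congr pair; case: (p) (p') uu gg => ? ? [? ?] /= -> ->.
have /orP[/eqP uu|/eqP uv3] := main p' a' b' hp' m' p.1 v uv (ltac:(by rewrite ua vb)).
  by have := uv'; rewrite uu -uv'' adj_irr.
have e1 : a = b' by rewrite -ua -vb' uv''.
have e2 : a' = b by rewrite -ua' -vb uv3.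
by move: ab ab'; rewrite e1 e2 => /ltn_trans h /h; rewrite ltnn.
Qed.

(** Embeddings of the first kind meet [X], those of the second avoid it. *)
Lemma star_total (X XB : {set 'I_n}) : XB \subset X ->
  (\sum_(x in XB) \sum_(p | is_star EF p) #|star_at EF e cl X x p| +
   \sum_(ab | inner_edge X ab)
     \sum_(p | is_star EF p && (ycnt EF p.1 p.2 (cl ab.1) == 1)) #|star_through EF e cl X ab.1 ab.2 p|
   <= nemb EF e)%N.
Proof.
move=> /fintype.subsetP sub.
pose M := [set phi | emb EF e phi].
pose H := [set phi : {ffun 'I_f -> 'I_n} | [exists w, phi w \in X]].
rewrite /nemb -(cardsID H); apply: leq_add.
  rewrite pair_big_dep /=.
  apply: (sum_card_disjoint (P := fun q => (q.1 \in XB) && is_star EF q.2)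
     (S := fun q => star_at EF e cl X q.1 q.2)).
    move=> [x p] /= /andP[/sub xX _]; apply/fintype.subsetP => phi.
    rewrite !inE => /and3P[-> /eqP ux _] /=.
    by apply/existsP; exists p.1; rewrite ux.
  move=> [x p] [x' p'] phi /= /andP[/sub xX hp] /andP[/sub xX' hp'].
  exact: star_at_inj.
rewrite pair_big_dep /=.
apply: (sum_card_disjoint (P := fun q => inner_edge X q.1 && (is_star EF q.2 && (ycnt EF q.2.1 q.2.2 (cl q.1.1) == 1%N)))
     (S := fun q => star_through EF e cl X q.1.1 q.1.2 q.2)).
  move=> [[a b] p] /= _; apply/fintype.subsetP => phi.
  rewrite !inE => /and5P[-> _ _ /forallP h _]; rewrite andbT.
  by rewrite negb_exists; apply/forallP.
move=> [[a b] p] [[a' b'] p'] phi /= /and3P[ab hp /eqP y1] /and3P[ab' hp' /eqP y1'].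
exact: star_through_inj.
Qed.

End StarsDisjoint.

(** * Deviation from the Turan graph *)

Section Deviation.
Variables (R : realType) (r : nat).
Variables (n : nat) (e : rel 'I_n) (cl : 'I_n -> 'I_r).
Hypotheses (r_ge2 : (2 <= r)%N) (n_gt0 : (0 < n)%N).
Hypotheses (e_sym : symmetric e) (e_irr : irreflexive e).
Implicit Types (x y a b : 'I_n) (X : {set 'I_n}).

Let N : R := n%:R.
Let N_gt0 : 0 < N. Proof. by rewrite ltr0n. Qed.
Let r_gt0 : (0 < r)%N := ltnW r_ge2.
Let rR : 0 < r%:R :> R. Proof. by rewrite ltr0n. Qed.
Let rV : 0 < r%:R^-1 :> R. Proof. by rewrite invr_gt0. Qed.

Definition degR x : R := \sum_y (e x y)%:R.
Definition dbad x : R := dpart R e cl x (cl x).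
Definition badR : R := \sum_x dbad x.

Lemma sum_sqr_ge (s : 'I_r -> R) : (\sum_i s i) ^+ 2 <= r%:R * \sum_i s i ^+ 2.
Proof.
have -> : \sum_i s i = \sum_i 1 * s i by apply: eq_bigr => i _; rewrite mul1r.
have -> : r%:R = \sum_(i < r) 1 ^+ 2 :> R.
  by rewrite expr1n sumr_const card_ord.
exact: cauchy_schwarz.
Qed.

Lemma sum_cl_cond (P : pred 'I_n) :
  \sum_i \sum_(y | P y) (cl y == i)%:R = \sum_(y | P y) 1 :> R.
Proof.
rewrite exchange_big; apply: eq_bigr => y _ /=.
by rewrite (bigD1 (cl y)) //= eqxx big1 ?addr0 // => i; rewrite eq_sym => /negbTE ->.
Qed.

Lemma sum_psize : \sum_i psize R cl i = N.
Proof. by rewrite (sum_cl_cond xpredT) sumr_const card_ord. Qed.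

Lemma sum_deg_dpart x : \sum_i dpart R e cl x i = degR x.
Proof.
rewrite exchange_big; apply: eq_bigr => y _ /=.
rewrite (bigD1 (cl y)) //= eqxx andbT big1 ?addr0 // => i.
by rewrite eq_sym => /negbTE ->; rewrite andbF.
Qed.

Lemma dpart_le_psize x i : dpart R e cl x i <= psize R cl i.
Proof.
by apply: ler_sum => y _; rewrite ler_nat; case: (e x y); case: (cl y == i).
Qed.

Lemma degE x : degR x = dbad x + (N - psize R cl (cl x)) - dmiss R e cl x.
Proof.
have -> : N = \sum_(y : 'I_n) 1 :> R by rewrite sumr_const card_ord.
rewrite -sumrB -big_split -sumrB; apply: eq_bigr => y _ /=.
by case: (e x y); case: (cl y == cl x); rewrite /= ?subr0 ?subrr ?addr0 ?add0r ?subrr.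
Qed.

Lemma sum_psize_cl : \sum_x psize R cl (cl x) = \sum_i psize R cl i ^+ 2.
Proof.
transitivity (\sum_x \sum_i (cl x == i)%:R * psize R cl i).
  apply: eq_bigr => x _; rewrite (bigD1 (cl x)) //= eqxx mul1r big1 ?addr0 //.
  by move=> i; rewrite eq_sym => /negbTE ->; rewrite mul0r.
by rewrite exchange_big; apply: eq_bigr => i _ /=; rewrite -mulr_suml expr2.
Qed.

(** The degree sum equals [badR + N ^ 2 - miss] minus the sum of the squared part sizes, and that
    sum is [N ^ 2 / r] plus the variance term. So the density hypothesis bounds variance plus [miss]
    by [badR]. *)
Lemma turan_structure (eta : R) : 0 <= eta ->
  (1 - r%:R^-1) * N ^+ 2 <= \sum_x degR x -> badR <= eta ^+ 2 * N ^+ 2 ->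
  miss R e cl <= eta ^+ 2 * N ^+ 2 /\
  forall i, (r%:R^-1 - eta) * N <= psize R cl i <= (r%:R^-1 + eta) * N.
Proof.
move=> eta0 dense hbad.
have sq : \sum_i (psize R cl i - r%:R^-1 * N) ^+ 2 = \sum_i psize R cl i ^+ 2 - r%:R^-1 * N ^+ 2.
  rewrite (eq_bigr (fun i => psize R cl i ^+ 2 - (2 * r%:R^-1 * N) * psize R cl i + (r%:R^-1 * N) ^+ 2)).
    rewrite big_split sumrB /= -mulr_sumr sum_psize sumr_const card_ord -[(_ * N) ^+ 2 *+ r]mulr_natl.
    by field; rewrite gt_eqF.
  by move=> i _; ring.
have sq0 : 0 <= \sum_i (psize R cl i - r%:R^-1 * N) ^+ 2.
  by apply: sumr_ge0 => i _; rewrite sqr_ge0.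
have m0 : 0 <= miss R e cl by apply: sumr_ge0 => x _; exact: dmiss_ge0.
have key : \sum_i (psize R cl i - r%:R^-1 * N) ^+ 2 + miss R e cl <= eta ^+ 2 * N ^+ 2.
  apply: le_trans hbad; move: dense; rewrite (eq_bigr _ (fun x _ => degE x)).
  rewrite sumrB big_split sumrB /= sum_psize_cl -/badR -/(miss _ _ _) sumr_const card_ord.
  rewrite -[N *+ n]mulr_natl -/N sq; lra.
split; first by move: key sq0; lra.
move=> i.
have : (psize R cl i - r%:R^-1 * N) ^+ 2 <= (eta * N) ^+ 2.
  rewrite exprMn; apply: le_trans key; rewrite (bigD1 i) //= -addrA lerDl addr_ge0 //.
  by apply: sumr_ge0 => j _; rewrite sqr_ge0.
have eN : 0 <= eta * N by rewrite mulr_ge0 // ltW.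
rewrite -[in X in X -> _]real_normK ?num_real // ler_sqr ?nnegrE //.
by rewrite ler_norml => /andP[h1 h2]; rewrite mulrBl mulrDl; apply/andP; split; lra.
Qed.

Definition inner_deg X : R := \sum_(x | x \notin X) \sum_(y | y \notin X) (e x y && (cl y == cl x))%:R.

(** Off [X], the pairs crossing the partition obey Turan's bound for [N - #|X|] vertices, by
    Cauchy-Schwarz. Pairs meeting [X] are charged to their ends in [X], and those inside [X] are
    overcounted. *)
Lemma excess_split X :
  \sum_x degR x <= inner_deg X + (1 - r%:R^-1) * (N - #|X|%:R) ^+ 2 + 2 * \sum_(x in X) degR x.
Proof.
have h1 : \sum_x degR x <= \sum_(x | x \notin X) \sum_(y | y \notin X) (e x y)%:R
    + 2 * \sum_(x in X) degR x.
  have -> : 2 * \sum_(x in X) degR x = \sum_(x in X) degR x + \sum_x \sum_(y in X) (e x y)%:R.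
    rewrite mulrDl mul1r; congr (_ + _); rewrite exchange_big; apply: eq_bigr => x _ /=.
    by apply: eq_bigr => y _; rewrite e_sym.
  rewrite (bigID (mem X)) /= [X in _ <= X]addrCA lerD2l.
  rewrite [X in _ <= _ + X](bigID (mem X)) /= [X in _ <= _ + X]addrC addrA -big_split /=.
  rewrite -[leLHS]addr0 lerD //; last by apply: sumr_ge0 => x _; exact: sumr_ge0.
  by apply: ler_sum => x _; rewrite /degR (bigID (mem X)) /= addrC.
apply: le_trans h1 _; rewrite lerD2r.
pose s i : R := \sum_(y | y \notin X) (cl y == i)%:R.
have sE : \sum_i s i = N - #|X|%:R.
  have -> : N = #|X|%:R + \sum_(y | y \notin X) 1.
    transitivity (\sum_(y : 'I_n) 1 : R); first by rewrite sumr_const card_ord.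
    by rewrite (bigID (mem X)) /= sumr_const.
  by rewrite sum_cl_cond addrAC subrr add0r.
have h2 : \sum_(x | x \notin X) \sum_(y | y \notin X) (e x y)%:R <=
   inner_deg X + ((N - #|X|%:R) ^+ 2 - \sum_i s i ^+ 2).
  have -> : (N - #|X|%:R) ^+ 2 = \sum_(x | x \notin X) \sum_(y | y \notin X) 1.
    by rewrite -sE sum_cl_cond expr2 mulr_suml; apply: eq_bigr => x _; rewrite mul1r.
  have -> : \sum_i s i ^+ 2 = \sum_(x | x \notin X) \sum_(y | y \notin X) (cl y == cl x)%:R.
    transitivity (\sum_(x | x \notin X) \sum_i (cl x == i)%:R * s i).
      by rewrite exchange_big; apply: eq_bigr => i _ /=; rewrite -mulr_suml expr2.
    apply: eq_bigr => x _; rewrite (bigD1 (cl x)) //= eqxx mul1r big1 ?addr0 //.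
    by move=> i; rewrite eq_sym => /negbTE ->; rewrite mul0r.
  rewrite -sumrB -big_split; apply: ler_sum => x _ /=.
  rewrite -sumrB -big_split; apply: ler_sum => y _ /=.
  by case: (e x y); case: (cl y == cl x); rewrite /= ?subr0 ?subrr ?addr0 ?add0r.
apply: le_trans h2 _; rewrite lerD2l.
have := sum_sqr_ge s; rewrite sE => h3.
have : r%:R^-1 * (N - #|X|%:R) ^+ 2 <= \sum_i s i ^+ 2 by rewrite ler_pdivrMl.
by rewrite mulrBl mul1r; lra.
Qed.

Lemma inner_degE X : inner_deg X = 2 * #|[set ab | inner_edge e cl X ab]|%:R.
Proof.
rewrite /inner_deg -card_in_set.
have -> : \sum_(ab : 'I_n * 'I_n) (ab \in [set ab | inner_edge e cl X ab])%:R =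
   \sum_x \sum_y (inner_edge e cl X (x, y))%:R :> R.
  by rewrite pair_bigA; apply: eq_bigr => -[x y] _; rewrite inE.
rewrite mulrDl mul1r [X in _ = _ + X]exchange_big -big_split big_mkcond.
apply: eq_bigr => x _ /=.
case xX: (x \in X) => /=.
  by rewrite -big_split big1 // => y _; rewrite /inner_edge /= xX /= !andbF addr0.
rewrite -big_split big_mkcond; apply: eq_bigr => y _ /=.
rewrite /inner_edge /= xX e_sym eq_sym.
case: (y \in X); rewrite /= ?andbF ?addr0 //.
case: (cl x == cl y); rewrite ?andbF ?addr0 // !andbT.
have [E|xy] := eqVneq x y; first by rewrite E e_irr !andbF addr0.
case: (e y x); rewrite ?andbF ?addr0 // !andbT.
case: (ltngtP x y) => [_|_|/val_inj E]; rewrite ?addr0 ?add0r //.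
by rewrite E eqxx in xy.
Qed.

End Deviation.

(** * Counting embeddings over a near-optimal partition *)

Section CoreBound.
Variables (R : realType) (f r : nat) (EF : {set {set 'I_f}}).
Variables (n : nat) (e : rel 'I_n) (cl : 'I_n -> 'I_r).
Hypotheses (simpleF : simple_graph EF) (r_ge2 : (2 <= r)%N) (critF : r_critical r EF).
Hypotheses (n_gt0 : (0 < n)%N) (e_sym : symmetric e) (e_irr : irreflexive e).
Implicit Types (x y a b : 'I_n) (p : starpair f r).

Let N : R := n%:R.
Let N_gt0 : 0 < N. Proof. by rewrite ltr0n. Qed.
Let r_gt0 : (0 < r)%N := ltnW r_ge2.
Let rR : 0 < r%:R :> R. Proof. by rewrite ltr0n. Qed.
Let rV : 0 < r%:R^-1 :> R. Proof. by rewrite invr_gt0. Qed.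

Lemma f_ge2 : (2 <= f)%N.
Proof.
have [u /(_ (Ordinal r_gt0))[c [_ /eqP/cards1P[v vE]]]] := star_coloring simpleF critF.
have : v \in [set x | adj EF u x && (c x == Some (Ordinal r_gt0))] by rewrite vE inE.
rewrite inE => /andP[/andP[uv _] _].
by have := max_card (mem [set u; v]); rewrite cards2 uv card_ord.
Qed.

Variables (q delta eta : R).
Hypotheses (q_ge0 : 0 <= q) (eta_gt0 : 0 < eta) (eta_le1 : eta <= 1)
  (eta_delta : eta <= delta / 4) (delta_r : delta / 4 <= r%:R^-1) (etaN : 1 <= eta * N).
Hypotheses (dense : (1 - r%:R^-1) * N ^+ 2 + 2 * q <= \sum_x degR R e x)
  (bad_le : badR R e cl <= eta ^+ 2 * N ^+ 2)
  (maxcut : forall x i, dbad R e cl x <= dpart R e cl x i).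

(** The two thresholds differ by a factor 4 so that a vertex of [XM], gaining less than
    [delta / 4 * N] inside its part and losing [delta * N] across, stays [delta / 2 * N] below the
    Turan degree, even after the part size error [eta <= delta / 4]. *)
Let XB := [set x | delta / 4 * N <= dbad R e cl x].
Let XM := [set x | (x \notin XB) && (delta * N <= dmiss R e cl x)].
Let X := XB :|: XM.
Let kB : R := #|XB|%:R.
Let kM : R := #|XM|%:R.
Let C0 : R := #|starpair f r|%:R.
Let F : R := f%:R.
(** Per pair, the loss is [3 * eta] for each vertex, made of [eta] for part sizes and [2 * eta] for
    [X], and [2 * eta] for each pair of vertices. In [C2] the pinned edge adds [3 * delta], and
    [eta] is bounded by [delta]. *)
Let C1 : R := C0 * (3 * F + 2 * F ^+ 2).
Let C2 : R := C0 * (6 * F + 2 * F ^+ 2).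

Let delta_gt0 : 0 < delta.
Proof. by have := lt_le_trans eta_gt0 eta_delta; rewrite pmulr_lgt0 ?invr_gt0. Qed.

Let struct : miss R e cl <= eta ^+ 2 * N ^+ 2 /\
  forall i, (r%:R^-1 - eta) * N <= psize R cl i <= (r%:R^-1 + eta) * N.
Proof.
apply: turan_structure => //; first exact: ltW.
by apply: le_trans dense; rewrite lerDl mulr_ge0.
Qed.

(** Markov's inequality. The square of [eta] in the hypotheses is what leaves at most [eta * N]
    exceptional vertices for any threshold [c >= eta]. *)
Let markov (P : pred 'I_n) (g : 'I_n -> R) (c : R) :
  (forall x, 0 <= g x) -> (forall x, P x -> c * N <= g x) ->
  \sum_x g x <= eta ^+ 2 * N ^+ 2 -> eta <= c -> #|[set x | P x]|%:R <= eta * N.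
Proof.
move=> g0 gP gs ec; have c0 : 0 < c by exact: lt_le_trans ec.
have h : #|[set x | P x]|%:R * (c * N) <= \sum_x g x.
  rewrite -card_in_set mulr_suml; apply: ler_sum => x _; rewrite inE.
  by case Px: (P x); rewrite ?mul1r ?mul0r //; exact: gP.
have cN : 0 < c * N by rewrite mulr_gt0.
rewrite -(ler_pM2r cN); apply: le_trans (le_trans h gs) _.
have -> : eta * N * (c * N) = (eta * c) * N ^+ 2 by ring.
by rewrite ler_wpM2r ?sqr_ge0 // expr2 ler_wpM2l // ltW.
Qed.

Let kB_le : kB <= eta * N.
Proof.
apply: (@markov (fun x => delta / 4 * N <= dbad R e cl x) _ (delta / 4) _ _ bad_le) => //.
by move=> x; exact: dpart_ge0.
Qed.

Let kM_le : kM <= eta * N.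
Proof.
apply: (@markov (fun x => (x \notin XB) && (delta * N <= dmiss R e cl x)) _ delta _ _ struct.1).
- exact: dmiss_ge0.
- by move=> x /andP[].
- by apply: le_trans eta_delta _; have := delta_gt0; lra.
Qed.

Let kX_le : #|X|%:R <= (2 * eta) * N.
Proof.
apply: (@le_trans _ _ (kB + kM)).
  by rewrite -natrD ler_nat cardsU leq_subr.
by rewrite -mulrA mulrDl mul1r lerD.
Qed.

Let miss_le : miss R e cl + N <= (2 * eta) * N ^+ 2.
Proof.
have h1 : eta ^+ 2 * N ^+ 2 <= eta * N ^+ 2.
  by rewrite ler_wpM2r ?sqr_ge0 // expr2 ler_piMr // ltW.
have h2 : N <= eta * N ^+ 2 by rewrite expr2 mulrA ler_peMl // ltW.
rewrite -mulrA mulrDl mul1r lerD //; exact: le_trans struct.1 h1.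
Qed.

Let psize_ge i : (r%:R^-1 - eta) * N <= psize R cl i.
Proof. by have /andP[] := struct.2 i. Qed.

Let psize_le i : psize R cl i <= (r%:R^-1 + eta) * N.
Proof. by have /andP[] := struct.2 i. Qed.

(** The degree deficit of the vertices in [XM] outweighs the quadratic error [2 * kM ^ 2] that their
    removal causes, as [kM <= eta * N]. Only the error from the heavy vertices survives. *)
Let excess_deg : 2 * q <= 2 * #|[set ab | inner_edge e cl X ab]|%:R +
  2 * \sum_(x in XB) (degR R e x - (1 - r%:R^-1) * N) + 2 * kB ^+ 2.
Proof.
have := le_trans dense (excess_split R cl r_ge2 e_sym X).
rewrite inner_degE //.
have dis : [disjoint XB & XM].
  rewrite disjoint_subset; apply/fintype.subsetP => x xB.
  by rewrite !inE; move: xB; rewrite inE => ->.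
have -> : \sum_(x in X) degR R e x = \sum_(x in XB) degR R e x + \sum_(x in XM) degR R e x.
  by rewrite -bigU //; apply: eq_bigl => x; rewrite !inE.
have -> : #|X|%:R = kB + kM :> R.
  by rewrite -natrD cardsU (_ : XB :&: XM = finset.set0) ?cards0 ?subn0 //; exact: disjoint_setI0.
have hM : \sum_(x in XM) degR R e x <= kM * ((1 - r%:R^-1) * N - delta / 2 * N).
  have -> : kM * ((1 - r%:R^-1) * N - delta / 2 * N) =
      \sum_(x in XM) ((1 - r%:R^-1) * N - delta / 2 * N).
    by rewrite sumr_const mulr_natl.
  apply: ler_sum => x; rewrite !inE -ltNge => /andP[h1 h2].
  rewrite (degE R e cl) -/N; have := psize_ge (cl x); rewrite !mulrBl mul1r.
  have : eta * N <= delta / 4 * N by rewrite ler_wpM2r // ltW.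
  move: h1 h2; lra.
rewrite sumrB sumr_const -[_ *+ #|XB|]mulr_natl -/kB -/N.
have kM0 : 0 <= kM by rewrite ler0n.
have kB0 : 0 <= kB by rewrite ler0n.
have h3 : (kB + kM) ^+ 2 <= 2 * kB ^+ 2 + 2 * kM ^+ 2.
  by rewrite -subr_ge0 (_ : _ - _ = (kB - kM) ^+ 2) ?sqr_ge0 //; ring.
have h4 : 2 * kM ^+ 2 <= delta / 2 * N * kM.
  rewrite expr2 mulrA ler_wpM2r //.
  have : eta * N <= delta / 4 * N by rewrite ler_wpM2r // ltW.
  have := kM_le; lra.
have h5 : (1 - r%:R^-1) * (N - (kB + kM)) ^+ 2 <=
   (1 - r%:R^-1) * (N ^+ 2 - 2 * N * (kB + kM)) + (kB + kM) ^+ 2.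
  rewrite (_ : (N - (kB + kM)) ^+ 2 = N ^+ 2 - 2 * N * (kB + kM) + (kB + kM) ^+ 2); last by ring.
  rewrite mulrDr lerD2l mulrBl mul1r gerBl mulr_ge0 ?sqr_ge0 //; exact: ltW.
move: hM h3 h4 h5.
move: (\sum_(x in XM) _) (\sum_(x in XB) _) (kB) (kM) (N) (q) (r%:R^-1) (#|_|%:R : R).
move=> sM sB b m N0 q0 t i hM h3 h4 h5 h6; nra.
Qed.

Let NfE : N ^+ (f - 1) = N * N ^+ (f - 2).
Proof. by rewrite -exprS -subSn ?f_ge2 // subSS. Qed.

Let card_is_star : \sum_(p : starpair f r | is_star EF p) 1 <= C0.
Proof. by rewrite sumr_const ler_nat max_card. Qed.

Let s1_ge : \sum_(x in XB) N ^+ (f - 1) * (autR R EF * PF EF (profile R e cl x) - C1 * eta) <=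
  (\sum_(x in XB) \sum_(p | is_star EF p) #|star_at EF e cl X x p|)%:R.
Proof.
rewrite natr_sum; apply: ler_sum => x xB.
have xX : x \in X by rewrite inE xB.
have NN : 0 <= N ^+ (f - 1) by rewrite exprn_ge0 // ltW.
rewrite natr_sum; apply: (@le_trans _ _ (\sum_(p | is_star EF p) N ^+ (f - 1) *
   (\prod_w zeta EF (profile R e cl x) p w - F * (eta + 2 * eta) - F ^+ 2 * (2 * eta)))); last first.
  apply: ler_sum => p hp.
  by apply: card_star_at => //; rewrite ?mulr_ge0 // ltW.
rewrite -mulr_sumr ler_wpM2l // PF_E //.
under [leRHS]eq_bigr do rewrite -addrA.
rewrite big_split /= lerD2l sumr_const -[leRHS]mulr_natl.
rewrite -opprD mulrN lerN2 /C1.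
have := card_is_star; rewrite sumr_const => h.
have F0 : 0 <= F by rewrite ler0n.
have h' : 0 <= F * (eta + 2 * eta) + F ^+ 2 * (2 * eta).
  by rewrite addr_ge0 ?mulr_ge0 ?sqr_ge0 ?addr_ge0 ?mulr_ge0 // ltW.
apply: le_trans (ler_wpM2r h' h) _.
by rewrite le_eqVlt; apply/orP; left; apply/eqP; ring.
Qed.

Let s2_ge (w : R) : (forall i : 'I_r, w + C2 * delta <= edge_weight R EF i) ->
  #|[set ab | inner_edge e cl X ab]|%:R * (N ^+ (f - 2) * w) <=
  (\sum_(ab | inner_edge e cl X ab) \sum_(p | is_star EF p && (ycnt EF p.1 p.2 (cl ab.1) == 1%N))
     #|star_through EF e cl X ab.1 ab.2 p|)%:R.
Proof.
move=> hw.
have -> : #|[set ab | inner_edge e cl X ab]|%:R * (N ^+ (f - 2) * w) =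
  \sum_(ab | inner_edge e cl X ab) N ^+ (f - 2) * w.
  by rewrite sumr_const cardsE mulr_natl.
rewrite natr_sum; apply: ler_sum => -[a b] /and5P[/= _ aX bX eab /eqP clab].
have NN : 0 <= N ^+ (f - 2) by rewrite exprn_ge0 // ltW.
have small y : y \notin X -> dmiss R e cl y <= delta * N.
  rewrite !inE negb_or negb_and negbK => /andP[/negbTE -> /=].
  by rewrite -ltNge => /ltW.
have eta0 := ltW eta_gt0; have delta0 := ltW delta_gt0.
have F0 : 0 <= F by rewrite ler0n.
rewrite natr_sum; apply: (@le_trans _ _ (\sum_(p | is_star EF p && (ycnt EF p.1 p.2 (cl a) == 1%N)) N ^+ (f - 2) *
   (r%:R^-1 ^+ (f - 2) - F * (eta + 2 * eta + 3 * delta) - F ^+ 2 * (2 * eta)))); last first.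
  apply: ler_sum => p /andP[hp /eqP yp].
  apply: card_star_through; rewrite ?mulr_ge0 ?small //.
  have : eta * N <= delta / 4 * N by rewrite ler_wpM2r // ltW.
  by move: etaN; lra.
rewrite -mulr_sumr ler_wpM2l //.
under [leRHS]eq_bigr do rewrite -addrA.
rewrite big_split /= -lerBlDr; apply: le_trans (hw (cl a)).
rewrite lerD2l sumr_const -[X in - X]mulr_natl -mulrN opprD !opprK /C2.
set c : R := #|_|%:R.
have hc : c <= C0 by rewrite ler_nat max_card.
have h' : 0 <= F * (eta + 2 * eta + 3 * delta) + F ^+ 2 * (2 * eta).
  by rewrite addr_ge0 ?mulr_ge0 ?sqr_ge0 ?addr_ge0 ?mulr_ge0.
apply: le_trans (ler_wpM2r h' hc) _.
rewrite -mulrA; apply: ler_wpM2l; first by rewrite ler0n.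
have h : eta <= delta by apply: le_trans eta_delta _; lra.
have h1 : F * eta <= F * delta by rewrite ler_wpM2l.
have h2 : F ^+ 2 * eta <= F ^+ 2 * delta by rewrite ler_wpM2l ?sqr_ge0.
by lra.
Qed.

Let XB_sub : XB \subset X. Proof. exact: finset.subsetUl. Qed.

Let profile_ge x i : x \in XB -> delta / 4 <= profile R e cl x i.
Proof.
rewrite inE => h; rewrite /profile le_min delta_r andbT ler_pdivlMr //.
exact: le_trans (maxcut x i).
Qed.

(** Truncating a coordinate at [1 / r] costs at most [eta], since no part exceeds
    [(1 / r + eta) * N]. *)
Let excess_profile x : degR R e x / N - (1 - r%:R^-1) - r%:R * eta <= excess (profile R e cl x).
Proof.
rewrite /excess -(sum_deg_dpart R e cl) mulr_suml addrAC lerD2r.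
have -> : r%:R * eta = \sum_(i < r) eta by rewrite sumr_const card_ord mulr_natl.
rewrite -sumrB; apply: ler_sum => i _; rewrite /profile le_min lerBlDr lerDl (ltW eta_gt0) /=.
rewrite lerBlDr ler_pdivrMr //; apply: le_trans (psize_le i).
exact: dpart_le_psize.
Qed.

(* Heavy vertices have many neighbours in every part, their own included. *)
Lemma nemb_ge_heavy :
  kB * (N ^+ (f - 1) * ((delta / 4) ^+ f.+1 - C1 * eta)) <= (nemb EF e)%:R.
Proof.
apply: (@le_trans _ _ (\sum_(x in XB) \sum_(p | is_star EF p) #|star_at EF e cl X x p|)%:R); last first.
  by rewrite ler_nat; apply: leq_trans (star_total EF e cl XB_sub); exact: leq_addr.
apply: le_trans s1_ge.
have -> : kB * (N ^+ (f - 1) * ((delta / 4) ^+ f.+1 - C1 * eta)) =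
   \sum_(x in XB) N ^+ (f - 1) * ((delta / 4) ^+ f.+1 - C1 * eta).
  by rewrite sumr_const mulr_natl.
apply: ler_sum => x xB; apply: ler_wpM2l; first by rewrite exprn_ge0 // ltW.
rewrite lerD2r exprS.
have d0 : 0 <= delta / 4 by rewrite divr_ge0 // ltW.
apply: (@le_trans _ _ (profile R e cl x (Ordinal r_gt0) * (delta / 4) ^+ f)).
  by rewrite ler_wpM2r ?exprn_ge0 // profile_ge.
apply: PF_lower => //; first exact: cube_profile.
  by rewrite d0.
by move=> j _; exact: profile_ge.
Qed.

(** Heavy vertices and inner edges both yield embeddings at rate at least [autR * b] per excess
    edge, up to errors, and [excess_deg] counts the excess edges. Taking [b] slightly below [betaF]
    gives the slack [C2 * delta] for inner edges. *)
Lemma nemb_ge (b : R) : 0 <= b ->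
  (forall i : 'I_r, autR R EF * b + C2 * delta <= edge_weight R EF i) ->
  (forall xi : 'I_r -> R, cube xi -> b * excess xi <= PF EF xi) ->
  N ^+ (f - 2) * (autR R EF * b * (q - kB ^+ 2) - (C1 + autR R EF * b * r%:R) * eta * (kB * N))
    <= (nemb EF e)%:R.
Proof.
move=> b0 hb hP.
apply: (@le_trans _ _ ((\sum_(x in XB) \sum_(p | is_star EF p) #|star_at EF e cl X x p|)%:R +
  (\sum_(ab | inner_edge e cl X ab) \sum_(p | is_star EF p && (ycnt EF p.1 p.2 (cl ab.1) == 1%N))
     #|star_through EF e cl X ab.1 ab.2 p|)%:R)); last first.
  by rewrite -natrD ler_nat; exact: (star_total EF e cl XB_sub).
apply: le_trans (lerD s1_ge (s2_ge hb)).
have A0 : 0 < autR R EF by exact: autR_gt0.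
have NN : 0 <= N ^+ (f - 2) by rewrite exprn_ge0 // ltW.
set s : R := #|[set ab | _]|%:R.
apply: (@le_trans _ _ (N ^+ (f - 2) * (\sum_(x in XB) (autR R EF * b * (degR R e x - (1 - r%:R^-1) * N)
    - (C1 + autR R EF * b * r%:R) * eta * N) + s * (autR R EF * b)))).
  apply: ler_wpM2l => //.
  rewrite sumrB sumr_const -mulr_sumr -[_ *+ #|_|]mulr_natl -/kB.
  have := excess_deg; rewrite -/s.
  move: (\sum_(x in XB) _) => t h.
  have Ab : 0 <= autR R EF * b by rewrite mulr_ge0 // ltW.
  have h2 : q - kB ^+ 2 <= s + t by lra.
  have := ler_wpM2l Ab h2; move: (autR R EF * b) => c; move: (kB) (N) => m N0; lra.
rewrite mulrDr; apply: lerD; last by rewrite mulrCA.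
rewrite mulr_sumr; apply: ler_sum => x xB.
set t := autR R EF * PF EF _ - C1 * eta.
have -> : N ^+ (f - 1) * t = N ^+ (f - 2) * (N * t) by rewrite NfE mulrAC mulrC.
apply: ler_wpM2l => //; rewrite /t.
have h1 := hP _ (cube_profile R e cl n_gt0 r_ge2 x).
have h2 := ler_wpM2l b0 (excess_profile x).
have h3 : autR R EF * (b * (degR R e x / N - (1 - r%:R^-1) - r%:R * eta)) <=
   autR R EF * PF EF (profile R e cl x).
  by rewrite ler_pM2l //; exact: le_trans h1.
apply: (@le_trans _ _ (N * (autR R EF * (b * (degR R e x / N - (1 - r%:R^-1) - r%:R * eta)) - C1 * eta))).
  rewrite le_eqVlt; apply/orP; left; apply/eqP.
  have -> : degR R e x = (degR R e x / N) * N by rewrite divfK // gt_eqF.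
  by rewrite mulfK ?gt_eqF //; ring.
by rewrite ler_pM2l // lerD2r.
Qed.

End CoreBound.

(** * The lower bound *)

Section MaxCut.
Variables (R : realType) (r n : nat) (e : rel 'I_n).
Hypotheses (e_sym : symmetric e) (e_irr : irreflexive e).

Let rest (cl : 'I_n -> 'I_r) x : R :=
  \sum_(y | y != x) \sum_(z | z != x) (e y z && (cl z == cl y))%:R.

Lemma badR_split (cl : 'I_n -> 'I_r) x : badR R e cl = rest cl x + 2 * dbad R e cl x.
Proof.
have dE : dbad R e cl x = \sum_(y | y != x) (e y x && (cl x == cl y))%:R.
  rewrite /dbad /dpart (bigD1 x) //= e_irr add0r; apply: eq_bigr => y _.
  by rewrite e_sym eq_sym.
rewrite /badR (bigD1 x) //= mulrDl mul1r addrA addrC; congr (_ + _).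
rewrite dE /rest -big_split; apply: eq_bigr => y _ /=.
by rewrite {1}/dbad /dpart (bigD1 x) //= addrC.
Qed.

(** Moving [x] to part [i] leaves [rest] unchanged and replaces [dbad] by [dpart], so a global
    minimiser has the local property. *)
Lemma exists_maxcut (cl0 : {ffun 'I_n -> 'I_r}) : exists cl : {ffun 'I_n -> 'I_r},
  badR R e cl <= badR R e cl0 /\ forall x i, dbad R e cl x <= dpart R e cl x i.
Proof.
pose cl := [arg min_(c < cl0) badR R e (c : {ffun 'I_n -> 'I_r})]%O.
have clmin (c : {ffun 'I_n -> 'I_r}) : badR R e cl <= badR R e c.
  by rewrite /cl; case: arg_minP => // k _ /(_ c isT).
exists cl; split => // x i.
have := clmin (upd cl x i); rewrite !(badR_split _ x).
have -> : rest (upd cl x i) x = rest cl x.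
  apply: eq_bigr => y /negbTE yx; apply: eq_bigr => z /negbTE zx.
  by rewrite !updE yx zx.
have -> : dbad R e (upd cl x i) x = dpart R e cl x i.
  apply: eq_bigr => y _; rewrite !updE eqxx.
  by case: (eqVneq y x) => [->|//]; rewrite e_irr.
by rewrite lerD2l ler_pM2l.
Qed.
End MaxCut.

Lemma nat_ge (R : realType) (x : R) : exists n0 : nat, forall n, (n0 <= n)%N -> x <= n%:R.
Proof.
exists (Num.bound `|x|) => n hn; apply: le_trans (ler_norm x) _.
by apply: (le_trans (ltW (Num.Theory.archi_boundP (normr_ge0 x)))); rewrite ler_nat.
Qed.

Section Lower.
Variables (R : realType) (f r : nat) (EF : {set {set 'I_f}}).
Hypotheses (simpleF : simple_graph EF) (r_ge2 : (2 <= r)%N) (critF : r_critical r EF).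

Let r_gt0 : (0 < r)%N := ltnW r_ge2.

(** As [col] is proper, every such map preserves the edges of [F]; the non-injective ones are
    bounded over pairs of identified vertices. *)
Lemma nmhom_le (T K : finType) (e : rel T) (col : {ffun 'I_f -> K}) : (0 < #|T|)%N ->
  (forall x y, adj EF x y -> col x != col y) ->
  nmhom R e col [set: 'I_f] <= (nemb EF e)%:R + f%:R ^+ 2 * #|T|%:R ^+ (f - 1).
Proof.
move=> T0 hcol; rewrite /nemb -card_in_set.
have f2 := f_ge2 simpleF r_ge2 critF.
have N0 : 0 < #|T|%:R :> R by rewrite ltr0n.
have coll (w w' : 'I_f) : w != w' ->
    \sum_(phi : {ffun 'I_f -> T}) (phi w == phi w')%:R = #|T|%:R ^+ (f - 1) :> R.
  move=> ww; apply: (mulfI (lt0r_neq0 N0)); rewrite -exprS -subSn 1?ltnW // subSS subn0.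
  rewrite -(sum_upd w) (eq_bigr (fun=> 1)); last first.
    move=> phi _; rewrite (bigD1 (phi w')) //= !updE eqxx [w' == w]eq_sym (negbTE ww) eqxx.
    by rewrite big1 ?addr0 // => a /negbTE an; rewrite !updE eqxx [w' == w]eq_sym (negbTE ww) an.
  by rewrite sumr_const card_ffun card_ord natrX.
have -> : f%:R ^+ 2 * #|T|%:R ^+ (f - 1) =
    \sum_(w : 'I_f) \sum_(w' : 'I_f) #|T|%:R ^+ (f - 1) :> R.
  by rewrite !sumr_const card_ord -mulrnA -[RHS]mulr_natl natrM.
apply: (@le_trans _ _ (\sum_(phi : {ffun 'I_f -> T}) ((phi \in [set phi | emb EF e phi])%:R +
   \sum_w \sum_(w' | w != w') (phi w == phi w')%:R))).
  apply: ler_sum => phi _; rewrite inE.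
  case hm: (mhom _ _ _ _); last by rewrite addr_ge0 //; do 2!(apply: sumr_ge0 => ? _).
  have [i|] := boolP (injectiveb phi).
    rewrite (_ : emb _ _ _); first by rewrite lerDl; do 2!(apply: sumr_ge0 => ? _).
    apply/embP; split=> [|x y /hcol]; first exact/injectiveP.
    by move/mhomP: hm; apply; rewrite inE.
  move=> /injectivePn[w [w' ww pw]].
  rewrite (bigD1 w) //= (bigD1 w') //= pw eqxx /=.
  rewrite [leRHS]addrC -!addrA lerDl !addr_ge0 //; try exact: sumr_ge0.
  by do 2!(apply: sumr_ge0 => ? _).
rewrite big_split lerD2l /= exchange_big; apply: ler_sum => w _ /=.
rewrite exchange_big /= big_mkcond; apply: ler_sum => w' _.
by case: ifP => [ww|_]; rewrite ?coll // exprn_ge0.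
Qed.

(* A transversal of the colour classes of [F]: cliques on it are copies of
   [K_(r+1)], of which there are few when there are few copies of [F]. *)
Lemma few_cliques : exists (t : 'I_r -> 'I_f) (w : 'I_f),
  [/\ injective t, w \notin [set t x | x : 'I_r] &
   forall g : R, 0 < g -> exists g' : R, 0 < g' /\ exists n0 : nat,
     forall (T : finType) (e : rel T), symmetric e -> (n0 <= #|T|)%N ->
       (nemb EF e)%:R < g' * #|T|%:R ^+ f ->
       nclq R e (w |: [set t x | x : 'I_r]) <= g * #|T|%:R ^+ f].
Proof.
have [col [hcol hsurj]] := full_coloring r_gt0 critF.
have ex i : exists x, col x == i by have [x <-] := hsurj i; exists x.
pose s i := xchoose (ex i).
have sE i : col (s i) = i by apply/eqP; exact: (xchooseP (ex i)).
have sinj : injective s by move=> i j /(congr1 col); rewrite !sE.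
exists (fun i => s (lift ord0 i)), (s ord0); split.
- by move=> i j /sinj /lift_inj.
- apply/imsetP => -[i _ /sinj] /eqP; exact/negP/neq_lift.
set S := _ |: _.
(* Cloning asks for a density at most 1. Of the density [G] it returns, half is kept for embeddings;
   for large [n] the non-injective maps fit into the other half. *)
move=> g g0; pose g1 := Num.min g 1.
have g10 : 0 < g1 by rewrite lt_min g0 ltr01.
pose G := g1 ^+ (2 ^ f); have G0 : 0 < G by rewrite exprn_gt0.
exists (G / 2); split; first by rewrite divr_gt0.
have [n0 hn0] := nat_ge (2 * f%:R ^+ 2 / G).
exists (maxn n0 1) => T e e_sym; rewrite geq_max => /andP[/hn0 hn T0] few.
rewrite leNgt; apply/negP => lt.
have f2 := f_ge2 simpleF r_ge2 critF.
have N0 : 0 < #|T|%:R :> R by rewrite ltr0n.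
have NF : 0 < #|T|%:R ^+ (f - 1) :> R by rewrite exprn_gt0.
have NE : #|T|%:R ^+ f = #|T|%:R * #|T|%:R ^+ (f - 1) :> R.
  by rewrite -exprS -subSn 1?ltnW // subSS subn0.
have h1 : g1 * #|T|%:R ^+ #|'I_f| <= nmhom R e col S.
  rewrite card_ord; apply: (@le_trans _ _ (g * #|T|%:R ^+ f)).
    by rewrite ler_wpM2r ?exprn_ge0 // ge_min lexx.
  apply: le_trans (ltW lt) _; apply: ler_sum => phi _; rewrite ler_nat.
  case c: (clq _ _ _) => //; rewrite (_ : mhom _ _ _ _) //.
  move/clqP: c => c; apply/mhomP => i j iS jS ij; apply: c => //.
  by apply: contraNneq ij => ->.
have hS w : exists2 i, i \in S & col w = col i.
  exists (s (col w)); last by rewrite sE.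
  rewrite /S; case: (unliftP ord0 (col w)) => [j ->|->]; rewrite !inE ?eqxx //.
  by apply/orP; right; apply/imsetP; exists j.
have := nmhom_all e_sym T0 hS _ h1.
rewrite (ltW g10) ge_min lexx orbT => /(_ isT).
rewrite card_ord -/G => h2.
have := le_trans h2 (nmhom_le e T0 hcol); rewrite leNgt => /negP; apply.
move: few hn; rewrite NE ler_pdivrMr // => few hn.
move: NF few; move: (#|T|%:R ^+ (f - 1)) => M M0 few.
have := ler_wpM2r (ltW M0) hn; lra.
Qed.

(* Constants are chosen in the order [delta], [eta], [d]: [delta] is the threshold
   for heavy vertices, [eta] bounds the distance to the Turan graph, and [d] is
   small enough that few copies of [F] force this distance. *)
Theorem nemb_lower (eps : R) : 0 < eps -> exists d : R, 0 < d /\ exists n0 : nat,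
  forall n (e : rel 'I_n) (q : R), (n0 <= n)%N -> symmetric e -> irreflexive e ->
    0 <= q <= d * n%:R ^+ 2 ->
    (1 - r%:R^-1) * n%:R ^+ 2 + 2 * q <= \sum_x degR R e x ->
    autR R EF * (betaF R r EF - eps) * q * n%:R ^+ (f - 2) <= (nemb EF e)%:R.
Proof.
move=> e0; have b0 := betaF_gt0 R simpleF r_ge2 critF.
set be := betaF R r EF in b0 *.
have A0 : 0 < autR R EF by exact: autR_gt0.
set A := autR R EF in A0 *.
have [le|lt] := leP be eps.
  exists 1; split => //; exists 0%N => n e q _ _ _ /andP[q0 _] _.
  apply: le_trans (ler0n _ _); rewrite mulr_le0_ge0 ?exprn_ge0 //.
  by rewrite mulr_le0_ge0 // mulr_ge0_le0 ?(ltW A0) // subr_le0.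
(* Half of [eps] lowers the rate to [b] and yields the slack for [C2 * delta]; the other half is
   shared equally by the errors in [eta * k * n] and in [k ^ 2]. *)
pose b := be - eps / 2.
have bb : 0 < b by rewrite /b; lra.
pose C0 : R := #|starpair f r|%:R.
pose C1 : R := C0 * (3 * f%:R + 2 * f%:R ^+ 2).
pose C2 : R := C0 * (6 * f%:R + 2 * f%:R ^+ 2).
have C10 : 0 <= C1 by rewrite mulr_ge0 ?addr_ge0 ?mulr_ge0 ?sqr_ge0.
have C20 : 0 <= C2 by rewrite mulr_ge0 ?addr_ge0 ?mulr_ge0 ?sqr_ge0.
have rV : 0 < r%:R^-1 :> R by rewrite invr_gt0 ltr0n.
pose delta := Num.min (4 * r%:R^-1) (A * eps / (2 * (C2 + 1))).
have delta0 : 0 < delta.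
  by rewrite lt_min mulr_gt0 //= divr_gt0 ?mulr_gt0 //; lra.
have delta1 : delta / 4 <= r%:R^-1.
  have : delta <= 4 * r%:R^-1 by rewrite ge_min lexx.
  lra.
have delta2 : C2 * delta <= A * eps / 2.
  have : delta <= A * eps / (2 * (C2 + 1)) by rewrite ge_min lexx orbT.
  rewrite ler_pdivlMr; last by lra.
  have := mulr_gt0 A0 e0; nra.
pose m := (delta / 4) ^+ f.+1.
have m0 : 0 < m by rewrite exprn_gt0 // divr_gt0.
(* With [C1 * eta <= c1], each heavy vertex accounts for [c1 * n ^ (f - 1)] embeddings. A total
   below [A * b * q * n ^ (f - 2)] thus forces [k * n <= L * q]. *)
pose c1 := m / 2.
have c10 : 0 < c1 by rewrite divr_gt0.
pose L := A * b / c1.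
have L0 : 0 < L by rewrite divr_gt0 // mulr_gt0.
pose D := C1 + A * b * r%:R.
have D0 : 0 <= D by rewrite addr_ge0 // !mulr_ge0 // ltW.
pose eta := Num.min (Num.min (delta / 4) 1) (Num.min (c1 / (C1 + 1)) (A * eps / (4 * (D + 1) * (L + 1)))).
have C11 : 0 < C1 + 1 by lra.
have DL : 0 < 4 * (D + 1) * (L + 1) by rewrite !mulr_gt0 //; lra.
have eta0 : 0 < eta.
  by rewrite !lt_min ltr01 ?divr_gt0 // ?mulr_gt0.
have eta1 : eta <= 1 by rewrite !ge_min lexx ?orbT.
have eta2 : eta <= delta / 4 by rewrite !ge_min lexx ?orbT.
have eta3 : C1 * eta <= c1.
  have : eta <= c1 / (C1 + 1) by rewrite !ge_min lexx ?orbT.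
  by rewrite ler_pdivlMr //; nra.
have eta4 : D * eta * L <= A * eps / 4.
  have : eta <= A * eps / (4 * (D + 1) * (L + 1)) by rewrite !ge_min lexx ?orbT.
  rewrite ler_pdivlMr // => h.
  have : D * eta * L <= eta * ((D + 1) * (L + 1)).
    have : 0 <= D * L by rewrite mulr_ge0 // ltW.
    move=> DL0; have : 0 <= eta * (D + L + 1) by rewrite mulr_ge0 ?(ltW eta0) //; lra.
    lra.
  lra.
have [t [w [tinj wt few]]] := few_cliques.
pose Cs : R := 3 * r%:R / \prod_(s < r) (1 - s%:R / r%:R).
have Cs0 : 0 < Cs.
  rewrite divr_gt0 ?mulr_gt0 ?ltr0n //; apply: prodr_gt0 => s _.
  by rewrite subr_gt0 ltr_pdivrMr ?ltr0n // mul1r ltr_nat.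
have gam0 : 0 < eta ^+ 2 / Cs by rewrite divr_gt0 ?exprn_gt0.
have [g' [g'0 [n1 hn1]]] := few _ gam0.
(* The first bound turns few embeddings into few cliques; the second makes
   [k ^ 2 <= (L * q / n) ^ 2] a small multiple of [q]. *)
pose d := Num.min (g' / (A * b + 1)) (eps / (4 * (b * L ^+ 2 + 1))).
have Ab0 : 0 < A * b by rewrite mulr_gt0.
have bL0 : 0 <= b * L ^+ 2 by rewrite mulr_ge0 ?sqr_ge0 // ltW.
have d0 : 0 < d by rewrite lt_min !divr_gt0 //; lra.
have d1 : A * b * d < g'.
  have : d <= g' / (A * b + 1) by rewrite ge_min lexx.
  rewrite ler_pdivlMr; [lra|lra].
have d2 : b * L ^+ 2 * d <= eps / 4.
  have : d <= eps / (4 * (b * L ^+ 2 + 1)) by rewrite ge_min lexx orbT.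
  rewrite ler_pdivlMr; [lra|lra].
exists d; split => //.
have [n2 hn2] := nat_ge eta^-1.
exists (maxn (maxn n1 n2) 1) => n e q.
rewrite !geq_max => /andP[/andP[n1n /hn2 n2n] n_gt0] e_sym e_irr /andP[q0 qd] dense.
have N0 : 0 < n%:R :> R by rewrite ltr0n.
have etaN : 1 <= eta * n%:R by rewrite -ler_pdivrMl // mulr1.
(* Once the rate [b] is reached the claim holds. Otherwise embeddings are few, which is used both
   for stability and to bound the number of heavy vertices. *)
have [big|small] := leP (A * b * q * n%:R ^+ (f - 2)) (nemb EF e)%:R.
  apply: le_trans big; rewrite ler_wpM2r ?exprn_ge0 // ler_wpM2r // ler_pM2l // /b; lra.
have f2 := f_ge2 simpleF r_ge2 critF.
have NF2 : 0 < n%:R ^+ (f - 2) :> R by rewrite exprn_gt0.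
have Nf : n%:R ^+ f = n%:R ^+ 2 * n%:R ^+ (f - 2) :> R by rewrite -exprD subnKC.
have Nf1 : n%:R ^+ (f - 1) = n%:R * n%:R ^+ (f - 2) :> R.
  by rewrite -exprS -subSn // subSS.
have hcl : nclq R e (w |: [set t x | x : 'I_r]) <= eta ^+ 2 / Cs * n%:R ^+ f.
  have := @hn1 'I_n e e_sym; rewrite card_ord; apply => //.
  apply: lt_le_trans small _; rewrite Nf mulrA ler_pM2r //.
  apply: (@le_trans _ _ (A * b * (d * n%:R ^+ 2))); first by rewrite ler_pM2l.
  by rewrite mulrA ler_wpM2r ?sqr_ge0 // ltW.
have n_gt0' : (0 < #|'I_n|)%N by rewrite card_ord.
have dense' : (1 - r%:R^-1) * #|'I_n|%:R ^+ 2 <= \sum_x \sum_y (e x y)%:R :> R.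
  by rewrite card_ord; apply: le_trans dense; rewrite lerDl mulr_ge0.
have := @stability R _ _ e e_sym n_gt0' r r_gt0 dense' t w (eta ^+ 2 / Cs) tinj wt.
rewrite !card_ord => /(_ hcl)[cl0]; rewrite -/Cs.
have -> : Cs * (eta ^+ 2 / Cs) = eta ^+ 2 by rewrite mulrC divfK // gt_eqF.
move=> bad0.
have [cl [clbad maxcut]] := exists_maxcut R e_sym e_irr cl0.
have bad : badR R e cl <= eta ^+ 2 * n%:R ^+ 2.
  apply: le_trans clbad _; apply: le_trans bad0; apply: ler_sum => y _.
  by apply: ler_sum => z _; rewrite eq_sym.
have hb (i : 'I_r) : A * b + C2 * delta <= edge_weight R EF i.
  have := autR_betaF_le_edge_weight R r_ge2 critF i; rewrite -/be -/A.
  by apply: le_trans; rewrite /b mulrBr; lra.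
have hP (xi : 'I_r -> R) : cube xi -> b * excess xi <= PF EF xi.
  move=> hx; have [s0|s0] := ltP 0 (excess xi).
    apply: le_trans (betaF_le r_ge2 critF hx).
    by rewrite ler_wpM2r ?(ltW s0) // /b -/be; lra.
  by apply: le_trans (PF_ge0 r_ge2 critF hx); rewrite mulr_ge0_le0 // ltW.
have H1 := nemb_ge_heavy simpleF r_ge2 critF n_gt0 e_sym q0 eta0 eta1 eta2 delta1 etaN dense bad maxcut.
have H2 := nemb_ge simpleF r_ge2 critF n_gt0 e_sym e_irr q0 eta0 eta1 eta2 etaN dense bad (ltW bb) hb hP.
move: H1 H2; rewrite -/C0 -/C1 -/D -/m -/A; set k : R := #|_|%:R.
have k0 : 0 <= k by rewrite ler0n.
move=> H1 H2; apply: le_trans H2.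
rewrite mulrC ler_pM2l //.
have kL : k * n%:R <= L * q.
  rewrite /L mulrAC ler_pdivlMr // -(ler_pM2r NF2).
  apply: le_trans (ltW small); apply: le_trans H1.
  have -> : k * n%:R * c1 * n%:R ^+ (f - 2) = k * (n%:R ^+ (f - 1) * c1) by rewrite Nf1; ring.
  rewrite ler_wpM2l // ler_wpM2l ?exprn_ge0 //.
  by rewrite /c1 in eta3 *; lra.
have kq : b * k ^+ 2 <= eps / 4 * q.
  have N20 : 0 < n%:R ^+ 2 :> R by rewrite exprn_gt0.
  rewrite -(ler_pM2r N20).
  have kL2 : (k * n%:R) ^+ 2 <= (L * q) ^+ 2.
    by rewrite ler_sqr // nnegrE mulr_ge0 // ltW.
  have -> : b * k ^+ 2 * n%:R ^+ 2 = b * (k * n%:R) ^+ 2 by ring.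
  apply: (@le_trans _ _ (b * (L * q) ^+ 2)); first by rewrite ler_pM2l.
  apply: (@le_trans _ _ (b * L ^+ 2 * q * (d * n%:R ^+ 2))).
    have -> : b * (L * q) ^+ 2 = b * L ^+ 2 * q * q by ring.
    by rewrite ler_wpM2l // mulr_ge0.
  rewrite (_ : _ * (d * _) = b * L ^+ 2 * d * (q * n%:R ^+ 2)); last by ring.
  by rewrite -[leRHS]mulrA ler_wpM2r // mulr_ge0 // ltW.
have h1 : D * eta * (k * n%:R) <= A * eps / 4 * q.
  apply: (@le_trans _ _ (D * eta * (L * q))).
    by rewrite ler_wpM2l // mulr_ge0 // ltW.
  by rewrite mulrA ler_wpM2r.
have h2 : A * (b * k ^+ 2) <= A * (eps / 4 * q) by rewrite ler_pM2l.
rewrite mulrBr /b in h2 *.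
move: h1 h2; move: (D * eta * _) (k ^+ 2) => u v; rewrite /b; nra.
Qed.

End Lower.

(** * The upper bound *)

Section EdgeSets.
Variable n : nat.
Implicit Types (E : {set {set 'I_n}}) (e : rel 'I_n).

Lemma handshake E : simple_graph E ->
  (\sum_x \sum_y (adj E x y : nat) = 2 * #|E|)%N.
Proof.
move=> sE; rewrite pair_bigA /=.
rewrite (eq_bigr (fun p : 'I_n * 'I_n => if adj E p.1 p.2 then 1 else 0)%N); last first.
  by move=> p _; case: (adj _ _ _).
rewrite -big_mkcond (partition_big (fun p => [set p.1; p.2]) (mem E)) /=; last first.
  by move=> p; rewrite adjE.
rewrite -sum1_card big_distrr /=; apply: eq_bigr => h hE.
have /forall_inP/(_ h hE)/cards2P[a [b [ab hab]]] := sE.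
rewrite (eq_bigl (mem [set (a, b); (b, a)])); last first.
  move=> [x y] /=; rewrite !inE !xpair_eqE hab; apply/andP/orP.
    move=> [/andP[xy _] /eqP e].
    have xab : x \in [set a; b] by rewrite -e !inE eqxx.
    have yab : y \in [set a; b] by rewrite -e !inE eqxx orbT.
    move: xab yab xy; rewrite !inE => /orP[]/eqP-> /orP[]/eqP->; rewrite ?eqxx //; by auto.
  move=> [|] /andP[/eqP-> /eqP->]; rewrite /adj ?ab ?[b == a]eq_sym ?ab.
    by rewrite -hab hE.
  by rewrite finset.setUC -hab hE.
by rewrite sum1_card cards2 xpair_eqE negb_and ab.
Qed.

Lemma sum_degR_adj (R : realType) E : simple_graph E ->
  \sum_x degR R (adj E) x = 2 * #|E|%:R.
Proof.
move=> /handshake h; rewrite -natrM -h natr_sum; apply: eq_bigr => x _.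
by rewrite natr_sum.
Qed.

Definition edges_of e : {set {set 'I_n}} := [set [set p.1; p.2] | p : 'I_n * 'I_n & e p.1 p.2].

Lemma edges_of_simple e : irreflexive e -> simple_graph (edges_of e).
Proof.
move=> ir; apply/forall_inP => h /imsetP[[x y] /=]; rewrite inE /= => exy ->.
by rewrite cards2; case: (eqVneq x y) exy => [->|//]; rewrite ir.
Qed.

Lemma adj_edges_of e : symmetric e -> irreflexive e -> adj (edges_of e) =2 e.
Proof.
move=> sy ir x y; rewrite adjE; last exact: edges_of_simple.
apply/imsetP/idP => [[[a b] /=]|exy]; last by exists (x, y) => //; rewrite inE.
rewrite inE /= => eab xyab.
have xab : x \in [set a; b] by rewrite -xyab !inE eqxx.
have yab : y \in [set a; b] by rewrite -xyab !inE eqxx orbT.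
have axy : a \in [set x; y] by rewrite xyab !inE eqxx.
have bxy : b \in [set x; y] by rewrite xyab !inE eqxx orbT.
have ab : a != b by apply: contraTneq eab => ->; rewrite ir.
have ba : b != a by rewrite eq_sym.
move: xab yab axy bxy; rewrite !inE => /orP[]/eqP-> /orP[]/eqP->;
  rewrite ?orbb ?(negbTE ab) ?(negbTE ba) // => _ _.
by rewrite sy.
Qed.

Lemma nemb_eq f (EF : {set {set 'I_f}}) e e' : e =2 e' -> nemb EF e = nemb EF e'.
Proof.
move=> h; apply/eqP; rewrite eqn_leq; apply/andP; split; apply: nembS => x y;
  by rewrite ?h // -h.
Qed.

Lemma subset_of_card (T : finType) (A : {set T}) k : (k <= #|A|)%N ->
  exists2 B : {set T}, B \subset A & #|B| = k.
Proof.
move=> kA; exists [set x in take k (enum A)].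
  by apply/fintype.subsetP => x; rewrite inE => /mem_take; rewrite mem_enum.
by rewrite cardsE (card_uniqP _) ?take_uniq ?enum_uniq // size_take -cardE; case: ltngtP kA.
Qed.

End EdgeSets.

(** * Embeddings when removing few vertices leaves an r-partite graph *)

Section Upper.
Variables (R : realType) (f r : nat) (EF : {set {set 'I_f}}).
Hypotheses (simpleF : simple_graph EF) (r_ge2 : (2 <= r)%N) (critF : r_critical r EF).

Let r_gt0 : (0 < r)%N := ltnW r_ge2.

(** [F] is not [r]-colourable, so every embedding meets [X]. Either two vertices land in [X], which
    gives the error term, or exactly one vertex [u] does, and then [cl] induces a colouring of
    [F - u] that puts the embedding in the box of a star. *)
Lemma nemb_upper n (e : rel 'I_n) (cl : 'I_n -> 'I_r) (X : {set 'I_n}) (xi : 'I_r -> R) :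
  (0 < n)%N -> cube xi ->
  (forall x y, x \notin X -> y \notin X -> e x y -> cl x != cl y) ->
  (forall x i, x \in X -> #|[set y | [&& y \notin X, cl y == i & e x y]]|%:R <= xi i * n%:R) ->
  (forall i, #|[set y | (y \notin X) && (cl y == i)]|%:R <= r%:R^-1 * n%:R :> R) ->
  (nemb EF e)%:R <= #|X|%:R * (n%:R ^+ (f - 1) * (autR R EF * PF EF xi)) +
     f%:R ^+ 2 * (#|X|%:R ^+ 2 * n%:R ^+ (f - 2)).
Proof.
move=> n_gt0 hx hcl hd hs.
have N0 : 0 < n%:R :> R by rewrite ltr0n.
have f2 := f_ge2 simpleF r_ge2 critF.
pose A x (p : starpair f r) z : {set 'I_n} := if z == p.1 then [set x] else
  [set y | [&& y \notin X, p.2 z == Some (cl y) & adj EF p.1 z ==> e x y]].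
pose B (w w' : 'I_f) z : {set 'I_n} := if (z == w) || (z == w') then X else [set: 'I_n].
have hA x p : x \in X -> is_star EF p ->
    \sum_(phi : {ffun 'I_f -> 'I_n}) (in_box (A x p) phi)%:R <=
    n%:R ^+ (f - 1) * \prod_z zeta EF xi p z.
  move=> xX hp; have [cN _] := coloring_minusP _ _ _ hp.
  have -> : n%:R ^+ (f - 1) = \prod_(z : 'I_f) (if z == p.1 then 1 else n%:R) :> R.
    rewrite (bigD1 p.1) //= eqxx mul1r (eq_bigr (fun=> n%:R)); last first.
      by move=> z /negbTE ->.
    by rewrite prodr_const cardC1 card_ord subn1.
  rewrite sum_in_box -big_split /=; apply: ler_prod => z _; rewrite ler0n /=.
  rewrite /A; case: eqP => [->|/eqP zu].
    by rewrite cards1 mul1r /zeta; have := cN p.1; rewrite eqxx; case: (p.2 p.1).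
  have [i pz] : exists i, p.2 z = Some i by exact: coloring_minus_some hp zu.
  rewrite /zeta pz mulrC; case uz: (adj EF p.1 z).
    apply: le_trans (hd x i xX); rewrite ler_nat; apply/subset_leq_card/fintype.subsetP => y.
    by rewrite !inE => /and3P[-> /eqP[->] /= ->]; rewrite eqxx.
  apply: le_trans (hs i); rewrite ler_nat; apply/subset_leq_card/fintype.subsetP => y.
  by rewrite !inE => /and3P[-> /eqP[->] _]; rewrite eqxx.
have hB (w w' : 'I_f) : w != w' ->
    \sum_(phi : {ffun 'I_f -> 'I_n}) (in_box (B w w') phi)%:R = #|X|%:R ^+ 2 * n%:R ^+ (f - 2) :> R.
  move=> ww; rewrite sum_in_box (bigD1 w) //= (bigD1 w') 1?eq_sym //= /B !eqxx orbT /= mulrA -expr2.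
  congr (_ * _); rewrite (eq_bigr (fun=> n%:R)); last first.
    by move=> z /andP[/negbTE -> /negbTE ->]; rewrite cardsT card_ord.
  rewrite prodr_const; congr (_ ^+ _).
  have := cardsC [set w; w']; rewrite card_ord cards2 ww => /(canRL (addKn 2)) <-.
  by apply: eq_card => z; rewrite finset.in_setC finset.in_set2 negb_or.
rewrite /nemb -[leLHS]card_in_set.
apply: (@le_trans _ _ (\sum_(phi : {ffun 'I_f -> 'I_n})
   (\sum_(x in X) \sum_(p | is_star EF p) (in_box (A x p) phi)%:R +
    \sum_w \sum_(w' | w != w') (in_box (B w w') phi)%:R))).
  apply: ler_sum => phi _; rewrite inE.
  have s1 : 0 <= \sum_(x in X) \sum_(p | is_star EF p) (in_box (A x p) phi)%:R :> R.
    by do 2!(apply: sumr_ge0 => ? _).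
  have s2 : 0 <= \sum_w \sum_(w' | w != w') (in_box (B w w') phi)%:R :> R.
    by do 2!(apply: sumr_ge0 => ? _).
  case ep: (emb EF e phi); last by rewrite addr_ge0.
  have [inj hom] := embP _ _ _ ep.
  have [/existsP[u uX]|noX] := boolP [exists u, phi u \in X]; last first.
    have [x [y [xy cxy]]] := not_colorable critF (fun z => cl (phi z)).
    have nX z : phi z \notin X by apply: contra noX => zX; apply/existsP; exists z.
    by have := hcl _ _ (nX x) (nX y) (hom x y xy); rewrite cxy eqxx.
  have [/existsP[w /andP[wu wX]]|no2] := boolP [exists w, (w != u) && (phi w \in X)].
    rewrite addrC (bigD1 w) //= (bigD1 u) //= (_ : in_box _ _); last first.
      apply/forallP => z; rewrite /B; case: eqP => [->//|_] /=; case: eqP => [->//|_].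
      by rewrite inE.
    by rewrite -!addrA lerDl !addr_ge0 //; do ?(apply: sumr_ge0 => ? _).
  have nX z : z != u -> phi z \notin X.
    by move=> zu; apply: contra no2 => zX; apply/existsP; exists z; rewrite zu.
  pose c := [ffun z => if z == u then None else Some (cl (phi z))].
  have hp : is_star EF (u, c).
    apply/coloring_minusP; split=> [z|y z yz]; first by rewrite ffunE; case: (z == u).
    have /andP[ynz _] := yz; rewrite !ffunE.
    case: (eqVneq y u) => [yu|yu]; case: (eqVneq z u) => [zu|zu] //.
      by move: ynz; rewrite yu zu eqxx.
    by have := hcl _ _ (nX y yu) (nX z zu) (hom y z yz); apply: contra => /eqP[->].
  rewrite (bigD1 (phi u)) //= (bigD1 (u, c)) //= (_ : in_box _ _); last first.
    apply/forallP => z; rewrite /A /=; case: eqP => [->|/eqP zu]; first by rewrite inE.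
    rewrite inE nX //= ffunE (negbTE zu) eqxx /=; apply/implyP => uz.
    exact: hom.
  by rewrite -!addrA lerDl !addr_ge0 //; do ?(apply: sumr_ge0 => ? _).
rewrite big_split; apply: lerD.
  rewrite exchange_big /=.
  have -> : #|X|%:R * (n%:R ^+ (f - 1) * (autR R EF * PF EF xi)) =
     \sum_(x in X) n%:R ^+ (f - 1) * (autR R EF * PF EF xi) by rewrite sumr_const mulr_natl.
  apply: ler_sum => x xX; rewrite exchange_big PF_E //= mulr_sumr.
  by apply: ler_sum => p hp; exact: hA.
rewrite exchange_big /=.
have -> : f%:R ^+ 2 * (#|X|%:R ^+ 2 * n%:R ^+ (f - 2)) =
    \sum_(w : 'I_f) \sum_(w' : 'I_f) (#|X|%:R ^+ 2 * n%:R ^+ (f - 2)) :> R.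
  by rewrite !sumr_const card_ord -mulrnA -[RHS]mulr_natl natrM.
apply: ler_sum => w _; rewrite exchange_big /= big_mkcond; apply: ler_sum => w' _.
by case: ifP => [ww|_]; rewrite ?hB // mulr_ge0 ?sqr_ge0 ?exprn_ge0.
Qed.

End Upper.

(** * Apexes joined to a balanced r-partite graph *)

Section Construction.
Variables (R : realType) (r n k : nat) (D : 'I_r -> nat).
Hypotheses (r_gt0 : (0 < r)%N) (kn : (k <= n)%N) (Dm : forall i, (r * D i <= n - k)%N).
Implicit Types (x y : 'I_n) (i : 'I_r).

(** Vertices from [k] on are dealt to the parts cyclically, so [(y - k) %/ r] is the rank of [y] in
    its part and an apex is joined to the first [D i] vertices of part [i]. Truncated subtraction
    gives the apexes part 0 by default. *)
Definition part_of x : 'I_r := Ordinal (ltn_pmod (x - k) r_gt0).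
Definition apexes : {set 'I_n} := [set x : 'I_n | (x < k)%N].
Definition apex_adj x y := [&& (x < k)%N, (k <= y)%N & ((y - k) %/ r < D (part_of y))%N].
Definition near_turan : rel 'I_n := fun x y =>
  [|| [&& (k <= x)%N, (k <= y)%N & part_of x != part_of y], apex_adj x y | apex_adj y x].

Lemma near_turan_sym : symmetric near_turan.
Proof.
move=> x y; rewrite /near_turan [part_of x == _]eq_sym andbCA; congr (_ || _).
by rewrite orbC.
Qed.

Lemma near_turan_irr : irreflexive near_turan.
Proof. by move=> x; rewrite /near_turan eqxx !andbF /= orbb /apex_adj; case: ltnP. Qed.

Let Q i t := [set y : 'I_n | [&& (k <= y)%N, part_of y == i & ((y - k) %/ r < t)%N]].

Let Q_le i t : (#|Q i t| <= t)%N.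
Proof.
case: t => [|t]; first by rewrite leqn0 cards_eq0; apply/eqP/setP => y; rewrite !inE !andbF.
pose g (y : 'I_n) : 'I_t.+1 := inord ((y - k) %/ r).
rewrite -[t.+1 in leqRHS](card_ord) -(card_in_imset (f := g)); first exact: max_card.
move=> x y; rewrite !inE => /and3P[kx /eqP cx tx] /and3P[ky /eqP cy ty] /(congr1 val).
rewrite /= !inordK // => dxy.
have /(congr1 val) /= mxy : part_of x = part_of y by rewrite cx cy.
apply: val_inj => /=; rewrite -(subnK kx) -(subnK ky); congr (_ + _)%N.
by rewrite (divn_eq (x - k) r) (divn_eq (y - k) r) dxy mxy.
Qed.

Let Q_ge i t : (r * t <= n - k)%N -> (t <= #|Q i t|)%N.
Proof.
move=> rt.
have lt (s : 'I_t) : (k + (s * r + i) < n)%N.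
  rewrite -ltn_subRL; apply: leq_trans rt.
  apply: (@leq_trans (s * r + r)); first by rewrite ltn_add2l ltn_ord.
  by rewrite -mulSnr mulnC leq_mul2l ltn_ord orbT.
pose g s : 'I_n := Ordinal (lt s).
have ginj : injective g.
  move=> s s' /(congr1 val) /= /addnI/addIn /eqP.
  by rewrite eqn_pmul2r // => /eqP/val_inj.
rewrite -[leqLHS]card_ord -(card_imset _ ginj); apply/subset_leq_card/fintype.subsetP.
move=> y /imsetP[s _ ->]; rewrite inE /= leq_addr /= addKn.
rewrite divnMDl // divn_small // addn0 ltn_ord andbT.
by apply/eqP/val_inj => /=; rewrite addKn modnMDl modn_small.
Qed.

Let m : R := (n - k)%:R.
Let rR : 0 < r%:R :> R. Proof. by rewrite ltr0n. Qed.

Lemma card_apexes : #|apexes| = k.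
Proof.
pose g (x : 'I_k) : 'I_n := widen_ord kn x.
have ginj : injective g by move=> x y /(congr1 val) /= /val_inj.
rewrite -[RHS]card_ord -(card_imset _ ginj); apply: eq_card => y; rewrite inE.
apply/idP/imsetP => [yk|[x _ ->] /=]; last exact: ltn_ord.
by exists (Ordinal yk) => //; apply: val_inj.
Qed.

Let part_eq i : [set y | (y \notin apexes) && (part_of y == i)] = Q i ((n - k) %/ r).+1.
Proof.
apply/setP => y; rewrite !inE -leqNgt ltnS; case: leqP => //= ky.
by rewrite leq_div2r ?andbT // leq_sub2r // ltnW.
Qed.

Lemma card_part i : #|[set y | (y \notin apexes) && (part_of y == i)]|%:R <= m / r%:R + 1 :> R.
Proof.
rewrite part_eq; apply: (@le_trans _ _ ((n - k) %/ r).+1%:R); first by rewrite ler_nat Q_le.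
by rewrite -natr1 lerD2r ler_pdivlMr // -natrM ler_nat leq_trunc_div.
Qed.

Lemma card_join x i : x \in apexes -> #|[set y | [&& y \notin apexes, part_of y == i & near_turan x y]]| = D i.
Proof.
rewrite inE => xk.
have -> : [set y | [&& y \notin apexes, part_of y == i & near_turan x y]] = Q i (D i).
  apply/setP => y; rewrite !inE -leqNgt; case: (leqP k y) => //= ky.
  case: eqP => //= yi.
  by rewrite /near_turan /apex_adj leqNgt xk ky /= [(y < k)%N]ltnNge ky /= orbF yi.
by apply/eqP; rewrite eqn_leq Q_le Q_ge.
Qed.

Lemma near_turan_proper x y : x \notin apexes -> y \notin apexes -> near_turan x y -> part_of x != part_of y.
Proof. by rewrite !inE /near_turan /apex_adj => /negbTE -> /negbTE -> /=; rewrite orbF; case/and3P. Qed.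

(** With parts of at most [m / r + 1] vertices, at most [(m / r + 1) * m] ordered pairs stay inside
    a part. Edges at the apexes are counted from both ends. *)
Lemma degR_near_turan : m ^+ 2 - (m / r%:R + 1) * m + 2 * k%:R * \sum_i (D i)%:R <= \sum_x degR R near_turan x.
Proof.
pose s i : R := #|[set y | (y \notin apexes) && (part_of y == i)]|%:R.
have sE i : s i = \sum_(y | y \notin apexes) (part_of y == i)%:R.
  rewrite /s -card_in_set [RHS]big_mkcond; apply: eq_bigr => y _; rewrite !inE.
  by case: (y < k)%N.
have cm0 : \sum_(y : 'I_n | y \notin apexes) 1 = m :> R.
  rewrite sumr_const; congr (_%:R); have := cardC (mem apexes).
  by rewrite card_apexes card_ord => /(canRL (addKn k)) <-; apply: eq_card.
have sm : \sum_i s i = m.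
  rewrite (eq_bigr _ (fun i _ => sE i)) exchange_big -cm0; apply: eq_bigr => y _ /=.
  by rewrite (bigD1 (part_of y)) //= eqxx big1 ?addr0 // => i; rewrite eq_sym => /negbTE ->.
have inner : m ^+ 2 - (m / r%:R + 1) * m <=
    \sum_(x | x \notin apexes) \sum_(y | y \notin apexes) (near_turan x y)%:R.
  apply: (@le_trans _ _ (m ^+ 2 - \sum_i s i * s i)).
    rewrite lerD2l lerN2 -{2}sm mulr_sumr; apply: ler_sum => i _.
    by rewrite ler_wpM2r ?ler0n // card_part.
  have -> : \sum_i s i * s i = \sum_(x | x \notin apexes) \sum_(y | y \notin apexes) (part_of y == part_of x)%:R.
    transitivity (\sum_i \sum_(x | x \notin apexes) (part_of x == i)%:R * s i).
      by apply: eq_bigr => i _; rewrite -mulr_suml -sE.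
    rewrite exchange_big; apply: eq_bigr => x _ /=.
    rewrite (bigD1 (part_of x)) //= eqxx mul1r big1 ?addr0 ?sE //.
    by move=> i; rewrite eq_sym => /negbTE ->; rewrite mul0r.
  rewrite expr2 -{1}cm0 mulr_suml -sumrB; apply: ler_sum => x xX.
  rewrite mul1r -cm0 -sumrB; apply: ler_sum => y yX.
  rewrite /near_turan; move: xX yX; rewrite !inE -!leqNgt => -> -> /=.
  by rewrite [part_of y == _]eq_sym; case: eqP => _ /=; rewrite ?subr0 ?subrr.
have outer x : x \in apexes -> \sum_(y | y \notin apexes) (near_turan x y)%:R = \sum_i (D i)%:R :> R.
  move=> xX; rewrite (eq_bigr (fun i => \sum_(y | y \notin apexes) ((part_of y == i) && near_turan x y)%:R)); last first.
    move=> i _; rewrite -(card_join i xX) -card_in_set [RHS]big_mkcond.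
    by apply: eq_bigr => y _; rewrite !inE; case: (y < k)%N.
  rewrite exchange_big; apply: eq_bigr => y _ /=.
  rewrite (bigD1 (part_of y)) //= eqxx big1 ?addr0 // => i.
  by rewrite eq_sym => /negbTE ->.
have cross : \sum_(x in apexes) \sum_(y | y \notin apexes) (near_turan x y)%:R = k%:R * \sum_i (D i)%:R :> R.
  by rewrite (eq_bigr _ outer) sumr_const card_apexes mulr_natl.
rewrite (bigID (mem apexes)) /=.
have -> : \sum_(x | x \notin apexes) degR R near_turan x =
    \sum_(x | x \notin apexes) \sum_(y in apexes) (near_turan x y)%:R +
    \sum_(x | x \notin apexes) \sum_(y | y \notin apexes) (near_turan x y)%:R.
  by rewrite -big_split; apply: eq_bigr => x _; rewrite /degR (bigID (mem apexes)).
have -> : \sum_(x | x \notin apexes) \sum_(y in apexes) (near_turan x y)%:R = k%:R * \sum_i (D i)%:R :> R.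
  rewrite exchange_big -cross; apply: eq_bigr => x _ /=; apply: eq_bigr => y _.
  by rewrite near_turan_sym.
have h : k%:R * \sum_i (D i)%:R <= \sum_(x in apexes) degR R near_turan x.
  rewrite -cross; apply: ler_sum => x _; rewrite /degR [leRHS](bigID (mem apexes)) /=.
  by rewrite lerDr sumr_ge0.
move: h inner; rewrite -[2 * k%:R * _]mulrA; lra.
Qed.

End Construction.

(** * The limit *)

Section Extremal.
Variables (R : realType) (f r : nat) (EF : {set {set 'I_f}}).
Hypotheses (simpleF : simple_graph EF) (r_ge2 : (2 <= r)%N) (critF : r_critical r EF).

Let r_gt0 : (0 < r)%N := ltnW r_ge2.
Let rR : 0 < r%:R :> R. Proof. by rewrite ltr0n. Qed.

Lemma copies_natr n (E : {set {set 'I_n}}) : simple_graph E ->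
  autR R EF * (copies EF E)%:R = (nemb EF (adj E))%:R.
Proof. by move=> sE; rewrite -copies_aut // natrM mulrC. Qed.

Lemma adj_irreflexive n (E : {set {set 'I_n}}) : irreflexive (adj E).
Proof. by move=> x; exact: adj_irr. Qed.

(** The construction without apexes is [r]-partite, hence free of [F]. The loss linear in [n] is
    negligible against [q]. *)
Lemma ex_num_ge n : (1 - r%:R^-1) * n%:R ^+ 2 - n%:R <= 2 * (ex_num EF n)%:R :> R.
Proof.
pose D (i : 'I_r) := 0%N.
have hD i : (r * D i <= n - 0)%N by rewrite muln0.
pose e := @near_turan r n 0 D r_gt0.
have es : symmetric e by exact: near_turan_sym.
have ei : irreflexive e by exact: near_turan_irr.
have sE := edges_of_simple ei.
have free : copies EF (edges_of e) = 0%N.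
  have : nemb EF (adj (edges_of e)) = 0%N.
    rewrite (nemb_eq _ (adj_edges_of es ei)) /nemb; apply/eqP.
    rewrite cards_eq0; apply/eqP/setP => phi; rewrite !inE; apply/negP => /embP[_ hom].
    have [x [y [xy cxy]]] := not_colorable critF (fun z => part_of 0 r_gt0 (phi z)).
    by have := @near_turan_proper r n 0 D r_gt0 (phi x) (phi y); rewrite !inE cxy eqxx => /(_ isT isT (hom _ _ xy)).
  rewrite -copies_aut // => /eqP; rewrite muln_eq0 => /orP[/eqP//|/eqP a0].
  by have := aut_gt0 EF; rewrite a0.
apply: (@le_trans _ _ (2 * #|edges_of e|%:R)); last first.
  rewrite ler_pM2l // ler_nat /ex_num; apply: (leq_bigmax_cond (edges_of e)).
  by rewrite sE free eqxx.
rewrite -sum_degR_adj //.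
have -> : \sum_x degR R (adj (edges_of e)) x = \sum_x degR R e x.
  by apply: eq_bigr => x _; apply: eq_bigr => y _; rewrite adj_edges_of.
apply: le_trans (@degR_near_turan R r n 0 D r_gt0 (leq0n n) hD).
rewrite subn0 mulr0 mul0r addr0 le_eqVlt; apply/orP; left; apply/eqP; field.
by rewrite gt_eqF.
Qed.

(* Only an upper bound up to an error [o(q)] is needed, so Simonovits' theorem
   on the exact Turan number of critical graphs can be avoided. *)
Lemma ex_num_le : exists d : R, 0 < d /\ exists n0 : nat, forall n (q : R),
  (n0 <= n)%N -> 0 < q <= d * n%:R ^+ 2 ->
  2 * (ex_num EF n)%:R <= (1 - r%:R^-1) * n%:R ^+ 2 + 2 * q.
Proof.
have b0 := betaF_gt0 R simpleF r_ge2 critF.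
have b2 : 0 < betaF R r EF / 2 by rewrite divr_gt0.
have [d [d0 [n0 hn0]]] := nemb_lower simpleF r_ge2 critF b2.
exists d; split => //; exists (maxn n0 1) => n q.
rewrite geq_max => /andP[nn n1] /andP[q0 qd].
pose K (m : nat) : bool := 2 * m%:R <= (1 - r%:R^-1) * n%:R ^+ 2 + 2 * q.
change (is_true (K (ex_num EF n))); apply: (big_ind (fun m => is_true (K m))).
- rewrite /K mulr0 addr_ge0 ?mulr_ge0 ?sqr_ge0 ?(ltW q0) // subr_ge0.
  by rewrite invf_le1 // ler1n.
- by move=> a b Ka Kb; rewrite /maxn; case: ifP.
(* A graph above this density contains embeddings by [nemb_lower], whose rate [betaF / 2] is
   positive. *)
move=> E /andP[sE /eqP free]; rewrite /K leNgt; apply/negP => lt.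
have := hn0 n (adj E) q nn (adj_sym E) (@adj_irreflexive n E).
rewrite (ltW q0) qd sum_degR_adj // => /(_ isT (ltW lt)).
rewrite -copies_natr // free mulr0 leNgt => /negP; apply.
rewrite !mulr_gt0 ?exprn_gt0 ?autR_gt0 ?ltr0n //.
by move: b0; lra.
Qed.

Lemma hF_le n q (E : {set {set 'I_n}}) : admissible EF q E ->
  (hF EF n q <= copies EF E)%N.
Proof.
move=> aE; rewrite /hF; case: pickP => [E0 aE0|/(_ E)]; last by rewrite aE.
by case: arg_minnP => // E1 _ /(_ E aE).
Qed.

Lemma hF_attained n q (E : {set {set 'I_n}}) : admissible EF q E ->
  exists2 E1 : {set {set 'I_n}}, admissible EF q E1 & hF EF n q = copies EF E1.
Proof.
move=> aE; rewrite /hF; case: pickP => [E0 aE0|/(_ E)]; last by rewrite aE.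
by case: arg_minnP => // E1 aE1 _; exists E1.
Qed.

(** Deleting edges down to the exact number cannot create embeddings. *)
Lemma exists_few_copies n q (e : rel 'I_n) : symmetric e -> irreflexive e ->
  2 * (ex_num EF n + q)%:R <= \sum_x degR R e x ->
  exists2 E : {set {set 'I_n}}, admissible EF q E &
    autR R EF * (copies EF E)%:R <= (nemb EF e)%:R.
Proof.
move=> es ei h.
have sE := edges_of_simple ei.
have : (ex_num EF n + q <= #|edges_of e|)%N.
  rewrite -(ler_nat R) -(ler_pM2l (ltr0Sn R 1)) -sum_degR_adj //.
  apply: le_trans h _; apply: ler_sum => x _; apply: ler_sum => y _.
  by rewrite adj_edges_of.
move=> /subset_of_card[E sub cE].
have sE' : simple_graph E.
  apply/forall_inP => h' hE; move/forall_inP: sE; apply.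
  exact: (fintype.subsetP sub).
exists E; first by rewrite /admissible sE' cE eqxx.
rewrite copies_natr // ler_nat -(nemb_eq _ (adj_edges_of es ei)).
apply: nembS => x y; rewrite /adj => /andP[-> xyE] /=.
exact: (fintype.subsetP sub).
Qed.

End Extremal.

(** * The two asymptotic bounds *)

Section Limit.
Variables (R : realType) (r f : nat) (EF : {set {set 'I_f}}).
Hypotheses (simpleF : simple_graph EF) (r_ge2 : (2 <= r)%N) (critF : r_critical r EF).

Let r_gt0 : (0 < r)%N := ltnW r_ge2.
Let rR : 0 < r%:R :> R. Proof. by rewrite ltr0n. Qed.
Let rV : 0 < r%:R^-1 :> R. Proof. by rewrite invr_gt0. Qed.

Lemma hF_lower (eps : R) : 0 < eps -> exists d M : R, 0 < d /\ exists n0 : nat,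
  forall n (q : nat) (E : {set {set 'I_n}}), (n0 <= n)%N ->
    M * n%:R <= q%:R -> q%:R <= d * n%:R ^+ 2 -> admissible EF q E ->
    (betaF R r EF - eps) * (q%:R * n%:R ^+ (f - 2)) <= (copies EF E)%:R.
Proof.
move=> e0; have b0 := betaF_gt0 R simpleF r_ge2 critF.
set be := betaF R r EF in b0 *.
have e2 : 0 < eps / 2 by rewrite divr_gt0.
have [d [d0 [n0 hn0]]] := nemb_lower simpleF r_ge2 critF e2.
have A0 : 0 < autR R EF by exact: autR_gt0.
(* A proportion [tau] of the [q] edges is given up to cover the linear loss in [ex_num_ge]; this
   costs at most [eps / 2] in the rate. *)
pose tau := Num.min 1 (eps / (2 * be)).
have tau0 : 0 < tau by rewrite lt_min ltr01 divr_gt0 // mulr_gt0.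
have tau1 : tau <= 1 by rewrite ge_min lexx.
have tau2 : tau * be <= eps / 2.
  have : tau <= eps / (2 * be) by rewrite ge_min lexx orbT.
  rewrite ler_pdivlMr ?mulr_gt0 //; lra.
exists d, (tau^-1); split => //; exists n0 => n q E nn qM qd /andP[sE /eqP cE].
rewrite -(ler_pM2l A0) copies_natr //.
have q0 : 0 <= q%:R :> R by [].
have nq : n%:R <= tau * q%:R by rewrite -ler_pdivrMl.
have h := hn0 n (adj E) ((1 - tau) * q%:R) nn (adj_sym E) (@adj_irreflexive n E).
have h1 : 0 <= (1 - tau) * q%:R <= d * n%:R ^+ 2.
  rewrite mulr_ge0 ?subr_ge0 //=; apply: le_trans qd.
  by rewrite mulrBl mul1r gerBl mulr_ge0 // ltW.
have h2 : (1 - r%:R^-1) * n%:R ^+ 2 + 2 * ((1 - tau) * q%:R) <= \sum_x degR R (adj E) x.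
  rewrite sum_degR_adj // cE natrD; have := ex_num_ge R simpleF r_ge2 critF n.
  have : 0 <= tau * q%:R by rewrite mulr_ge0 // ltW.
  have := nq; lra.
have [le|lt] := leP be (eps / 2).
  apply: le_trans (ler0n _ _); rewrite mulr_ge0_le0 ?(ltW A0) // mulr_le0_ge0 ?mulr_ge0 ?exprn_ge0 //.
  by move: e0 le; lra.
apply: le_trans (h h1 h2).
rewrite -!mulrA ler_wpM2l ?(ltW A0) // !mulrA ler_wpM2r ?exprn_ge0 // -mulrA mulrA ler_wpM2r //.
rewrite -/be; nra.
Qed.

Lemma exists_near_extremal n k (xi : 'I_r -> R) : (0 < n)%N -> (r <= k <= n)%N -> cube xi ->
  exists e : rel 'I_n, [/\ symmetric e, irreflexive e,
    (1 - r%:R^-1) * n%:R ^+ 2 + 2 * k%:R * n%:R * excess xi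
      - 2 * k%:R ^+ 2 - n%:R - 2 * k%:R * r%:R <= \sum_x degR R e x &
    (nemb EF e)%:R <= n%:R ^+ (f - 2) *
      (k%:R * n%:R * (autR R EF * PF EF xi) + f%:R ^+ 2 * k%:R ^+ 2)].
Proof.
move=> n0 /andP[rk kn] hx.
pose m : R := (n - k)%:R; have m0 : 0 <= m by rewrite ler0n.
have mE : m = n%:R - k%:R by rewrite /m natrB.
(* Rounding down respects [r * D i <= n - k], as [xi i <= 1 / r], and loses at most one neighbour
   per apex and part, whence the term [2 * k * r]. *)
pose D (i : 'I_r) := Num.truncn (xi i * m).
have xm i : 0 <= xi i * m by rewrite mulr_ge0 //; have /andP[] := hx i.
have Dle i : (D i)%:R <= xi i * m by rewrite truncn_le.
have Dgt i : xi i * m - 1 <= (D i)%:R.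
  by rewrite lerBlDr natr1; apply/ltW; have /andP[] := truncn_itv (xm i).
have hD i : (r * D i <= n - k)%N.
  rewrite -(ler_nat R) natrM -ler_pdivlMl //; apply: le_trans (Dle i) _.
  by rewrite ler_wpM2r //; have /andP[] := hx i.
exists (@near_turan r n k D r_gt0); split; [exact: near_turan_sym|exact: near_turan_irr| |].
  apply: le_trans (@degR_near_turan R r n k D r_gt0 kn hD); rewrite -/m.
  have h1 : (excess xi + (1 - r%:R^-1)) * m - r%:R <= \sum_i (D i)%:R.
    apply: (@le_trans _ _ (\sum_i (xi i * m - 1))); last by apply: ler_sum.
    by rewrite sumrB sumr_const card_ord -mulr_suml /excess subrK.
  have rho1 : excess xi + (1 - r%:R^-1) <= 1 by rewrite /excess subrK sum_le1.
  have k0 : 0 <= k%:R :> R by rewrite ler0n.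
  have h2 := ler_wpM2l k0 h1.
  have r1 : r%:R^-1 <= 1 :> R by rewrite invf_le1 // ler1n.
  have k2 : 0 <= k%:R ^+ 2 :> R by rewrite sqr_ge0.
  have h3 : (excess xi + (1 - r%:R^-1)) * k%:R ^+ 2 <= k%:R ^+ 2.
    by rewrite -[leRHS]mul1r ler_wpM2r.
  have h4 : 0 <= (1 - r%:R^-1) * k%:R ^+ 2 :> R by rewrite mulr_ge0 // subr_ge0.
  move: h2 h3 h4 k0; rewrite mE.
  move: (\sum_i _) (excess xi) (r%:R^-1) (k%:R : R) (n%:R : R) => S s t K N; lra.
have kR : r%:R <= k%:R :> R by rewrite ler_nat.
apply: le_trans (nemb_upper (cl := part_of k r_gt0) (X := apexes n k) (xi := xi) simpleF r_ge2 critF n0 hx _ _ _) _.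
- by move=> x y; exact: near_turan_proper.
- move=> x i xX; rewrite card_join //; apply: le_trans (Dle i) _.
  by rewrite ler_wpM2l // ?ler_nat ?leq_subr //; have /andP[] := hx i.
(* Here [r <= k] matters: it makes [(n - k) / r + 1] at most [n / r]. *)
- move=> i; apply: le_trans (@card_part R r n k r_gt0 i) _; rewrite -/m mE mulrC.
  rewrite mulrBr -addrA gerDl addrC subr_le0 -ler_pdivrMl ?invr_gt0 //.
  by rewrite invrK mulr1.
rewrite card_apexes //.
have -> : n%:R ^+ (f - 1) = n%:R * n%:R ^+ (f - 2) :> R.
  by rewrite -exprS -subSn ?(f_ge2 simpleF r_ge2 critF) // subSS.
by rewrite le_eqVlt; apply/orP; left; apply/eqP; ring.
Qed.

Lemma hF_upper (eps : R) : 0 < eps -> exists d M : R, 0 < d /\ exists n0 : nat,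
  forall n (q : nat), (n0 <= n)%N ->
    M * n%:R <= q%:R -> q%:R <= d * n%:R ^+ 2 ->
    exists2 E : {set {set 'I_n}}, admissible EF q E &
    (copies EF E)%:R <= (betaF R r EF + eps) * (q%:R * n%:R ^+ (f - 2)).
Proof.
move=> e0; have be0 := betaF_gt0 R simpleF r_ge2 critF.
set be := betaF R r EF in be0 *.
(* One [e1] each goes to the choice of [xi], to the surplus factor [1 + 2 * tau], and to embeddings
   with two vertices among the apexes. *)
pose e1 := eps / 4; have e10 : 0 < e1 by rewrite divr_gt0.
have [xi [hx s0 hP]] := betaF_approx r_ge2 critF e10.
have {}hP : PF EF xi <= (be + e1) * excess xi by [].
have A0 : 0 < autR R EF by exact: autR_gt0.
set s := excess xi in s0 hP.
have bee : 0 < be + e1 by rewrite addr_gt0.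
pose tau := Num.min 1 (e1 / (2 * (be + e1))).
have tau0 : 0 < tau by rewrite lt_min ltr01 divr_gt0 // mulr_gt0.
have tau1 : tau <= 1 by rewrite ge_min lexx.
have tau2 : 2 * tau * (be + e1) <= e1.
  have : tau <= e1 / (2 * (be + e1)) by rewrite ge_min lexx orbT.
  rewrite ler_pdivlMr ?mulr_gt0 //; lra.
(* [K] bounds [k * n / q] for the number [k] of apexes: one [tau] is the surplus of edges aimed at,
   the other the rounding of [k]. *)
have [K KE] : exists K, K = (1 + 2 * tau) / s by eexists.
have K0 : 0 < K by rewrite KE divr_gt0 //; lra.
have [d3 [d30 [n3 h3]]] := ex_num_le R simpleF r_ge2 critF.
(* In order: the range of [ex_num_le], the edge loss [2 * k ^ 2], the condition [k <= n], and the
   embeddings with two vertices among the apexes. *)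
pose d := Num.min (Num.min d3 (tau / (8 * K ^+ 2)))
                  (Num.min K^-1 (e1 * autR R EF / (f%:R ^+ 2 * K ^+ 2 + 1))).
have K2 : 0 < K ^+ 2 by rewrite exprn_gt0.
have fK0 : 0 < f%:R ^+ 2 * K ^+ 2 + 1.
  by rewrite ltr_wpDl // mulr_ge0 ?sqr_ge0.
have d0 : 0 < d.
  by rewrite !lt_min d30 invr_gt0 K0 /=; apply/andP; split; apply: divr_gt0 => //; rewrite mulr_gt0.
have dd3 : d <= d3 by rewrite !ge_min lexx.
have dK2 : K ^+ 2 * d <= tau / 8.
  have : d <= tau / (8 * K ^+ 2) by rewrite !ge_min lexx orbT.
  rewrite ler_pdivlMr; last by apply: mulr_gt0.
  move=> h; rewrite ler_pdivlMr //.
  by have -> : K ^+ 2 * d * 8 = d * (8 * K ^+ 2) by ring.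
have dK : K * d <= 1.
  have : d <= K^-1 by rewrite !ge_min lexx !orbT.
  by rewrite -ler_pdivlMl // mulr1.
have dfK : f%:R ^+ 2 * K ^+ 2 * d <= e1 * autR R EF.
  have : d <= e1 * autR R EF / (f%:R ^+ 2 * K ^+ 2 + 1) by rewrite !ge_min lexx !orbT.
  by rewrite ler_pdivlMr //; lra.
(* These constants absorb the rounding of [k], ensure [r <= k], and make [n] at most
   [tau / 4 * q]. *)
pose M := Num.max (Num.max (s / tau) (r%:R * s)) (4 / tau).
have [n4 h4] := nat_ge (8 * r%:R * K / tau).
exists d, M; split => //; exists (maxn (maxn n3 n4) 1) => n q.
rewrite !geq_max => /andP[/andP[n3n /h4 n4n] n1] qM qd.
have N0 : 0 < n%:R :> R by rewrite ltr0n.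
have M0 : 0 < M by rewrite !lt_max divr_gt0.
have q0 : 0 < q%:R :> R by apply: lt_le_trans qM; rewrite mulr_gt0.
have sN : 0 < s * n%:R by rewrite mulr_gt0.
have qM' c : c <= M -> c * n%:R <= q%:R.
  by move=> cM; apply: le_trans qM; rewrite ler_wpM2r // ltW.
have q1 : s / tau * n%:R <= q%:R by apply: qM'; rewrite !le_max lexx.
have q2 : r%:R * s * n%:R <= q%:R by apply: qM'; rewrite !le_max lexx orbT.
have q3 : 4 / tau * n%:R <= q%:R by apply: qM'; rewrite !le_max lexx !orbT.
(* Each apex brings about [s * n] excess edges. The surplus [tau * q] pays for the losses [k ^ 2],
   [n] and [k * r] and for the estimate of ex(n,F). *)
pose x := (1 + tau) * q%:R / (s * n%:R).
have x0 : 0 <= x by rewrite divr_ge0 ?mulr_ge0 ?(ltW sN) //; lra.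
pose k := (Num.truncn x).+1.
have /andP[kx1 kx2] := truncn_itv x0.
have klo : (1 + tau) * q%:R <= k%:R * (s * n%:R) by rewrite -ler_pdivrMr // ltW.
have kup : k%:R <= K * q%:R / n%:R.
  have : k%:R <= x + 1 by rewrite /k -natr1 lerD2r.
  move/le_trans; apply; rewrite -(ler_pM2r sN) mulrDl /x divfK ?gt_eqF // mul1r.
  have -> : K * q%:R / n%:R * (s * n%:R) = (1 + 2 * tau) * q%:R.
    by rewrite KE; field; rewrite !gt_eqF.
  move: q1; rewrite mulrAC ler_pdivrMr //; lra.
have rk : (r <= k)%N.
  rewrite -(ler_nat R) -(ler_pM2r sN); apply: le_trans klo.
  rewrite mulrA; apply: le_trans q2 _.
  by rewrite mulrDl mul1r lerDl mulr_ge0 // ltW.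
have kn : (k <= n)%N.
  rewrite -(ler_nat R); apply: le_trans kup _; rewrite ler_pdivrMr //.
  apply: (@le_trans _ _ (K * (d * n%:R ^+ 2))); first by rewrite ler_pM2l.
  by rewrite mulrA -expr2 -[leRHS]mul1r ler_wpM2r ?sqr_ge0.
have [e [es ei deg few]] := exists_near_extremal n1 (introT andP (conj rk kn)) hx.
have k0 : 0 <= k%:R :> R by [].
have kk c : 0 <= c -> c * k%:R ^+ 2 <= c * (K ^+ 2 * d) * q%:R.
  move=> c0; rewrite -!mulrA ler_wpM2l //.
  have N20 : 0 < n%:R ^+ 2 :> R by rewrite exprn_gt0.
  rewrite -(ler_pM2r N20) (_ : _ * n%:R ^+ 2 = (k%:R * n%:R) ^+ 2); last by ring.
  have kN : k%:R * n%:R <= K * q%:R by rewrite -ler_pdivlMr.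
  apply: (@le_trans _ _ ((K * q%:R) ^+ 2)).
    by rewrite ler_sqr // nnegrE mulr_ge0 // ltW.
  have -> : (K * q%:R) ^+ 2 = K ^+ 2 * q%:R * q%:R by ring.
  rewrite [leRHS](_ : _ = K ^+ 2 * q%:R * (d * n%:R ^+ 2)); last by ring.
  by rewrite ler_wpM2l // mulr_ge0 // ltW.
have dense : 2 * (ex_num EF n + q)%:R <= \sum_x degR R e x.
  apply: le_trans deg; rewrite -/s natrD.
  have ht : 0 < tau / 4 * q%:R <= d3 * n%:R ^+ 2.
    rewrite mulr_gt0 ?divr_gt0 //=; apply: (@le_trans _ _ q%:R).
      by rewrite ler_piMl //; lra.
    by apply: le_trans qd _; rewrite ler_wpM2r ?sqr_ge0.
  have ex := h3 n _ n3n ht.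
  have h5 : 2 * k%:R ^+ 2 <= tau / 4 * q%:R.
    apply: le_trans (kk 2 _) _ => //; rewrite ler_wpM2r ?(ltW q0) //; lra.
  have h6 : n%:R <= tau / 4 * q%:R.
    by move: q3; rewrite mulrAC ler_pdivrMr //; lra.
  have h7 : 2 * k%:R * r%:R <= tau / 4 * q%:R.
    have : 2 * r%:R * k%:R <= 2 * r%:R * (K * q%:R / n%:R) by rewrite ler_wpM2l // mulr_ge0.
    move=> h; rewrite mulrAC; apply: le_trans h _.
    rewrite mulrA ler_pdivrMr //.
    move: n4n; rewrite ler_pdivrMr // => n4n.
    have := ler_wpM2r (ltW q0) n4n; lra.
  have tq := mulr_gt0 tau0 q0.
  move: klo ex h5 h6 h7; rewrite (mulrA k%:R).
  have -> : 2 * k%:R * n%:R * s = 2 * (k%:R * s * n%:R) by ring.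
  move: (k%:R * s * n%:R) => u; lra.
have [E aE cE] := exists_few_copies simpleF es ei dense.
exists E => //; rewrite -(ler_pM2l A0); apply: le_trans cE _; apply: le_trans few _.
have NF : 0 < n%:R ^+ (f - 2) :> R by rewrite exprn_gt0.
rewrite [leRHS](_ : _ = n%:R ^+ (f - 2) * (autR R EF * (be + eps) * q%:R)); last by ring.
apply: ler_wpM2l; first exact: ltW.
have h8 : f%:R ^+ 2 * k%:R ^+ 2 <= e1 * autR R EF * q%:R.
  by apply: le_trans (kk _ (sqr_ge0 _)) _; rewrite ler_wpM2r ?(ltW q0) // mulrA.
have h9 : k%:R * n%:R * autR R EF * PF EF xi <= autR R EF * (be + e1) * ((1 + 2 * tau) * q%:R).
  apply: (@le_trans _ _ (k%:R * n%:R * autR R EF * ((be + e1) * s))).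
    by rewrite ler_wpM2l // !mulr_ge0 // ltW.
  have -> : k%:R * n%:R * autR R EF * ((be + e1) * s) =
     autR R EF * (be + e1) * (k%:R * (s * n%:R)) by ring.
  apply: ler_wpM2l; first by rewrite mulr_ge0 // ltW.
  rewrite -ler_pdivlMr //; apply: le_trans kup _.
  by rewrite le_eqVlt; apply/orP; left; apply/eqP; rewrite KE; field; rewrite !gt_eqF.
have h10 : 0 <= autR R EF * q%:R by rewrite mulr_ge0 // ltW.
have h11 : (autR R EF * q%:R) * (2 * tau * (be + e1)) <= (autR R EF * q%:R) * e1 by rewrite ler_wpM2l.
rewrite /e1 in h8 h9 h11 *; have := mulr_ge0 h10 (ltW e0); lra.
Qed.

End Limit.
Local Open Scope classical_set_scope.

Theorem theorem7 (R : realType) (r f : nat) (EF : {set {set 'I_f}})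
  (q : nat -> nat) :
  (2 <= r)%N ->
  simple_graph EF ->
  r_critical r EF ->
  ((q n)%:R / (n%:R ^+ 2) : R) @[n --> \oo] --> 0%R ->
  ((q n)%:R / n%:R : R) @[n --> \oo] --> +oo%R ->
  ((hF EF n (q n))%:R / ((q n)%:R * n%:R ^+ (f - 2)) : R) @[n --> \oo]
    --> betaF R r EF.
Proof.
move=> r_ge2 simpleF critF q0 qoo.
have evd (d : R) : 0 < d -> exists n0 : nat, forall n, (n0 <= n)%N -> (q n)%:R <= d * n%:R ^+ 2.
  move=> d0; have /cvgrPdist_le/(_ d d0)[n0 _ hn0] := q0.
  exists (maxn n0 1) => n; rewrite geq_max => /andP[/hn0 /= + n1].
  have N0 : 0 < n%:R :> R by rewrite ltr0n.
  have N2 : 0 < n%:R ^+ 2 :> R by rewrite exprn_gt0.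
  have x0 : 0 <= (q n)%:R / n%:R ^+ 2 :> R by rewrite divr_ge0 // ltW.
  by rewrite sub0r normrN (ger0_norm x0) ler_pdivrMr.
have evM (M : R) : exists n0 : nat, forall n, (n0 <= n)%N -> M * n%:R <= (q n)%:R.
  have /cvgryPge/(_ M)[n0 _ hn0] := qoo.
  exists (maxn n0 1) => n; rewrite geq_max => /andP[/hn0 /= + n1].
  by rewrite ler_pdivlMr // ltr0n.
apply/cvgrPdist_le => eps e0.
have [d1 [M1 [d10 [n1 h1]]]] := hF_lower simpleF r_ge2 critF e0.
have [d2 [M2 [d20 [n2 h2]]]] := hF_upper simpleF r_ge2 critF e0.
have [m1 k1] := evd _ d10; have [m2 k2] := evd _ d20.
have [m3 k3] := evM M1; have [m4 k4] := evM M2; have [m5 k5] := evM 1.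
exists (maxn (maxn (maxn n1 n2) (maxn m1 m2)) (maxn (maxn m3 m4) (maxn m5 1))) => // n /=.
rewrite !geq_max.
move=> /andP[/andP[/andP[n1n n2n] /andP[m1n m2n]] /andP[/andP[m3n m4n] /andP[m5n n0]]].
have N0 : 0 < n%:R :> R by rewrite ltr0n.
have Q0 : 0 < (q n)%:R :> R by apply: lt_le_trans N0 _; rewrite -[leLHS]mul1r; exact: k5.
have [E aE ub] := h2 n (q n) n2n (k4 n m4n) (k2 n m2n).
(* The graph [E] shows that the minimum is over a nonempty family, so [hF] is not at its default
   value 0. *)
have [E1 aE1 hE] := hF_attained aE.
have lb := h1 n (q n) E1 n1n (k3 n m3n) (k1 n m1n) aE1.
have D0 : 0 < (q n)%:R * n%:R ^+ (f - 2) :> R by rewrite mulr_gt0 // exprn_gt0.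
have ub' : (hF EF n (q n))%:R <= (betaF R r EF + eps) * ((q n)%:R * n%:R ^+ (f - 2)).
  by apply: le_trans ub; rewrite ler_nat hF_le.
rewrite -hE -ler_pdivlMr // in lb; rewrite -ler_pdivrMr // in ub'.
by rewrite ler_distl; apply/andP; split; [move: ub'|move: lb]; lra.
Qed.
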